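(* Let $(X_t)_{t\in\mathbb{Z}}$ be a strictly stationary $\mathbb{R}^d$-valued sequence which is regularly varying with index $\alpha>0$. Let $A\subset\overline{\mathbb{R}}^d_0$ be a Borel set bounded away from zero such that $A$ is a continuity set with respect to $\mu_0$ and, for every $h\ge 1$, the sets $A\times\overline{\mathbb{R}}^{dh}$ and $A\times\overline{\mathbb{R}}^{d(h-1)}\times A$ are continuity sets with respect to $\mu_h$; assume $\mu_0(A)>0$. Assume that conditions (M) and (M1) (defined in the context) and $\sum_{h\ge1}\rho_A(h)<\infty$ hold. Let $0<\lambda_1<\cdots<\lambda_N<\pi$ be fixed frequencies, $N\ge1$. Then, as $n\to\infty$, $$\mathbf Z_n=\big(\alpha_n(\lambda_i),\beta_n(\lambda_i)\big)_{i=1,\ldots,N}\xrightarrow{d}\big(\alpha(\lambda_i),\beta(\lambda_i)\big)_{i=1,\ldots,N},$$ where the limiting vector has the $N(\mathbf 0,\Sigma_N)$ distribution with $$\Sigma_N=\mu_0(A)\operatorname{diag}\big(f_A(\lambda_1),f_A(\lambda_1),\ldots,f_A(\lambda_N),f_A(\lambda_N)\big).$$ The limit relation remains valid if the frequencies $\lambda_i$, $i=1,\ldots,N$, in $\mathbf Z_n$ are replaced by distinct Fourier frequencies $\omega_i(n)\to\lambda_i\in(0,\pi)$ as $n\to\infty$; here the limits $\lambda_i$ do not have to be distinct.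
   Context: Notation: $\overline{\mathbb{R}}=\mathbb{R}\cup\{\pm\infty\}$, $\overline{\mathbb{R}}^k_0=\overline{\mathbb{R}}^k\setminus\{\mathbf 0\}$. A set is bounded away from zero if its closure does not contain $\mathbf 0$. Regular variation: the strictly stationary sequence $(X_t)$ is regularly varying with index $\alpha>0$ if, with $(a_n)$ chosen such that $a_n\to\infty$ and $nP(|X_0|>a_n)\to1$, for every $h\ge0$ there is a non-null Radon measure $\mu_h$ on the Borel $\sigma$-field of $\overline{\mathbb{R}}^{d(h+1)}_0$ (where bounded sets are those bounded away from zero) such that, with $Y_h=(X_0,\ldots,X_h)$, $nP(a_n^{-1}Y_h\in\cdot)\to\mu_h(\cdot)$ vaguely, and $\mu_h(tC)=t^{-\alpha}\mu_h(C)$ for $t>0$ and Borel $C$ (equivalently $P(x^{-1}Y_h\in\cdot)/P(|X_0|>x)\to\mu_h(\cdot)$ vaguely as $x\to\infty$). Extremogram and spectral density: $\rho_A(h)=\lim_{x\to\infty}P(x^{-1}X_h\in A\mid x^{-1}X_0\in A)$, $h\ge0$ (the limit exists under the stated continuity conditions), $\rho_A(-h)=\rho_A(h)$, and $f_A(\lambda)=\sum_{h\in\mathbb{Z}}\rho_A(h)e^{-ih\lambda}$, $\lambda\in[0,\pi]$. Condition (M): $(X_t)$ is strongly mixing with rate function $(\xi_h)$, $\xi_h=\sup\{|P(C\cap D)-P(C)P(D)|: C\in\sigma(X_s,s\le0), D\in\sigma(X_s,s\ge h)\}\to0$. There exist integer sequences $m=m_n\to\infty$, $r_n\to\infty$ with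 $m_n/n\to0$, $r_n/m_n\to0$, $\lim_{n\to\infty}m_n\sum_{h=r_n}^\infty\xi_h=0$, and for all $\epsilon>0$, $\lim_{k\to\infty}\limsup_{n\to\infty}m_n\sum_{h=k}^{r_n}P(|X_h|>\epsilon a_m,|X_0|>\epsilon a_m)=0$, where $a_m=a_{m_n}$. These $(m_n),(r_n)$ are used throughout. Condition (M1): the sequences $(m_n),(r_n)$ from (M) and $k_n=[n/m_n]$ also satisfy $k_n\xi_{r_n}\to0$ and $m_n=o(n^{1/3})$. Set $I_t=\mathbf 1\{X_t/a_m\in A\}$, $p_0=P(a_m^{-1}X_0\in A)$, $\widetilde I_t=I_t-p_0$, and $$\alpha_n(\lambda)=\Big(\frac{2m_n}{n}\Big)^{1/2}\sum_{t=1}^n\widetilde I_t\cos(\lambda t),\qquad \beta_n(\lambda)=\Big(\frac{2m_n}{n}\Big)^{1/2}\sum_{t=1}^n\widetilde I_t\sin(\lambda t).$$ A Fourier frequency (for sample size $n$) is a number of the form $2\pi j/n$ with integer $j$. *)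

(* Defs.v *)
From HB Require Import structures.
From mathcomp Require Import all_boot all_order all_algebra.
From mathcomp Require Import all_classical all_reals all_analysis.
From mathcomp Require Import complex.

Set Implicit Arguments.
Unset Strict Implicit.
Unset Printing Implicit Defensive.

Import Order.TTheory GRing.Theory Num.Theory.
Import numFieldNormedType.Exports.

Local Open Scope classical_set_scope.
Local Open Scope ring_scope.

Notation borel S := (g_sigma_algebraType (@open S)).

(* No particular norm |.| on R^d is fixed: the results are stated for every norm. *)
Definition is_norm (R : realType) (d : nat) (N : 'rV[R]_d -> R) : Prop :=
  [/\ forall x y, N (x + y) <= N x + N y,
      forall (c : R) x, N (c *: x) = `|c| * N x
    & forall x, N x = 0 -> x = 0].

Section punctured_space.
Context {R : realType} {k d : nat}.
Implicit Types (B : set 'M[\bar R]_(k, d)).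

(* A point of (R^d)^k, or of its compactification, is a k x d matrix whose rows
   are the k vectors. *)

Definition bounded_away B : Prop := ~ closure B (const_mx 0%E).

Definition erescale (s : R) (x : 'M[R]_(k, d)) : 'M[\bar R]_(k, d) :=
  map_mx EFin (s^-1 *: x).

Definition edilate (t : R) (x : 'M[\bar R]_(k, d)) : 'M[\bar R]_(k, d) :=
  map_mx (fun y => (t%:E * y)%E) x.

(* Measures on the punctured space are represented by measures on the whole
   space without mass at the origin. *)
Definition punctured_radon (mu : {measure set (borel 'M[\bar R]_(k, d)) -> \bar R})
    : Prop :=
  mu [set const_mx 0%E] = 0%E /\
  forall B : set (borel 'M[\bar R]_(k, d)),
    measurable B -> bounded_away B -> (mu B < +oo)%E.

Definition continuity_set
    (mu : {measure set (borel 'M[\bar R]_(k, d)) -> \bar R}) B : Prop :=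
  mu (closure B `\` interior B) = 0%E.

(* Nonnegative continuous functions with compact support in the punctured space,
   extended by 0 at the origin. *)
Definition vague_test (f : 'M[\bar R]_(k, d) -> R) : Prop :=
  [/\ continuous f, forall x, 0 <= f x & bounded_away [set x | f x != 0]].

End punctured_space.

Section stationary_sequence.
Context {R : realType} {dsp : measure_display} {T : measurableType dsp}.
Variables (P : probability T R) (d : nat).
Variable X : int -> T -> 'rV[R]_d.

Definition random_vectors : Prop :=
  forall t, measurable_fun [set: T] (X t : T -> borel 'rV[R]_d).

Definition block (n : nat) (t : 'I_n -> int) (w : T) : 'M[R]_(n, d) :=
  \matrix_(i < n) X (t i) w.

Definition strictly_stationary : Prop :=
  forall (n : nat) (t : 'I_n -> int) (s : int) (B : set (borel 'M[R]_(n, d))),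
    measurable B ->
    P [set w | B (block (fun i => t i + s) w)] = P [set w | B (block t w)].

Definition regularly_varying (N : 'rV[R]_d -> R) (alpha : R) (a : nat -> R)
    (mu : forall h : nat, {measure set (borel 'M[\bar R]_(h.+1, d)) -> \bar R})
    : Prop :=
  [/\ a n @[n --> \oo] --> +oo,
      (n%:R%:E * P [set w | (a n < N (X 0 w))%R])%E @[n --> \oo] --> 1%E
    & forall h : nat,
      [/\ punctured_radon (mu h),
          mu h [set: _] != 0%E,
          forall f, vague_test f ->
            (n%:R%:E * \int[P]_w
               (f (erescale (a n) (block (fun i : 'I_h.+1 => i%:Z) w)))%:E)%E
              @[n --> \oo] --> (\int[mu h]_x (f x)%:E)%E
        & forall (t : R) (C : set (borel 'M[\bar R]_(h.+1, d))),
            0 < t -> measurable C ->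
            mu h [set edilate t x | x in C] = ((t `^ (- alpha))%:E * mu h C)%E]].

(* For h < 0 this is the extension by evenness. *)
Definition extremogram (A : set 'rV[\bar R]_d) (h : int) : R :=
  lim (fine (P [set w | A (erescale x (X `|h|%N w)) /\ A (erescale x (X 0 w))])
       / fine (P [set w | A (erescale x (X 0 w))]) @[x --> +oo]).

Definition sigma_of (S : set int) : set (set T) :=
  <<s \bigcup_(s in S) preimage_set_system [set: T] (X s)
        (measurable : set (set (borel 'rV[R]_d))) >>.

Definition mixing_rate (h : nat) : R :=
  sup [set `|fine (P (C `&` D)) - fine (P C) * fine (P D)|
      | C in sigma_of [set s | s <= 0] & D in sigma_of [set s | h%:Z <= s]].

Definition condition_M (N : 'rV[R]_d -> R) (a : nat -> R) (m r : nat -> nat)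
    : Prop :=
  [/\ mixing_rate h @[h --> \oo] --> 0,
      [/\ m n @[n --> \oo] --> \oo, r n @[n --> \oo] --> \oo,
          (m n)%:R / n%:R @[n --> \oo] --> (0 : R)
        & (r n)%:R / (m n)%:R @[n --> \oo] --> (0 : R)],
      ((m n)%:R%:E * \sum_(r n <= h <oo) (mixing_rate h)%:E)%E
        @[n --> \oo] --> 0%E
    & forall eps : R, 0 < eps ->
        limn_esup (fun n => (m n)%:R%:E * \sum_(k <= h < (r n).+1)
            P [set w | (eps * a (m n) < N (X h w))%R
              /\ (eps * a (m n) < N (X 0 w))%R])%E
          @[k --> \oo] --> 0%E].

Definition condition_M1 (m r : nat -> nat) : Prop :=
  (n %/ m n)%:R * mixing_rate (r n) @[n --> \oo] --> 0 /\
  (m n)%:R / (n%:R `^ 3^-1) @[n --> \oo] --> (0 : R).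

Section periodogram_ordinates.
Variables (a : nat -> R) (m : nat -> nat) (A : set 'rV[\bar R]_d).

Definition centered_exceedance (n t : nat) (w : T) : R :=
  \1_A (erescale (a (m n)) (X t w))
  - fine (P [set w' | A (erescale (a (m n)) (X 0 w'))]).

Definition alpha_n (n : nat) (lambda : R) (w : T) : R :=
  Num.sqrt (2 * (m n)%:R / n%:R) *
  \sum_(1 <= t < n.+1) centered_exceedance n t w * cos (lambda * t%:R).

Definition beta_n (n : nat) (lambda : R) (w : T) : R :=
  Num.sqrt (2 * (m n)%:R / n%:R) *
  \sum_(1 <= t < n.+1) centered_exceedance n t w * sin (lambda * t%:R).

(* [mxvec] is row-major: the entries of [Z_n] are
   alpha_n(l_1), beta_n(l_1), alpha_n(l_2), beta_n(l_2), etc. *)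
Definition Z_n (K n : nat) (lambda : 'I_K -> R) (w : T) : 'rV[R]_(K * 2) :=
  mxvec (\matrix_(i < K, j < 2)
    if j == 0 then alpha_n n (lambda i) w else beta_n n (lambda i) w).

End periodogram_ordinates.

End stationary_sequence.

Section spectral_density.
Context {R : realType}.
Variable rho : int -> R.

Definition cexpi (x : R) : R[i] := Complex (cos x) (sin x).

(* the sum over |h| <= n, with h = j - n *)
Definition spectral_psum (lambda : R) (n : nat) : R[i] :=
  \sum_(j < n.*2.+1)
    Complex (rho (j%:Z - n%:Z)) 0 * cexpi (- ((j%:Z - n%:Z)%:~R * lambda)).

(* [spectral_psum_real] below: taking real parts loses nothing for even rho. *)
Definition spectral_density (lambda : R) : R :=
  limn (fun n => complex.Re (spectral_psum lambda n)).

End spectral_density.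

Lemma spectral_psum_real (R : realType) (rho : int -> R) (lambda : R) (n : nat) :
  (forall h, rho (- h) = rho h) -> complex.Im (spectral_psum rho lambda n) = 0.
Proof.
move=> rhoN; rewrite /spectral_psum raddf_sum/=.
pose F (j : 'I_n.*2.+1) : R :=
  rho (j%:Z - n%:Z) * sin (- ((j%:Z - n%:Z)%:~R * lambda)).
rewrite (eq_bigr F); last by move=> j _; rewrite /F /= mul0r addr0.
suff E : \sum_j F j = - \sum_j F j.
  by apply/eqP; rewrite -[_ == 0](mulrn_eq0 _ 2) mulr2n {1}E addNr.
rewrite [LHS](reindex_inj rev_ord_inj)/= -sumrN; apply: eq_bigr => j _.
have jE : (rev_ord j)%:Z - n%:Z = - (j%:Z - n%:Z).
  rewrite /= subSS -subzn; last by rewrite -ltnS.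
  by rewrite -[X in Posz X - _ - _]addnn PoszD opprB addrAC addrK.
by rewrite /F jE rhoN rmorphN/= mulNr opprK sinN mulrN opprK.
Qed.

Section weak_convergence.
Context {R : realType}.

Definition is_std_normal (l : nat) (gam : probability (borel 'rV[R]_l) R) : Prop :=
  forall B : 'I_l -> set R, (forall i, measurable (B i)) ->
    fine (gam [set x | forall i, B i (x 0 i)])
    = \prod_(i < l) fine (normal_prob 0 1 (B i)).

(* The law of m + z M for a standard normal row vector z, with M^T M = S; S may
   be singular.  ([normal_prob m 0] in the library is not a Dirac mass, so normal
   marginals with zero variance cannot be expressed through it.) *)
Definition is_normal (k : nat) (nu : probability (borel 'rV[R]_k) R)
    (m : 'rV[R]_k) (S : 'M[R]_k) : Prop :=
  exists (l : nat) (M : 'M[R]_(l, k)) (gam : probability (borel 'rV[R]_l) R),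
    [/\ is_std_normal gam, M^T *m M = S
      & forall B : set (borel 'rV[R]_k), measurable B ->
          nu B = gam [set z | B (m + z *m M)]].

Definition cvg_in_distribution (dsp : measure_display) (T : measurableType dsp)
    (P : probability T R) (k : nat) (Z : nat -> T -> 'rV[R]_k)
    (nu : probability (borel 'rV[R]_k) R) : Prop :=
  forall f : 'rV[R]_k -> R, continuous f -> (exists b, forall x, `|f x| <= b) ->
    (\int[P]_w (f (Z n w))%:E)%E @[n --> \oo] --> (\int[nu]_x (f x)%:E)%E.

Definition fourier_frequency (n : nat) (omega : R) : Prop :=
  exists j : int, omega = 2 * pi * j%:~R / n%:R.

End weak_convergence.

(* Main.v *)
Require Import Defs.
From HB Require Import structures.
From mathcomp Require Import all_boot all_order all_algebra.
From mathcomp Require Import all_classical all_reals all_analysis.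
From mathcomp Require Import measurable_realfun complex.
From mathcomp Require Import zify ring lra.

Set Implicit Arguments.
Unset Strict Implicit.
Unset Printing Implicit Defensive.

Import Order.TTheory GRing.Theory Num.Theory.
Import numFieldNormedType.Exports.

Local Open Scope classical_set_scope.
Local Open Scope ring_scope.

(** Write I_t for the exceedance indicators and p for their mean, of order 1 / m.
  A linear functional of the vector of periodogram ordinates is
  kappa * sum_t w_t (I_t - p), where kappa ^ 2 = 2 m / n and the weights w_t are
  bounded trigonometric sums in t.  By Levy's continuity theorem, it is enough to
  show that the mean of its cosine, with an arbitrary phase, tends to that of a
  normal variable, the limits of the variances giving tightness.

  Variance.  Sorted by lag, the variance is the sum over h of m cov (I_0, I_h)
  times averages over t of w_t w_{t + h}.  These averages converge
  ([lag_average_cvg]): the oscillating products of distinct frequencies, and of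
  sines with cosines, average out, for fixed frequencies because sums of cosines
  in arithmetic progression are bounded and for Fourier frequencies because they
  vanish exactly.  This is why the limiting ordinates are independent.  Regular
  variation gives m cov (I_0, I_h) -> mu_0 (A) rho_A (h) ([exceed_cov_cvg]), and
  the anti-clustering and mixing conditions make large lags uniformly negligible
  ([exceed_cov_tail]).  Summing over h produces the spectral density
  ([variance_cvg], [spectral_series_cvg]).

  The extremogram is a limit along real thresholds x, whereas vague convergence
  is given along the sequence a_n.  The two are matched by the sample size n (x)
  for which n (x) P (N (X_0) > x) -> 1: homogeneity of the limit measure forces
  a_{n (x)} / x -> 1, and in a metric of the compactified space a change of scale
  by a factor close to 1 moves every point by little, so that the portmanteau
  theorem still applies ([vague_cvg_scaled], [rv_cvg_real]).

  Normality.  For a fixed n everything is a function of the finite pattern of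
  exceedances.  The pattern is cut into blocks of length m separated by gaps of
  length r.  A block contributes at most a multiple of (m ^ 3 / n) ^ (1 / 2) to
  the sum, which tends to 0, so second-order Taylor expansions are accurate; the
  blocks are peeled off one at a time, at the expense of a multiple of the mixing
  coefficient at r for each of the n / m blocks ([mean_cos_sum],
  [mean_cos_gaussian]).  Letting n tend to infinity gives [trig_total_clt].

  All characteristic functions are handled through cos (u + c) with a phase c,
  which keeps the arguments within the real numbers. *)

(** * Taylor bounds and trigonometric sums *)

Section taylor_bounds.
Context {R : realType}.
Implicit Types (f : R -> R) (x y : R).

(** The alternating Taylor bounds for sine, cosine and exponential follow from
  one another by integration from 0, each being the derivative of the next one.
  *)
Lemma ge0_of_derive f f' : (forall x, is_derive x 1 f (f' x)) -> f 0 = 0 ->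
  (forall x, 0 <= x -> 0 <= f' x) -> forall x, 0 <= x -> 0 <= f x.
Proof.
move=> df f0 f'0 x x0.
have dv y : derivable f y 1 by case: (df y).
have := @ger0_derive1_ndecry R f 0 _ _ _ 0 x (lexx _) x0; rewrite f0; apply.
- by move=> y _; exact: dv.
- move=> y; rewrite in_itv/= andbT => /ltW y0.
  by rewrite derive1E; have [_ ->] := df y; exact: f'0.
- apply: continuous_subspaceT => y.
  exact/differentiable_continuous/derivable1_diffP.
Qed.

Lemma sin_le_id x : 0 <= x -> sin x <= x.
Proof.
move=> x0; rewrite -subr_ge0.
apply: (@ge0_of_derive (fun x => x - sin x) (fun x => 1 - cos x)) => //.
by rewrite sin0 subrr.
Qed.

Lemma cos_ge x : 1 - x ^+ 2 / 2 <= cos x.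
Proof.
wlog x0 : x / 0 <= x.
  move=> H; have [|/ltW x0] := leP 0 x; first exact: H.
  by rewrite -cosN -sqrrN; apply: H; rewrite oppr_ge0.
rewrite -subr_ge0.
apply: (@ge0_of_derive (fun x => cos x - (1 - x ^+ 2 / 2))
   (fun x => x - sin x)) => //.
- by move=> y; apply: is_derive_eq; rewrite /GRing.scale/=; lra.
- by rewrite cos0 expr2; lra.
- by move=> y y0; rewrite subr_ge0 sin_le_id.
Qed.

Lemma sin_ge x : 0 <= x -> x - x ^+ 3 / 6 <= sin x.
Proof.
move=> x0; rewrite -subr_ge0.
apply: (@ge0_of_derive (fun x => sin x - (x - x ^+ 3 / 6))
   (fun x => cos x - (1 - x ^+ 2 / 2))) => //.
- by move=> y; apply: is_derive_eq; rewrite /GRing.scale/=; lra.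
- by rewrite sin0 expr0n/=; lra.
- by move=> y y0; rewrite subr_ge0 cos_ge.
Qed.

Lemma cos_le x : cos x <= 1 - x ^+ 2 / 2 + x ^+ 4 / 24.
Proof.
wlog x0 : x / 0 <= x.
  move=> H; have [|/ltW x0] := leP 0 x; first exact: H.
  have := H (- x); rewrite oppr_ge0 => /(_ x0).
  by rewrite cosN sqrrN (exprM _ 2 2) sqrrN -exprM.
rewrite -subr_ge0.
apply: (@ge0_of_derive (fun x => 1 - x ^+ 2 / 2 + x ^+ 4 / 24 - cos x)
   (fun x => sin x - (x - x ^+ 3 / 6))) => //.
- by move=> y; apply: is_derive_eq; rewrite /GRing.scale/=; lra.
- by rewrite cos0 !expr0n/=; lra.
- by move=> y y0; rewrite subr_ge0 sin_ge.
Qed.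

Lemma expR_le x : 0 <= x -> expR (- x) <= 1 - x + x ^+ 2 / 2.
Proof.
move=> x0; rewrite -subr_ge0.
apply: (@ge0_of_derive (fun x => 1 - x + x ^+ 2 / 2 - expR (- x))
   (fun x => expR (- x) - (1 - x))) => //.
- by move=> y; apply: is_derive_eq; rewrite /GRing.scale/=; lra.
- by rewrite oppr0 expR0 !expr0n/=; lra.
- move=> y y0; rewrite subr_ge0; exact: expR_ge1Dx.
Qed.

Lemma normr_sin_le x : `|sin x| <= `|x|.
Proof.
wlog x0 : x / 0 <= x.
  move=> H; have [|/ltW x0] := leP 0 x; first exact: H.
  by rewrite -normrN -sinN -[leRHS]normrN; apply: H; rewrite oppr_ge0.
rewrite (ger0_norm x0) ler_norml sin_le_id// andbT.
have [x1|x1] := leP x 1.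
  apply: (@le_trans _ _ 0); first by rewrite oppr_le0.
  apply: le_trans (sin_ge x0); rewrite subr_ge0.
  have : x ^+ 3 <= x by rewrite -[leRHS]expr1 ler_wiXn2l// x0.
  lra.
by apply: le_trans (sin_geN1 _); rewrite lerNl opprK ltW.
Qed.

Lemma cos_lipschitz x y : `|cos x - cos y| <= `|x - y|.
Proof.
have -> : cos x - cos y = - (2 * sin ((x + y) / 2) * sin ((x - y) / 2)).
  have := cosD ((x + y) / 2) ((x - y) / 2).
  have := cosB ((x + y) / 2) ((x - y) / 2).
  have -> : (x + y) / 2 + (x - y) / 2 = x by lra.
  have -> : (x + y) / 2 - (x - y) / 2 = y by lra.
  lra.
rewrite normrN !normrM ger0_norm//.
have -> : `|x - y| = 2 * 1 * `|(x - y) / 2|.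
  by rewrite normrM [`|2^-1|]ger0_norm ?invr_ge0//; lra.
apply: ler_pM => //; last exact: normr_sin_le.
by apply: ler_pM => //; exact: sin_max.
Qed.

(** The error is stated relative to x ^ 2 because the means of squares are what
  is under control when x is random; of x itself only a small uniform bound e is
  known. *)
Lemma cos_taylor2 x (e : R) : `|x| <= e -> e <= 1 ->
  `|cos x - (1 - x ^+ 2 / 2)| <= e * x ^+ 2.
Proof.
move=> xe e1; rewrite ger0_norm ?subr_ge0 ?cos_ge//.
rewrite lerBlDr; apply: le_trans (cos_le x) _.
have e0 : 0 <= e := le_trans (normr_ge0 _) xe.
have : x ^+ 2 <= e.
  rewrite -(real_normK (num_real x)) expr2.
  by apply: le_trans (ler_pM _ _ xe (le_trans xe e1)) _; rewrite ?mulr1.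
move=> x2e; have x20 := sqr_ge0 x.
have -> : x ^+ 4 = x ^+ 2 * x ^+ 2 by rewrite -exprD.
nra.
Qed.

Lemma sin_taylor1 x (e : R) : `|x| <= e -> `|sin x - x| <= e * x ^+ 2.
Proof.
move=> xe.
apply: (@le_trans _ _ (`|x| ^+ 3 / 6)); last first.
  rewrite exprS real_normK ?num_real//.
  have := sqr_ge0 x; have := normr_ge0 x; nra.
wlog x0 : x {xe} / 0 <= x.
  move=> H; have [|/ltW x0] := leP 0 x; first exact: H.
  have := H (- x); rewrite oppr_ge0 => /(_ x0).
  by rewrite sinN -opprD !normrN.
rewrite (ger0_norm x0) ler_norml; apply/andP; split.
  by have := sin_ge x0; lra.
have := sin_le_id x0; have := exprn_ge0 3 x0; lra.
Qed.

Lemma expRN_taylor1 x (e : R) : 0 <= x -> x <= e ->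
  `|expR (- x) - (1 - x)| <= e * x.
Proof.
move=> x0 xe; have := expR_le x0; have := expR_ge1Dx (- x); rewrite expr2 => h1 h2.
by rewrite ger0_norm; [nra|lra].
Qed.

End taylor_bounds.

Section trigonometric_sums.
Context {R : realType}.

(** The factor 2 sin (th / 2) makes the sum telescope. *)
Lemma sum_cos_arith (th c : R) n :
  2 * sin (th / 2) * (\sum_(1 <= t < n.+1) cos (th * t%:R + c)) =
  sin (th * n%:R + th / 2 + c) - sin (th / 2 + c).
Proof.
elim: n => [|n IH]; first by rewrite big_geq// mulr0 mulr0 add0r subrr.
rewrite big_nat_recr//= mulrDr IH.
set x := th * n.+1%:R + c.
have -> : th * n.+1%:R + th / 2 + c = x + th / 2 by rewrite /x; lra.
have -> : th * n%:R + th / 2 + c = x - th / 2.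
  by rewrite /x -(natr1 n); lra.
rewrite sinB (sinD x); lra.
Qed.

Lemma sum_cos_bound (th c : R) n : sin (th / 2) != 0 ->
  `|\sum_(1 <= t < n.+1) cos (th * t%:R + c)| <= `|sin (th / 2)|^-1.
Proof.
move=> s0; rewrite -(ler_pM2l (_ : 0 < 2 * `|sin (th / 2)|)); last first.
  by rewrite mulr_gt0// normr_gt0.
rewrite -[X in X * _ <= _](ger0_norm (_ : 0 <= 2 * `|sin (th / 2)|)); last first.
  by rewrite mulr_ge0.
rewrite -normrM.
have -> : `|2 * `|sin (th / 2)| * \sum_(1 <= t < n.+1) cos (th * t%:R + c)|
    = `|2 * sin (th / 2) * \sum_(1 <= t < n.+1) cos (th * t%:R + c)|.
  by rewrite !normrM normr_id.
rewrite sum_cos_arith mulfK ?normr_eq0//.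
apply: le_trans (ler_normB _ _) _.
by have -> : 2 = 1 + 1 :> R by []; apply: lerD; exact: sin_max.
Qed.

Lemma sin_add_2pi_int (x : R) (j : int) : sin (x + 2 * pi * j%:~R) = sin x.
Proof.
have H (y : R) (k : nat) : sin (y + 2 * pi * k%:R) = sin y.
  elim: k => [|k IH]; first by rewrite mulr0 addr0.
  by rewrite -(natr1 k) mulrDr mulr1 addrA [2 * pi]mulr_natl sinD2pi -mulr_natl IH.
case: j => k; first exact: H.
by rewrite NegzE mulrNz mulrN -(H (x - _) k.+1) subrK.
Qed.

(** The frequency th completes an integral number of turns in n steps, so the
  two ends of the telescoping sum coincide. *)
Lemma sum_cos_fourier (th c : R) n : (0 < n)%N -> fourier_frequency n th ->
  sin (th / 2) != 0 -> \sum_(1 <= t < n.+1) cos (th * t%:R + c) = 0.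
Proof.
move=> n0 [j thE] s0.
have s20 : 2 * sin (th / 2) != 0 by rewrite mulf_neq0.
apply/eqP; rewrite -[_ == 0]orFb -(negbTE s20) -mulf_eq0 sum_cos_arith.
have -> : th * n%:R = 2 * pi * j%:~R.
  by rewrite thE mulfVK// pnatr_eq0 -lt0n.
by rewrite -addrA addrC sin_add_2pi_int subrr.
Qed.

End trigonometric_sums.

Lemma cvg_sum_fin {R : realType} {T : Type} {F : set_system T} {FF : Filter F}
    (I : Type) (r : seq I) (f : I -> T -> R) (l : I -> R) :
  (forall i, f i x @[x --> F] --> l i) ->
  \sum_(i <- r) f i x @[x --> F] --> \sum_(i <- r) l i.
Proof.
move=> fl; elim: r => [|i r IH].
  by rewrite big_nil; under eq_fun do rewrite big_nil; exact: cvg_cst.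
rewrite big_cons; under eq_fun do rewrite big_cons.
exact: cvgD.
Qed.

(** * Sums of weakly dependent variables under a finite law *)

Section cut_norm.
Context {R : realType} {I J : finType}.
Variables (c : I -> J -> R) (xi : R).
Hypothesis c_cut : forall (P : pred I) (Q : pred J),
  `|\sum_(i | P i) \sum_(j | Q j) c i j| <= xi.

(** The worst G is the sign of h, and the sign splits the index set into two
  parts on which the hypothesis applies. *)
Lemma sum_sign_split (K : finType) (G h : K -> R) (e : R) :
  (forall k, `|G k| <= 1) ->
  (forall Q : pred K, `|\sum_(k | Q k) h k| <= e) ->
  `|\sum_k G k * h k| <= 2 * e.
Proof.
move=> G1 he; apply: le_trans (ler_norm_sum _ _ _) _.
apply: (@le_trans _ _ (\sum_k `|h k|)).
  by apply: ler_sum => k _; rewrite normrM ler_piMl.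
rewrite (bigID (fun k => 0 <= h k))/= mulr_natl mulr2n; apply: lerD.
- rewrite (eq_bigr h) => [|k /ger0_norm//].
  exact: le_trans (ler_norm _) (he _).
- rewrite (eq_bigr (fun k => - h k)) => [|k]; last first.
    by rewrite -ltNge => /ltr0_norm.
  rewrite sumrN; apply: le_trans (he (fun k => ~~ (0 <= h k))).
  by rewrite -normrN; exact: ler_norm.
Qed.

(** One factor 2 for each of the two functions. *)
Lemma cut_norm_bilinear (F : I -> R) (G : J -> R) :
  (forall i, `|F i| <= 1) -> (forall j, `|G j| <= 1) ->
  `|\sum_i F i * \sum_j G j * c i j| <= 4 * xi.
Proof.
move=> F1 G1; have -> : 4 * xi = 2 * (2 * xi) by lra.
apply: sum_sign_split => // P.
rewrite exchange_big/= (eq_bigr (fun j => G j * \sum_(i | P i) c i j)); last first.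
  by move=> j _; rewrite mulr_sumr.
apply: sum_sign_split => // Q.
by rewrite exchange_big.
Qed.

End cut_norm.

Section finite_law.
Context {R : realType} {S : finType}.
Variables (p : S -> R).
Implicit Types (F G : S -> R).

Definition mean F : R := \sum_u p u * F u.

Lemma eq_mean F G : F =1 G -> mean F = mean G.
Proof. by move=> FG; apply: eq_bigr => u _; rewrite FG. Qed.

Lemma meanD F G : mean (fun u => F u + G u) = mean F + mean G.
Proof. by rewrite -big_split/=; apply: eq_bigr => u _; rewrite mulrDr. Qed.

Lemma meanZ (k : R) F : mean (fun u => k * F u) = k * mean F.
Proof. by rewrite /mean mulr_sumr; apply: eq_bigr => u _; rewrite mulrCA. Qed.

Lemma meanN F : mean (fun u => - F u) = - mean F.
Proof. by rewrite /mean -sumrN; apply: eq_bigr => u _; rewrite mulrN. Qed.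

Lemma meanB F G : mean (fun u => F u - G u) = mean F - mean G.
Proof. by rewrite meanD meanN. Qed.

Lemma mean_sum (I : Type) (r : seq I) (Q : pred I) (F : I -> S -> R) :
  mean (fun u => \sum_(i <- r | Q i) F i u) = \sum_(i <- r | Q i) mean (F i).
Proof. by rewrite exchange_big; apply: eq_bigr => u _; rewrite mulr_sumr. Qed.

Hypothesis p_ge0 : forall u, 0 <= p u.

Lemma ler_mean F G : (forall u, F u <= G u) -> mean F <= mean G.
Proof. by move=> FG; apply: ler_sum => u _; rewrite ler_wpM2l. Qed.

Lemma normr_mean F : `|mean F| <= mean (fun u => `|F u|).
Proof.
apply: le_trans (ler_norm_sum _ _ _) _.
by apply: ler_sum => u _; rewrite normrM (ger0_norm (p_ge0 u)).
Qed.

Hypothesis p_sum1 : \sum_u p u = 1.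

Lemma mean_cst (k : R) : mean (fun=> k) = k.
Proof. by rewrite /mean -mulr_suml p_sum1 mul1r. Qed.

Lemma normr_mean_le F (b : R) : (forall u, `|F u| <= b) -> `|mean F| <= b.
Proof.
move=> Fb; apply: le_trans (normr_mean _) _.
by rewrite -[leRHS]mean_cst; exact: ler_mean.
Qed.

(** A substitute for the Cauchy-Schwarz inequality without square roots; the
  free parameter e is sent to 0 at the very end. *)
Lemma mean_norm_le_sqr F (e : R) : 0 < e ->
  mean (fun u => `|F u|) <= e + mean (fun u => F u ^+ 2) / e.
Proof.
move=> e0; rewrite -[X in X + _]mean_cst mulrC -meanZ -meanD.
apply: ler_mean => u; rewrite mulrC -(real_normK (num_real (F u))).
set x := `|F u|; have x0 : 0 <= x by exact: normr_ge0.
rewrite -(ler_pM2r e0) mulrDl mulfVK ?gt_eqF//.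
have := sqr_ge0 (x - e); rewrite sqrrB; nra.
Qed.

Definition cov F G := mean (fun u => F u * G u) - mean F * mean G.

(** The characteristic function of a sum of nearly uncorrelated small variables
  is nearly the Gaussian one.  The addition formula peels the variables off one
  at a time; since the mean of each is 0, the sine of the removed variable
  contributes at second order only. *)
Lemma mean_cos_sum (Y : nat -> S -> R) (k : nat) (eta delta c : R) :
  eta <= 1 ->
  (forall j u, `|Y j u| <= eta) ->
  (forall j, mean (Y j) = 0) ->
  (forall j, (j < k)%N ->
    `|cov (fun u => cos (\sum_(i < j) Y i u + c)) (fun u => cos (Y j u))| <= delta /\
    `|cov (fun u => sin (\sum_(i < j) Y i u + c)) (fun u => sin (Y j u))| <= delta) ->
  `|mean (fun u => cos (\sum_(i < k) Y i u + c))
    - expR (- ((\sum_(i < k) mean (fun u => Y i u ^+ 2)) / 2)) * cos c|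
  <= k%:R * (2 * delta) + 3 * eta * \sum_(i < k) mean (fun u => Y i u ^+ 2).
Proof.
move=> eta1 Yeta Y0; elim: k => [|k IH] kdelta.
  rewrite !big_ord0 mul0r oppr0 expR0 mul1r mul0r mulr0 addr0.
  rewrite (eq_mean (G := fun=> cos c)) ?mean_cst ?subrr ?normr0// => u.
  by rewrite big_ord0 add0r.
have {}IH := IH (fun j jk => kdelta j (ltnW jk)).
have [dc ds] := kdelta k (ltnSn k).
set C := mean (fun u => cos (\sum_(i < k) Y i u + c)) in IH *.
pose v := mean (fun u => Y k u ^+ 2).
set V := \sum_(i < k) mean (fun u => Y i u ^+ 2) in IH *.
have v0 : 0 <= v.
  by rewrite -(mean_cst 0); apply: ler_mean => u; exact: sqr_ge0.
have V0 : 0 <= V.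
  apply: sumr_ge0 => i _.
  by rewrite -(mean_cst 0); apply: ler_mean => u; exact: sqr_ge0.
have [u0 _|S0] := pickP (fun _ : S => true); last first.
  exfalso; move: p_sum1; rewrite big1; last by move=> u; have := S0 u.
  by move/esym/eqP; rewrite oner_eq0.
have eta0 : 0 <= eta := le_trans (normr_ge0 _) (Yeta 0%N u0).
have veta : v / 2 <= eta.
  rewrite ler_pdivrMr//; apply: (@le_trans _ _ eta); last by lra.
  rewrite -[leRHS]mean_cst; apply: ler_mean => u.
  rewrite -(real_normK (num_real _)) expr2.
  by apply: le_trans (ler_pM _ _ (Yeta k u) (le_trans (Yeta k u) eta1)) _; rewrite ?mulr1.
have Ec : `|mean (fun u => cos (Y k u)) - expR (- (v / 2))| <= 2 * eta * v.
  have h1 : `|mean (fun u => cos (Y k u)) - (1 - v / 2)| <= eta * v.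
    have -> : 1 - v / 2 = mean (fun u => 1 - Y k u ^+ 2 / 2).
      rewrite meanB mean_cst; congr (_ - _); rewrite mulrC -meanZ.
      by apply: eq_mean => u; rewrite mulrC.
    rewrite -meanB; apply: le_trans (normr_mean _) _.
    by rewrite -meanZ; apply: ler_mean => u; exact: cos_taylor2.
  have h2 : `|expR (- (v / 2)) - (1 - v / 2)| <= eta * (v / 2).
    by apply: expRN_taylor1 => //; rewrite divr_ge0.
  move: h1 h2; rewrite !ler_norml => /andP[a1 a2] /andP[b1 b2].
  have ev := mulr_ge0 eta0 v0.
  by apply/andP; split; nra.
have Es : `|mean (fun u => sin (Y k u))| <= eta * v.
  have -> : mean (fun u => sin (Y k u)) = mean (fun u => sin (Y k u) - Y k u).
    by rewrite meanB Y0 subr0.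
  apply: le_trans (normr_mean _) _.
  by rewrite -meanZ; apply: ler_mean => u; exact: sin_taylor1.
have -> : mean (fun u => cos (\sum_(i < k.+1) Y i u + c)) =
    mean (fun u => cos (\sum_(i < k) Y i u + c) * cos (Y k u)) -
    mean (fun u => sin (\sum_(i < k) Y i u + c) * sin (Y k u)).
  rewrite -meanB; apply: eq_mean => u.
  by rewrite big_ord_recr/= addrAC cosD.
rewrite !big_ord_recr/= -/V -/v.
set A := mean _ in dc *; set B := mean _ in ds *.
have hC : `|C| <= 1 by apply: normr_mean_le => u; exact: cos_max.
set Sn := mean (fun u => sin (\sum_(i < k) Y i u + c)) in ds.
have hS : `|Sn| <= 1 by apply: normr_mean_le => u; exact: sin_max.
set ec := mean (fun u => cos (Y k u)) in Ec dc.
set es := mean (fun u => sin (Y k u)) in Es ds.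
(* Errors made by peeling off the last variable: the two covariances, the cosine
   replaced by a Gaussian factor, the sine, and the error of the previous step.
   *)
have -> : A - B - expR (- ((V + v) / 2)) * cos c =
  (A - C * ec) - (B - Sn * es) + C * (ec - expR (- (v / 2))) - Sn * es +
  expR (- (v / 2)) * (C - expR (- (V / 2)) * cos c).
  have -> : - ((V + v) / 2) = - (v / 2) + - (V / 2) by lra.
  rewrite expRD; lra.
have h3 : `|C * (ec - expR (- (v / 2)))| <= 2 * eta * v.
  by rewrite normrM; apply: le_trans Ec; rewrite ler_piMl.
have h4 : `|Sn * es| <= eta * v.
  by rewrite normrM; apply: le_trans Es; rewrite ler_piMl.
have h5 : `|expR (- (v / 2)) * (C - expR (- (V / 2)) * cos c)| <=
    k%:R * (2 * delta) + 3 * eta * V.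
  rewrite normrM; apply: le_trans IH; rewrite ler_piMl//.
  by rewrite ger0_norm ?expR_ge0// -[leRHS]expR0 ler_expR oppr_le0 divr_ge0.
move: dc ds h3 h4 h5; rewrite /cov -/A -/B -/C -/Sn -/ec -/es !ler_norml -(natr1 k).
move=> /andP[? ?] /andP[? ?] /andP[? ?] /andP[? ?] /andP[? ?].
by apply/andP; split; lra.
Qed.

End finite_law.

Section mixing_covariance.
Context {R : realType} {n : nat}.
Local Notation S := {ffun 'I_n -> bool}.
Variable p : S -> R.

(** For an event this says that it belongs to the sigma-algebra generated by the
  coordinates in [D]. *)
Definition depends_on (X : Type) (D : pred 'I_n) (F : S -> X) :=
  forall u v : S, (forall t, D t -> u t = v t) -> F u = F v.

Lemma cov_suml (I : finType) (Q : pred I) (a : I -> R) (F : I -> S -> R) (G : S -> R) :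
  cov p (fun u => \sum_(i | Q i) a i * F i u) G = \sum_(i | Q i) a i * cov p (F i) G.
Proof.
rewrite /cov mean_sum.
rewrite [X in X * _](eq_bigr (fun i => a i * mean p (F i))) => [|i _]; last exact: meanZ.
rewrite mulr_suml (eq_mean _ (G := fun u => \sum_(i | Q i) a i * (F i u * G u))); last first.
  by move=> u; rewrite mulr_suml; apply: eq_bigr => i _; rewrite mulrA.
rewrite mean_sum -sumrB; apply: eq_bigr => i _.
by rewrite meanZ mulrBr mulrA.
Qed.

Lemma covC F G : cov p F G = cov p G F.
Proof.
by rewrite /cov [X in _ - X]mulrC; congr (_ - _); apply: eq_mean => u; rewrite mulrC.
Qed.

Lemma cov_sumr (I : finType) (Q : pred I) (a : I -> R) (F : S -> R) (G : I -> S -> R) :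
  cov p F (fun u => \sum_(i | Q i) a i * G i u) = \sum_(i | Q i) a i * cov p F (G i).
Proof. by rewrite covC cov_suml; apply: eq_bigr => i _; rewrite covC. Qed.

Lemma eq_cov F F' G G' : F =1 F' -> G =1 G' -> cov p F G = cov p F' G'.
Proof.
move=> FE GE; rewrite /cov; congr (_ - _ * _); apply: eq_mean => u //.
by rewrite FE GE.
Qed.

(** Expanding both functions on the patterns of the coordinates that they depend
  on turns the covariance into a bilinear form; its values on indicator
  functions are covariances of events, so the mixing bound is a bound on its cut
  norm. *)
Lemma cov_le_mixing (xi : R) (D1 D2 : pred 'I_n) :
  (forall Q1 Q2 : pred S, depends_on D1 Q1 -> depends_on D2 Q2 ->
    `|cov p (fun u => (Q1 u)%:R) (fun u => (Q2 u)%:R)| <= xi) ->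
  forall F G : S -> R, depends_on D1 F -> depends_on D2 G ->
    (forall u, `|F u| <= 1) -> (forall u, `|G u| <= 1) -> `|cov p F G| <= 4 * xi.
Proof.
move=> mix F G FD GD F1 G1.
pose rho (D : pred 'I_n) (u : S) : S := [ffun t => D t && u t].
pose ind D (v u : S) : R := (rho D u == v)%:R.
have rhoD (X : Type) D (H : S -> X) : depends_on D H -> forall u, H (rho D u) = H u.
  by move=> HD u; apply: HD => t Dt; rewrite ffunE Dt.
have rho_dep D (Q : pred S) : depends_on D (fun u => Q (rho D u)).
  move=> u v uv; congr Q; apply/ffunP => t; rewrite !ffunE.
  by case: (boolP (D t)) => //= /uv.
have expand D (H : S -> R) : depends_on D H -> H =1 (fun u => \sum_v H v * ind D v u).
  move=> HD u; rewrite (bigD1 (rho D u))//= /ind eqxx mulr1 rhoD// big1 ?addr0//.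
  by move=> v; rewrite eq_sym => /negbTE ->; rewrite mulr0.
have indP D (P : pred S) : (fun u => (P (rho D u))%:R) =1
    (fun u => \sum_(v | P v) 1 * ind D v u).
  move=> u; under eq_bigr do rewrite mul1r.
  case: (boolP (P (rho D u))) => Pu.
    rewrite (bigD1 (rho D u))//= /ind eqxx big1 ?addr0//.
    by move=> v /andP[_]; rewrite eq_sym => /negbTE ->.
  rewrite big1// => v Pv; rewrite /ind; case: eqP => // E.
  by rewrite E Pv in Pu.
rewrite (eq_cov (expand _ _ FD) (expand _ _ GD)) cov_suml.
under eq_bigr do rewrite cov_sumr.
apply: cut_norm_bilinear => // P Q.
have -> : \sum_(i | P i) \sum_(j | Q j) cov p (ind D1 i) (ind D2 j) =
    cov p (fun u => (P (rho D1 u))%:R) (fun u => (Q (rho D2 u))%:R).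
  rewrite (eq_cov (indP _ _) (indP _ _)) cov_suml; apply: eq_bigr => i _.
  by rewrite cov_sumr mul1r; apply: eq_bigr => j _; rewrite mul1r.
by apply: mix; exact: rho_dep.
Qed.

End mixing_covariance.

Section stationary_variance.
Context {R : realType}.

(** One of the two truncated differences is 0, so this is |s - t|. *)
Definition dist (s t : nat) : nat := (s - t + (t - s))%N.

Lemma ler_sum_inj (I J : finType) (P : pred I) (phi : I -> J) (g : J -> R) :
  {in P &, injective phi} -> (forall j, 0 <= g j) ->
  \sum_(i | P i) g (phi i) <= \sum_j g j.
Proof.
move=> phiI g0; rewrite -(big_imset g phiI)/= big_mkcond/=.
by apply: ler_sum => j _; case: ifP.
Qed.

(** Seen from s, every lag is met at most twice. *)
Lemma sum_dist_le n (g : nat -> R) (s : 'I_n) : (forall h, 0 <= g h) ->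
  \sum_(t < n) g (dist s t) <= 2 * \sum_(h < n) g h.
Proof.
move=> g0; rewrite mulr_natl mulr2n.
have lt_n (a : nat) (b : 'I_n) : (b - a < n)%N by rewrite (leq_ltn_trans (leq_subr _ _)).
rewrite (bigID (fun t : 'I_n => (t <= s)%N))/=; apply: lerD.
  rewrite (eq_bigr (fun t : 'I_n => g (Ordinal (lt_n t s)))) => [|t ts]; last first.
    by rewrite /dist (eqP ts) addn0.
  apply: (ler_sum_inj (g := fun j : 'I_n => g j)) => // t t' ts ts' [E].
  apply/val_inj/eqP => /=; rewrite -(eqn_add2r (s - t)) {2}E.
  by rewrite !subnKC.
rewrite (eq_bigr (fun t : 'I_n => g (Ordinal (lt_n s t)))) => [|t]; last first.
  by rewrite -ltnNge => /ltnW; rewrite -subn_eq0 => /eqP ts; rewrite /dist ts.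
apply: (ler_sum_inj (g := fun j : 'I_n => g j)) => // t t'.
rewrite /in_mem/= -!ltnNge => ts ts' [E].
by apply/val_inj => /=; rewrite -(subnK (ltnW ts)) E subnK// ltnW.
Qed.

Variables (n : nat) (S : finType) (p : S -> R) (J : 'I_n -> S -> R) (c : nat -> R).
Variables (w : 'I_n -> R) (W : R).
Hypothesis mean_JJ : forall s t, mean p (fun u => J s u * J t u) = c (dist s t).
Hypothesis w_le : forall t, `|w t| <= W.

Lemma mean_sqr_sum (D : pred 'I_n) :
  mean p (fun u => (\sum_(t | D t) w t * J t u) ^+ 2) =
  \sum_(s | D s) \sum_(t | D t) w s * w t * c (dist s t).
Proof.
rewrite (eq_mean _ (G := fun u => \sum_(s | D s) \sum_(t | D t) (w s * w t) * (J s u * J t u))).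
  rewrite mean_sum; apply: eq_bigr => s _; rewrite mean_sum; apply: eq_bigr => t _.
  by rewrite meanZ mean_JJ.
move=> u; rewrite expr2 mulr_suml; apply: eq_bigr => s _; rewrite mulr_sumr.
by apply: eq_bigr => t _; rewrite mulrACA.
Qed.

Let ww_le s t : `|w s * w t * c (dist s t)| <= W ^+ 2 * `|c (dist s t)|.
Proof. by rewrite !normrM ler_wpM2r// expr2 ler_pM. Qed.

Lemma mean_sqr_sum_le (D : pred 'I_n) :
  mean p (fun u => (\sum_(t | D t) w t * J t u) ^+ 2) <=
  W ^+ 2 * #|D|%:R * (2 * \sum_(h < n) `|c h|).
Proof.
rewrite mean_sqr_sum -sum1_card natr_sum mulr_sumr mulr_suml.
apply: ler_sum => s _; rewrite mulr1.
apply: (@le_trans _ _ (\sum_(t < n) W ^+ 2 * `|c (dist s t)|)).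
  apply: le_trans (ler_norm _) _; apply: le_trans (ler_norm_sum _ _ _) _.
  rewrite big_mkcond/=; apply: ler_sum => t _; case: ifP => // _.
  by rewrite mulr_ge0 ?sqr_ge0.
rewrite -mulr_sumr ler_wpM2l ?sqr_ge0//.
exact: (sum_dist_le (g := fun h => `|c h|)).
Qed.

Variables (blk : 'I_n -> nat) (big : pred 'I_n) (k r : nat).
Hypothesis big_blk : forall t, big t -> (blk t < k)%N.
Hypothesis blk_sep : forall s t, big s -> big t -> blk s != blk t -> (r <= dist s t)%N.

(** Up to the covariances at lags at least r and those involving an index
  outside the big blocks, the variances of the blocks add up to that of the
  whole sum. *)
Lemma sum_block_variance :
  `|\sum_(j < k) mean p (fun u => (\sum_(t | big t && (blk t == j)) w t * J t u) ^+ 2) -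
    mean p (fun u => (\sum_t w t * J t u) ^+ 2)| <=
  W ^+ 2 * (2 * #|predC big|%:R * (2 * \sum_(h < n) `|c h|) +
            n%:R * (2 * \sum_(h < n | (r <= h)%N) `|c h|)).
Proof.
pose x s t := w s * w t * c (dist s t).
have -> : \sum_(j < k) mean p (fun u => (\sum_(t | big t && (blk t == j)) w t * J t u) ^+ 2)
    = \sum_s \sum_t (if [&& big s, big t & blk s == blk t] then x s t else 0).
  under eq_bigr do rewrite mean_sqr_sum big_mkcond.
  rewrite exchange_big/=; apply: eq_bigr => s _.
  case: (boolP (big s)) => bs/=; last by rewrite !big1.
  rewrite (bigD1 (Ordinal (big_blk bs)))//= eqxx [X in _ + X]big1 ?addr0; last first.
    by move=> j; rewrite -val_eqE/= eq_sym => /negbTE ->.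
  by rewrite big_mkcond/=; apply: eq_bigr => t _; rewrite eq_sym.
rewrite mean_sqr_sum -sumrB; under eq_bigr do rewrite -sumrB.
(* [a] bounds the pairs with a time outside the big blocks, [b] the pairs of
   times in two different big blocks. *)
pose a (s t : 'I_n) : R := W ^+ 2 * `|c (dist s t)|.
have a0 s t : 0 <= a s t by rewrite mulr_ge0 ?sqr_ge0.
pose b (s t : 'I_n) : R := W ^+ 2 * (if (r <= dist s t)%N then `|c (dist s t)| else 0).
have b0 s t : 0 <= b s t by rewrite mulr_ge0 ?sqr_ge0//; case: ifP.
apply: (@le_trans _ _ (\sum_s \sum_t ((if ~~ big s then a s t else 0) +
   (if ~~ big t then a s t else 0) + b s t))).
  apply: le_trans (ler_norm_sum _ _ _) _; apply: ler_sum => s _.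
  apply: le_trans (ler_norm_sum _ _ _) _; apply: ler_sum => t _.
  case: (boolP (big s)) => bs /=; last first.
    rewrite sub0r normrN -[leLHS]addr0 -addrA lerD ?ww_le//.
    by rewrite addr_ge0//; case: ifP.
  case: (boolP (big t)) => bt /=; last first.
    by rewrite sub0r normrN add0r -[leLHS]addr0 lerD ?ww_le.
  case: eqP => [_|/eqP st]; first by rewrite subrr normr0 !add0r.
  by rewrite sub0r normrN !add0r /b blk_sep// ww_le.
have Ha s : \sum_t a s t <= W ^+ 2 * (2 * \sum_(h < n) `|c h|).
  rewrite -mulr_sumr ler_wpM2l ?sqr_ge0//.
  exact: (sum_dist_le (g := fun h => `|c h|)).
have Hb s : \sum_t b s t <= W ^+ 2 * (2 * \sum_(h < n | (r <= h)%N) `|c h|).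
  rewrite -mulr_sumr ler_wpM2l ?sqr_ge0// [X in _ <= _ * X]big_mkcond/=.
  apply: (sum_dist_le (g := fun h => if (r <= h)%N then `|c h| else 0)) => h.
  by case: ifP.
have Hs : \sum_s (if ~~ big s then W ^+ 2 * (2 * \sum_(h < n) `|c h|) else 0) =
    W ^+ 2 * (#|predC big|%:R * (2 * \sum_(h < n) `|c h|)).
  rewrite -big_mkcond/= sumr_const -[LHS]mulr_natr -mulrA.
  by congr (_ * _); rewrite mulrC.
under eq_bigr do rewrite !big_split/=.
rewrite !big_split/= mulrDr; apply: lerD.
  have -> : W ^+ 2 * (2 * #|predC big|%:R * (2 * \sum_(h < n) `|c h|)) =
      W ^+ 2 * (#|predC big|%:R * (2 * \sum_(h < n) `|c h|)) +
      W ^+ 2 * (#|predC big|%:R * (2 * \sum_(h < n) `|c h|)) by lra.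
  rewrite -Hs; apply: lerD.
    by apply: ler_sum => s _; case: ifP => // _; rewrite ?big1.
  rewrite exchange_big/=; apply: ler_sum => s _; case: ifP => // _; last by rewrite big1.
  apply: le_trans (Ha s); apply: ler_sum => t _.
  by rewrite /a /dist addnC.
rewrite mulrCA; apply: (@le_trans _ _ (\sum_(s < n) W ^+ 2 * (2 * \sum_(h < n | (r <= h)%N) `|c h|))).
  by apply: ler_sum => s _; exact: Hb.
by rewrite sumr_const card_ord -[leLHS]mulr_natl.
Qed.

End stationary_variance.

(** * Bernstein blocks *)

Section one_sample_size.
Context {R : realType}.

Lemma expRN_lipschitz (a b : R) : 0 <= a -> 0 <= b ->
  `|expR (- a) - expR (- b)| <= `|a - b|.
Proof.
wlog ab : a b / a <= b.
  move=> H a0 b0; have [ab|/ltW ba] := leP a b; first exact: H.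
  by have := H _ _ ba b0 a0; rewrite distrC [leRHS]distrC.
move=> a0 b0; rewrite ger0_norm ?subr_ge0 ?ler_expR ?lerN2//.
rewrite distrC ger0_norm ?subr_ge0//.
have -> : - b = - a + - (b - a) by lra.
rewrite expRD -{1}[expR (- a)]mulr1 -mulrBr.
apply: (@le_trans _ _ (1 - expR (- (b - a)))).
  rewrite ler_piMl ?subr_ge0 -?expR0 ?ler_expR; lra.
by have := expR_ge1Dx (- (b - a)); lra.
Qed.

Variables (n m r : nat).
Hypotheses (m_gt0 : (0 < m)%N) (r_le_m : (r <= m)%N).
Local Notation k := (n %/ m)%N.

(** Bernstein blocks: the n times are cut into n / m blocks of length m, and the
  last r times of each block are dropped, together with the incomplete block at
  the end; what remains are big blocks at distance r from each other. *)
Definition big_index (t : 'I_n) : bool := (t %% m < m - r)%N && (t %/ m < k)%N.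

(** The dropped times are numbered consecutively: r for each complete block,
  then the incomplete one. *)
Lemma card_small : (#|predC big_index| <= k * r + m)%N.
Proof.
pose f (t : nat) : nat := (if t %/ m < k then (t %/ m) * r + (t %% m - (m - r))
  else k * r + (t - k * m))%N.
have fE (t : nat) : (t < n)%N -> ~~ ((t %% m < m - r) && (t %/ m < k))%N ->
    (if (t %/ m < k)%N then (f t < k * r)%N &&
       ((0 < r)%N && (t == (f t %/ r) * m + (f t %% r + (m - r)))%N)
     else (f t < k * r + m)%N && (t == f t - k * r + k * m)%N).
  move=> tn; rewrite /f; case: (ltnP (t %/ m)%N k) => [tk|kt].
    rewrite andbT -leqNgt => h.
    have tm := ltn_pmod t m_gt0; set b := (t %% m - (m - r))%N.
    have br : (b < r)%N by rewrite /b; lia.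
    have r0 : (0 < r)%N by exact: leq_ltn_trans br.
    rewrite divnMDl// modnMDl (divn_small br) (modn_small br) r0 addn0 /=.
    apply/andP; split; last by rewrite /b subnK// -divn_eq.
    apply: (@leq_trans ((t %/ m).+1 * r)); last by rewrite leq_mul2r tk orbT.
    by rewrite mulSn addnC ltn_add2r.
  move=> _.
  have : (k * m <= t)%N by apply: leq_trans (leq_trunc_div t m); rewrite leq_mul2r kt orbT.
  have := divn_eq n m; have := ltn_pmod n m_gt0.
  by move: tn; clear; move: (n %/ m * m)%N => q; lia.
have fN (t : 'I_n) : ~~ big_index t -> (f t < k * r + m)%N.
  move=> tb; have := fE t (ltn_ord t) tb; case: ifP => _ /andP[]//.
  by move=> h _; apply: leq_trans h _; rewrite leq_addr.
have N0 : (0 < k * r + m)%N by rewrite addn_gt0 m_gt0 orbT.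
pose phi (t : 'I_n) : 'I_(k * r + m) := insubd (Ordinal N0) (f t).
have phiE t : ~~ big_index t -> phi t = f t :> nat.
  by move=> tb; rewrite /phi /insubd insubT//= fN.
rewrite -(card_in_imset (f := phi)).
  by apply: leq_trans (max_card _) _; rewrite card_ord.
move=> s t; rewrite !inE => sb tb /(congr1 val)/=; rewrite !phiE// => st.
have := fE s (ltn_ord s) sb; have := fE t (ltn_ord t) tb; rewrite -st.
have f_ge (x : nat) : (x %/ m < k)%N = false -> (k * r <= f x)%N.
  by rewrite /f => ->; rewrite leq_addr.
case: ifP => tk; case: ifP => sk.
- move=> /andP[_ /andP[_ /eqP h1]] /andP[_ /andP[_ /eqP h2]].
  exact: ord_inj (etrans h2 (esym h1)).
- by move=> /andP[+ _] _; rewrite ltnNge f_ge.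
- by move=> _ /andP[+ _]; rewrite st ltnNge f_ge.
- move=> /andP[_ /eqP h1] /andP[_ /eqP h2].
  exact: ord_inj (etrans h2 (esym h1)).
Qed.

Local Notation S := {ffun 'I_n -> bool}.
Variables (p : S -> R) (p0 : R) (c : nat -> R) (xi W kappa eta : R).
Hypothesis p_ge0 : forall u, 0 <= p u.
Hypothesis p_sum1 : \sum_u p u = 1.
Hypothesis p0_itv : 0 <= p0 <= 1.
Definition centered (t : 'I_n) (u : S) : R := (u t)%:R - p0.
Hypothesis mean_J : forall t, mean p (centered t) = 0.
Hypothesis mean_JJ :
  forall s t, mean p (fun u => centered s u * centered t u) = c (dist s t).
Hypothesis mixing : forall (a : nat) (Q1 Q2 : pred S),
  depends_on (fun t : 'I_n => t < a)%N Q1 ->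
  depends_on (fun t : 'I_n => a + r <= t)%N Q2 ->
  `|cov p (fun u => (Q1 u)%:R) (fun u => (Q2 u)%:R)| <= xi.
Variable w : 'I_n -> R.
Hypothesis w_le : forall t, `|w t| <= W.
Hypothesis kappa_ge0 : 0 <= kappa.
Hypothesis eta_le1 : eta <= 1.
Hypothesis W_ge0 : 0 <= W.
Hypothesis block_le : kappa * W * m%:R <= eta.

Local Notation Ctot := (\sum_(h < n) `|c h|).
Local Notation Cfar := (\sum_(h < n | (r <= h)%N) `|c h|).
Local Notation small := ((k * r + m)%N%:R : R).

Let Y (j : nat) (u : S) : R :=
  kappa * \sum_(t | big_index t && (t %/ m == j)%N) w t * centered t u.

Let normr_centered t u : `|centered t u| <= 1.
Proof.
by rewrite /centered ler_norml; case: (u t) => /=; move/andP: p0_itv => [? ?]; apply/andP; split; lra.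
Qed.

Lemma card_block (j : nat) :
  (#|[pred t : 'I_n | big_index t && (t %/ m == j)%N]| <= m)%N.
Proof.
pose phi (t : 'I_n) : 'I_m := Ordinal (ltn_pmod t m_gt0).
rewrite -(card_in_imset (f := phi)).
  by apply: leq_trans (max_card _) _; rewrite card_ord.
move=> s t; rewrite !inE => /andP[_ /eqP sj] /andP[_ /eqP tj] /(congr1 val)/= st.
by apply: ord_inj; rewrite (divn_eq s m) (divn_eq t m) sj tj st.
Qed.

Let Y_le j u : `|Y j u| <= eta.
Proof.
apply: le_trans block_le; rewrite /Y normrM (ger0_norm kappa_ge0) -mulrA.
rewrite ler_wpM2l//; apply: le_trans (ler_norm_sum _ _ _) _.
apply: (@le_trans _ _ (\sum_(t < n | big_index t && (t %/ m == j)%N) W)).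
  apply: ler_sum => t _; rewrite normrM -[leRHS]mulr1.
  by apply: ler_pM.
rewrite sumr_const -[X in X <= _]mulr_natr ler_wpM2l// ler_nat.
exact: card_block.
Qed.

Let mean_Y j : mean p (Y j) = 0.
Proof.
rewrite /Y meanZ mean_sum big1 ?mulr0// => t _.
by rewrite meanZ mean_J mulr0.
Qed.

Let Y_dep (j : nat) (D : pred 'I_n) : (forall t, big_index t -> (t %/ m == j)%N -> D t) ->
  depends_on D (Y j).
Proof.
move=> H u v uv; congr (_ * _); apply: eq_bigr => t /andP[bt tj].
by rewrite /centered uv// H.
Qed.

(** The earlier big blocks only involve times before j m - r, and block j only
  times from j m on. *)
Let cov_blocks (f : R -> R) (j : nat) (c0 : R) : (forall x, `|f x| <= 1) ->
  `|cov p (fun u => f (\sum_(i < j) Y i u + c0)) (fun u => f (Y j u))| <= 4 * xi.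
Proof.
have xi0 : 0 <= 4 * xi.
  rewrite mulr_ge0//; apply: le_trans (normr_ge0 _) (mixing (a := 0) (Q1 := xpredT) (Q2 := xpredT) _ _) => //.
move=> f1; case: j => [|j].
  rewrite /cov (eq_mean _ (G := fun u => f c0 * f (Y 0 u))); last first.
    by move=> u; rewrite big_ord0 add0r.
  rewrite meanZ (eq_mean _ (F := fun u => f (_ + c0)) (G := fun=> f c0)); last first.
    by move=> u; rewrite big_ord0 add0r.
  by rewrite mean_cst// subrr normr0.
have rj : (r <= j.+1 * m)%N by rewrite mulSn (leq_trans r_le_m)// leq_addr.
apply: (cov_le_mixing (D1 := fun t : 'I_n => (t < j.+1 * m - r)%N)
    (D2 := fun t : 'I_n => (j.+1 * m - r + r <= t)%N)) => //.
- exact: mixing.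
- move=> u v uv; congr f; congr (_ + _); apply: eq_bigr => i _.
  apply: Y_dep uv => t /andP[h _] /eqP ti.
  rewrite (divn_eq t m) ti.
  have : (i.+1 * m <= j.+1 * m)%N by rewrite leq_mul2r ltn_ord orbT.
  by move: h r_le_m; rewrite (mulSn i); move: (i * m)%N (j.+1 * m)%N (t %% m)%N; clear; lia.
- move=> u v uv; congr f; apply: Y_dep uv => t _ /eqP tj.
  by rewrite subnK// -tj leq_trunc_div.
Qed.

Let blk_sep (s t : 'I_n) : big_index s -> big_index t -> (s %/ m)%N != (t %/ m)%N ->
  (r <= dist s t)%N.
Proof.
wlog st : s t / (s %/ m <= t %/ m)%N.
  move=> H bs bt st; have [/H|/ltnW/H] := leqP (s %/ m) (t %/ m); first exact.
  by rewrite eq_sym /dist addnC; apply.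
move=> /andP[h1 _] _ ne; have {ne}st : (s %/ m < t %/ m)%N by rewrite ltn_neqAle ne.
have : ((s %/ m).+1 * m <= t %/ m * m)%N by rewrite leq_mul2r st orbT.
rewrite mulSn /dist; have := leq_trunc_div t m; have := divn_eq s m.
by move: h1 r_le_m; clear; move: (s %/ m * m)%N (t %/ m * m)%N; lia.
Qed.

Local Notation var_gap :=
  (kappa ^+ 2 * (W ^+ 2 * (2 * small * (2 * Ctot) + n%:R * (2 * Cfar)))).
Local Notation total u := (\sum_t w t * centered t u).
Local Notation V := (kappa ^+ 2 * mean p (fun u => total u ^+ 2)).

(** Bernstein's blocking method with explicit errors. In this order: the
  dependence between consecutive blocks; the Taylor remainders within the
  blocks, each block being at most eta; the dropped times, through their second
  moment; and the difference between the sum of the variances of the blocks and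
  the variance of the whole sum. *)
Lemma mean_cos_gaussian (c0 e : R) : 0 < e ->
  `|mean p (fun u => cos (kappa * total u + c0)) - expR (- (V / 2)) * cos c0| <=
  k%:R * (2 * (4 * xi)) + 3 * eta * (V + var_gap) +
  (e + kappa ^+ 2 * (W ^+ 2 * small * (2 * Ctot)) / e) + var_gap.
Proof.
move=> e0.
pose V' := \sum_(j < k) mean p (fun u => Y j u ^+ 2).
have Ctot0 : 0 <= Ctot by apply: sumr_ge0.
have small_ge : #|predC big_index|%:R <= small by rewrite ler_nat card_small.
have V0 : 0 <= V.
  rewrite mulr_ge0 ?sqr_ge0//; apply: sumr_ge0 => u _.
  by rewrite mulr_ge0 ?sqr_ge0.
have V'0 : 0 <= V'.
  apply: sumr_ge0 => j _; apply: sumr_ge0 => u _.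
  by rewrite mulr_ge0 ?sqr_ge0.
have VV' : `|V' - V| <= var_gap.
  have -> : V' = kappa ^+ 2 * \sum_(j < k) mean p
      (fun u => (\sum_(t | big_index t && (t %/ m == j)%N) w t * centered t u) ^+ 2).
    rewrite mulr_sumr; apply: eq_bigr => j _; rewrite -meanZ.
    by apply: eq_mean => u; rewrite exprMn.
  rewrite -mulrBr normrM ger0_norm ?sqr_ge0// ler_wpM2l ?sqr_ge0//.
  apply: le_trans (sum_block_variance (J := centered) (c := c) (W := W) (big := big_index) (blk := fun t => (t %/ m)%N) (r := r) _ _ _ _) _ => //.
    by move=> t /andP[].
  rewrite ler_wpM2l ?sqr_ge0// lerD2r// ler_wpM2r ?mulr_ge0//.
  by rewrite ler_wpM2l.
have gap0 : 0 <= var_gap := le_trans (normr_ge0 _) VV'.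
have eta0 : 0 <= eta by apply: le_trans block_le; rewrite !mulr_ge0.
(* the cosine of the sum over the big blocks only *)
pose C' := mean p (fun u => cos (\sum_(j < k) Y j u + c0)).
have h1 : `|C' - expR (- (V' / 2)) * cos c0| <= k%:R * (2 * (4 * xi)) + 3 * eta * V'.
  apply: mean_cos_sum => // j jk; split; apply: cov_blocks => x.
    exact: cos_max.
  exact: sin_max.
have h2 : `|expR (- (V' / 2)) * cos c0 - expR (- (V / 2)) * cos c0| <= var_gap.
  rewrite -mulrBl normrM; apply: (@le_trans _ _ `|expR (- (V' / 2)) - expR (- (V / 2))|).
    by rewrite ler_piMr ?cos_max.
  apply: le_trans (expRN_lipschitz _ _) _; rewrite ?divr_ge0//.
  rewrite -mulrBl normrM [`|2^-1|]ger0_norm ?invr_ge0//.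
  by move: VV' gap0; lra.
have h3 : `|mean p (fun u => cos (kappa * total u + c0)) - C'| <=
    e + kappa ^+ 2 * (W ^+ 2 * small * (2 * Ctot)) / e.
  rewrite -meanB; apply: le_trans (normr_mean _ _) _ => //.
  pose rest u := kappa * \sum_(t | predC big_index t) w t * centered t u.
  apply: (@le_trans _ _ (mean p (fun u => `|rest u|))).
    apply: ler_mean => // u; apply: le_trans (cos_lipschitz _ _) _.
    rewrite opprD addrACA subrr addr0.
    have -> : \sum_(j < k) Y j u = kappa * \sum_(t | big_index t) w t * centered t u.
      rewrite -mulr_sumr; congr (_ * _).
      rewrite [RHS](partition_big (fun t : 'I_n => inord (t %/ m) : 'I_k.+1) predT)//=.
      rewrite big_ord_recr/= [X in _ = _ + X]big_pred0 ?addr0.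
        apply: eq_bigr => j _; apply: eq_bigl => t.
        case: (boolP (big_index t)) => //= /andP[_ tk].
        by rewrite -val_eqE/= inordK// ltnW.
      move=> t; case: (boolP (big_index t)) => //= /andP[_ tk].
      by rewrite -val_eqE/= inordK ?ltn_eqF// ltnW.
    rewrite -mulrBr /rest (bigID big_index)/=.
    by rewrite [X in kappa * X](_ : _ = \sum_(t | ~~ big_index t) w t * centered t u)// addrAC subrr add0r.
  apply: le_trans (mean_norm_le_sqr _ _ _ e0) _ => //.
  rewrite lerD2l ler_pM2r ?invr_gt0//.
  rewrite (eq_mean _ (G := fun u => kappa ^+ 2 * (\sum_(t | predC big_index t) w t * centered t u) ^+ 2)); last first.
    by move=> u; rewrite exprMn.
  rewrite meanZ ler_wpM2l ?sqr_ge0//.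
  apply: le_trans (mean_sqr_sum_le (J := centered) (c := c) (W := W) _ _ _) _ => //.
  rewrite ler_wpM2r ?mulr_ge0// ler_wpM2l ?sqr_ge0//.
have h4 : 3 * eta * V' <= 3 * eta * (V + var_gap).
  rewrite ler_wpM2l ?mulr_ge0//; move: VV'; rewrite ler_norml => /andP[]; lra.
move: h1 h2 h3 h4; set E1 := expR _ * _; set E2 := expR _ * _; set M := mean _ _.
rewrite !ler_norml => /andP[? ?] /andP[? ?] /andP[? ?] ?; apply/andP; split; lra.
Qed.

End one_sample_size.

(** * Limit of the variances of trigonometric sums *)

Section lag_sums.
Context {R : realType}.

(** A lag h > 0 comes from two ordered pairs of times, the lag 0 from one. *)
Definition lag_weight (h : nat) : R := if h == 0%N then 1 else 2.

Lemma sum_by_lag (w c : nat -> R) n :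
  \sum_(s < n) \sum_(t < n) w s * w t * c (dist s t) =
  \sum_(h < n) lag_weight h * c h * \sum_(t < n - h) w t * w (t + h)%N.
Proof.
elim: n => [|n IH]; first by rewrite !big_ord0.
rewrite big_ord_recr/=.
under eq_bigr do rewrite big_ord_recr/=.
rewrite big_split/= IH.
have -> : \sum_(h < n.+1) lag_weight h * c h * \sum_(t < n.+1 - h) w t * w (t + h)%N
  = \sum_(h < n) lag_weight h * c h * (\sum_(t < n - h) w t * w (t + h)%N) +
    \sum_(h < n.+1) lag_weight h * c h * (w (n - h)%N * w n).
  rewrite big_ord_recr/= [X in _ = _ + X]big_ord_recr/= addrA -big_split/=.
  congr (_ + _); last by rewrite subnn subSn// subnn big_ord_recl big_ord0 addr0 add0n.
  apply: eq_bigr => h _; rewrite -mulrDr subSn 1?ltnW// big_ord_recr/= subnK//.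
  exact: ltnW.
rewrite -addrA; congr (_ + _).
rewrite [X in _ + X]big_ord_recr/= big_ord_recl/=.
rewrite /lag_weight/= subn0 mul1r {3}/dist subnn addn0 addrA [RHS]addrC; congr (_ + _); last first.
  by rewrite mulrC.
rewrite -big_split/= (reindex_inj rev_ord_inj)/=; apply: eq_bigr => i _.
have hi := ltn_ord i.
have -> : bump 0 i = i.+1 by [].
have -> : dist (n - i.+1) n = i.+1 by rewrite /dist; lia.
have -> : dist n (n - i.+1) = i.+1 by rewrite /dist; lia.
lra.
Qed.

Definition mean_cos (n : nat) (th c : R) : R :=
  (\sum_(1 <= t < n.+1) cos (th * t%:R + c)) / n%:R.

(** Uniformity in the phase [c] is what lets the lag be absorbed into it. *)
Definition oscillating (th : nat -> R) : Prop :=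
  forall e : R, 0 < e -> \forall n \near \oo, forall c, `|mean_cos n (th n) c| <= e.

Lemma oscillating_fixed (th : R) : sin (th / 2) != 0 -> oscillating (fun=> th).
Proof.
move=> s0 e e0; near=> n => c.
have n0 : 0 < n%:R :> R by rewrite ltr0n; near: n; exact: nbhs_infty_gt.
rewrite /mean_cos normrM normfV (gtr0_norm n0) ler_pdivrMr//.
apply: le_trans (sum_cos_bound _ _ s0) _.
rewrite -ler_pdivrMl// mulrC; near: n; exact: nbhs_infty_ger.
Unshelve. all: by end_near. Qed.

Lemma oscillating_fourier (th : nat -> R) :
  (\forall n \near \oo, fourier_frequency n (th n) /\ sin (th n / 2) != 0) ->
  oscillating th.
Proof.
move=> H e e0; near=> n => c.
have [f s] : fourier_frequency n (th n) /\ sin (th n / 2) != 0 by near: n.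
rewrite /mean_cos sum_cos_fourier ?mul0r ?normr0 ?ltW//.
by near: n; exact: nbhs_infty_gt.
Unshelve. all: by end_near. Qed.

Lemma oscillating_cvg0 (th c : nat -> R) : oscillating th ->
  mean_cos n (th n) (c n) @[n --> \oo] --> 0.
Proof.
move=> H; apply/cvgr0Pnorm_le => e e0.
by apply: filterS (H e e0) => n; exact.
Qed.

Variables (K : nat) (x y : 'I_K -> R) (om : nat -> 'I_K -> R) (lam : 'I_K -> R).
Hypothesis om_diff : forall i j, i != j -> oscillating (fun n => om n i - om n j).
Hypothesis om_sum : forall i j, oscillating (fun n => om n i + om n j).
Hypothesis om_cvg : forall i, om n i @[n --> \oo] --> lam i.

Definition trig_weight (n t : nat) : R :=
  \sum_i (x i * cos (om n i * t%:R) + y i * sin (om n i * t%:R)).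

Definition trig_bound : R := \sum_i (`|x i| + `|y i|).

Lemma trig_bound_ge0 : 0 <= trig_bound.
Proof. by apply: sumr_ge0 => i _; rewrite addr_ge0. Qed.

Lemma trig_weight_le n t : `|trig_weight n t| <= trig_bound.
Proof.
apply: le_trans (ler_norm_sum _ _ _) _; apply: ler_sum => i _.
apply: le_trans (ler_normD _ _) _; rewrite !normrM.
by rewrite lerD// ler_piMr// ?cos_max ?sin_max.
Qed.

(** Sines are written as cosines with the phase shifted by pi / 2, so that
  cosine means are all that has to be estimated. *)
Let prod_formula (a b a' b' A B : R) :
  2 * ((a * cos A + b * sin A) * (a' * cos B + b' * sin B)) =
  (a * a' + b * b') * cos (A - B) + (b * a' - a * b') * cos (A - B - pi / 2) +
  ((a * a' - b * b') * cos (A + B) + (a * b' + b * a') * cos (A + B - pi / 2)).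
Proof. rewrite !cosBpihalf cosB cosD sinB sinD; lra. Qed.

Let full_avg (n h : nat) : R :=
  2 / n%:R * \sum_(1 <= t < n.+1) trig_weight n t * trig_weight n (t + h).

Let full_avgE n h : full_avg n h = \sum_i \sum_j
  ((x i * x j + y i * y j) * mean_cos n (om n i - om n j) (- (om n j * h%:R)) +
   (y i * x j - x i * y j) * mean_cos n (om n i - om n j) (- (om n j * h%:R) - pi / 2) +
   ((x i * x j - y i * y j) * mean_cos n (om n i + om n j) (om n j * h%:R) +
    (x i * y j + y i * x j) * mean_cos n (om n i + om n j) (om n j * h%:R - pi / 2))).
Proof.
rewrite /full_avg /mean_cos mulrAC.
have -> : 2 * (\sum_(1 <= t < n.+1) trig_weight n t * trig_weight n (t + h)) =
  \sum_i \sum_j \sum_(1 <= t < n.+1)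
   2 * ((x i * cos (om n i * t%:R) + y i * sin (om n i * t%:R)) *
    (x j * cos (om n j * (t + h)%:R) + y j * sin (om n j * (t + h)%:R))).
  rewrite mulr_sumr; under eq_bigr do rewrite /trig_weight mulr_suml mulr_sumr.
  rewrite exchange_big/=; apply: eq_bigr => i _.
  under eq_bigr do rewrite 2!mulr_sumr.
  by rewrite exchange_big/=.
rewrite mulr_suml; apply: eq_bigr => i _; rewrite mulr_suml; apply: eq_bigr => j _.
under eq_bigr do rewrite prod_formula natrD.
move: (pi / 2) (x i * x j + y i * y j) (y i * x j - x i * y j)
  (x i * x j - y i * y j) (x i * y j + y i * x j) => ph a1 a2 a3 a4.
rewrite big_split/= 2!big_split/= -!mulr_sumr.
rewrite [X in a1 * X](eq_bigr (fun t : nat => cos ((om n i - om n j) * t%:R + - (om n j * h%:R)))); last first.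
  by move=> t _; congr cos; lra.
rewrite [X in a2 * X](eq_bigr (fun t : nat => cos ((om n i - om n j) * t%:R + (- (om n j * h%:R) - ph)))); last first.
  by move=> t _; congr cos; lra.
rewrite [X in a3 * X](eq_bigr (fun t : nat => cos ((om n i + om n j) * t%:R + om n j * h%:R))); last first.
  by move=> t _; congr cos; lra.
rewrite [X in a4 * X](eq_bigr (fun t : nat => cos ((om n i + om n j) * t%:R + (om n j * h%:R - ph)))); last first.
  by move=> t _; congr cos; lra.
by rewrite !mulrDl -!mulrA.
Qed.

Definition trig_autocov (h : nat) : R :=
  \sum_i (x i ^+ 2 + y i ^+ 2) * cos (lam i * h%:R).

Let mean_cos0 n c : (0 < n)%N -> mean_cos n 0 c = cos c.
Proof.
move=> n0; rewrite /mean_cos (eq_bigr (fun=> cos c)); last first.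
  by move=> t _; rewrite mul0r add0r.
rewrite sumr_const_nat subn1/= -[X in X / _]mulr_natr mulfK// pnatr_eq0.
by rewrite -lt0n.
Qed.

Let full_avg_cvg h : full_avg n h @[n --> \oo] --> trig_autocov h.
Proof.
under eq_fun do rewrite full_avgE.
rewrite /trig_autocov.
apply: cvg_sum_fin => i.
have -> : (x i ^+ 2 + y i ^+ 2) * cos (lam i * h%:R) =
  \sum_j (if j == i then (x i ^+ 2 + y i ^+ 2) * cos (lam i * h%:R) else 0).
  by rewrite -big_mkcond/= big_pred1_eq.
apply: cvg_sum_fin => j.
rewrite -[X in _ --> X]addr0; apply: cvgD; last first.
  rewrite -[X in _ --> X]addr0; apply: cvgD.
    rewrite -[X in _ --> X](mulr0 (x i * x j - y i * y j)); apply: cvgMr.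
    by apply: oscillating_cvg0; exact: om_sum.
  rewrite -[X in _ --> X](mulr0 (x i * y j + y i * x j)); apply: cvgMr.
  by apply: oscillating_cvg0; exact: om_sum.
have [->|ji] := eqVneq j i; last first.
  rewrite -[X in _ --> X]addr0; apply: cvgD.
    rewrite -[X in _ --> X](mulr0 (x i * x j + y i * y j)); apply: cvgMr.
    by apply: oscillating_cvg0; apply: om_diff; rewrite eq_sym.
  rewrite -[X in _ --> X](mulr0 (y i * x j - x i * y j)); apply: cvgMr.
  by apply: oscillating_cvg0; apply: om_diff; rewrite eq_sym.
rewrite -[X in _ --> X]addr0; apply: cvgD; last first.
  rewrite [X in X @ _ --> _](_ : _ = fun=> 0); first exact: cvg_cst.
  by apply/funext => n; rewrite [y i * x i]mulrC subrr mul0r.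
rewrite -!expr2; apply: cvgMr.
apply: (@cvg_trans _ (cos (- (om n i * h%:R)) @[n --> \oo])).
  apply: near_eq_cvg; near=> n.
  by rewrite subrr mean_cos0//; near: n; exact: nbhs_infty_gt.
under eq_fun do rewrite cosN.
apply: (cvg_comp (fun n => om n i * h%:R) cos).
  by apply: cvgMl; exact: om_cvg.
exact: continuous_cos.
Unshelve. all: by end_near. Qed.

(** By the product formulas, lagged products of the weights have the frequencies
  om i - om j and om i + om j; all of them average out except the differences
  with i = j, which are 0. *)
Lemma lag_average_cvg h :
  2 / n%:R * (\sum_(t < n - h) trig_weight n t.+1 * trig_weight n (t + h).+1)
    @[n --> \oo] --> trig_autocov h.
Proof.
apply: (cvg_sub0 _ (full_avg_cvg (h := h))).
apply/cvgr0Pnorm_le => e e0; near=> n.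
have n0 : 0 < n%:R :> R by rewrite ltr0n; near: n; exact: nbhs_infty_gt.
have hn : (h <= n)%N by near: n; exact: nbhs_infty_ge.
rewrite !fctE /full_avg.
have -> : \sum_(1 <= t < n.+1) trig_weight n t * trig_weight n (t + h) =
   \sum_(t < n - h) trig_weight n t.+1 * trig_weight n (t + h).+1 +
   \sum_(n - h <= t < n) trig_weight n t.+1 * trig_weight n (t + h).+1.
  rewrite big_add1/= (big_cat_nat (n := (n - h)%N))//= ?leq_subr//.
  by rewrite big_mkord.
rewrite mulrDr opprD addrA subrr add0r normrN.
rewrite normrM ger0_norm ?divr_ge0 ?ler0n// mulrAC ler_pdivrMr//.
apply: (@le_trans _ _ (2 * (h%:R * (trig_bound ^+ 2)))).
  rewrite ler_pM2l//; apply: le_trans (ler_norm_sum _ _ _) _.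
  apply: (@le_trans _ _ (\sum_(n - h <= t < n) trig_bound ^+ 2)).
    apply: ler_sum => t _; rewrite normrM expr2.
    by apply: ler_pM => //; exact: trig_weight_le.
  by rewrite sumr_const_nat subKn// mulr_natl.
rewrite -ler_pdivrMl// mulrC; near: n; exact: nbhs_infty_ger.
Unshelve. all: by end_near. Qed.

End lag_sums.

Section limit_variance.
Context {R : realType}.

(** Tannery's theorem, with small tails in place of a dominating series. *)
Lemma cvg_sum_tails (u : nat -> nat -> R) (ul : nat -> R) (U : R) :
  (forall h, u n h @[n --> \oo] --> ul h) ->
  (forall e : R, 0 < e -> exists k, \forall n \near \oo,
     \sum_(k <= h < n) `|u n h| <= e) ->
  \sum_(h < N) ul h @[N --> \oo] --> U ->
  \sum_(h < n) u n h @[n --> \oo] --> U.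
Proof.
move=> uc tail ulU; apply/cvgrPdist_le => e e0.
have e3 : 0 < e / 3 by rewrite divr_gt0.
have [k tailk] := tail _ e3.
have [N [kN NU]] : exists N, (k <= N)%N /\ `|U - \sum_(h < N) ul h| <= e / 3.
  have /cvgrPdist_le/(_ _ e3) [N0 _ HN0] := ulU.
  exists (maxn k N0); split; first exact: leq_maxl.
  by apply: HN0 => /=; exact: leq_maxr.
have := @cvg_sum_fin R nat \oo eventually_filter _ (index_enum 'I_N) _ _ (fun h : 'I_N => uc h).
move=> /cvgrPdist_le/(_ _ e3) near1.
near=> n.
have Nn : (N <= n)%N by near: n; exact: nbhs_infty_ge.
have a1 : `|\sum_(h < N) ul h - \sum_(h < N) u n h| <= e / 3 by near: n.
have a2 : \sum_(k <= h < n) `|u n h| <= e / 3 by near: n.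
have -> : \sum_(h < n) u n h = \sum_(h < N) u n h + \sum_(N <= h < n) u n h.
  by rewrite -!(big_mkord xpredT (u n)) -big_cat_nat.
have a3 : `|\sum_(N <= h < n) u n h| <= e / 3.
  apply: le_trans (ler_norm_sum _ _ _) _; apply: le_trans a2.
  rewrite [leRHS](big_cat_nat (n := N))//= lerDr.
  by apply: sumr_ge0.
move: NU a1 a3; rewrite !ler_norml => /andP[? ?] /andP[? ?] /andP[? ?].
by apply/andP; split; lra.
Unshelve. all: by end_near. Qed.

Variables (m : nat -> nat) (cc : nat -> nat -> R) (gam : nat -> R).
Hypothesis cc_cvg : forall h, (m n)%:R * cc n h @[n --> \oo] --> gam h.
Hypothesis cc_tail : forall e : R, 0 < e -> exists k, \forall n \near \oo,
  (m n)%:R * \sum_(k <= h < n) `|cc n h| <= e.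

Lemma total_cov_bounded : exists B : R, 0 <= B /\ \forall n \near \oo,
  (m n)%:R * \sum_(h < n) `|cc n h| <= B.
Proof.
have [k tailk] := cc_tail ltr01.
have cn (h : nat) : `|(m n)%:R * cc n h| @[n --> \oo] --> `|gam h|.
  by apply: cvg_norm; exact: cc_cvg.
have := @cvg_sum_fin R nat \oo eventually_filter _ (index_enum 'I_k) _ _ (fun h : 'I_k => cn h).
move=> /cvgrPdist_le/(_ _ ltr01) near1.
exists (\sum_(h < k) `|gam h| + 1 + 1); split.
  by rewrite !addr_ge0// sumr_ge0.
near=> n.
have kn : (k <= n)%N by near: n; exact: nbhs_infty_ge.
have a1 : `|\sum_(h < k) `|gam h| - \sum_(h < k) `|(m n)%:R * cc n h| | <= 1 by near: n.
have a2 : (m n)%:R * \sum_(k <= h < n) `|cc n h| <= 1 by near: n.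
have -> : \sum_(h < n) `|cc n h| = \sum_(h < k) `|cc n h| + \sum_(k <= h < n) `|cc n h|.
  by rewrite -!(big_mkord xpredT (fun h => `|cc n h|)) -big_cat_nat.
rewrite mulrDr lerD// mulr_sumr.
have -> : \sum_(h < k) (m n)%:R * `|cc n h| = \sum_(h < k) `|(m n)%:R * cc n h|.
  by apply: eq_bigr => h _; rewrite normrM normr_nat.
by move: a1; rewrite ler_norml => /andP[]; lra.
Unshelve. all: by end_near. Qed.

Variables (K : nat) (x y : 'I_K -> R) (om : nat -> 'I_K -> R) (lam : 'I_K -> R).
Hypothesis om_diff : forall i j, i != j -> oscillating (fun n => om n i - om n j).
Hypothesis om_sum : forall i j, oscillating (fun n => om n i + om n j).
Hypothesis om_cvg : forall i, om n i @[n --> \oo] --> lam i.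
Variable L : R.
Hypothesis L_def :
  \sum_(h < n) lag_weight h * gam h * trig_autocov x y lam h @[n --> \oo] --> L.

(** Summation by lag: m n * cc n h converges, it is multiplied by an average
  over time that converges to the trigonometric autocovariance, and the large
  lags are uniformly negligible. *)
Lemma variance_cvg :
  2 * (m n)%:R / n%:R * (\sum_(s < n) \sum_(t < n)
     trig_weight x y om n s.+1 * trig_weight x y om n t.+1 * cc n (dist s t))
  @[n --> \oo] --> L.
Proof.
pose u n h : R := lag_weight h * ((m n)%:R * cc n h) *
  (2 / n%:R * \sum_(t < n - h) trig_weight x y om n t.+1 * trig_weight x y om n (t + h).+1).
have -> : (fun n => 2 * (m n)%:R / n%:R * (\sum_(s < n) \sum_(t < n)
     trig_weight x y om n s.+1 * trig_weight x y om n t.+1 * cc n (dist s t))) =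
   (fun n => \sum_(h < n) u n h).
  apply/funext => n; rewrite (sum_by_lag (fun t => trig_weight x y om n t.+1)).
  rewrite mulr_sumr; apply: eq_bigr => h _; rewrite /u.
  by move: (\sum_(t < n - h) _) => X; lra.
apply: cvg_sum_tails L_def.
  move=> h; apply: cvgM; first by apply: cvgMr; exact: cc_cvg.
  exact: lag_average_cvg.
move=> e e0; set W := trig_bound x y.
have W0 : 0 <= W := trig_bound_ge0 x y.
have W1 : 0 < 4 * W ^+ 2 + 1 by rewrite ltr_wpDl// mulr_ge0// sqr_ge0.
have [k tailk] := cc_tail (divr_gt0 e0 W1); exists k.
near=> n.
have n0 : 0 < n%:R :> R by rewrite ltr0n; near: n; exact: nbhs_infty_gt.
have a2 : (m n)%:R * \sum_(k <= h < n) `|cc n h| <= e / (4 * W ^+ 2 + 1) by near: n.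
move: a2; rewrite ler_pdivlMr// => a2; apply: le_trans a2.
rewrite mulr_sumr mulr_suml; apply: ler_sum => h _.
rewrite /u !normrM normr_nat.
have l2 : `|lag_weight h : R| <= 2.
  by rewrite /lag_weight; case: ifP => _; rewrite ger0_norm// ler1n.
have s2 : `|2 / n%:R : R| * `|\sum_(t < n - h) trig_weight x y om n t.+1 * trig_weight x y om n (t + h).+1|
   <= 2 * W ^+ 2.
  rewrite ger0_norm ?divr_ge0 ?ler0n// mulrAC ler_pdivrMr// -mulrA ler_pM2l//.
  apply: le_trans (ler_norm_sum _ _ _) _.
  apply: (@le_trans _ _ (\sum_(t < n - h) W ^+ 2)).
    apply: ler_sum => t _; rewrite normrM expr2.
    by apply: ler_pM => //; exact: trig_weight_le.
  rewrite sumr_const card_ord -[X in X <= _]mulr_natr ler_wpM2l ?sqr_ge0// ler_nat.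
  exact: leq_subr.
rewrite normrM in s2.
set q := `|2| * _ * _ in s2 *.
have q0 : 0 <= q by rewrite mulr_ge0.
set z := (m n)%:R * `|cc n h|; have z0 : 0 <= z by rewrite mulr_ge0.
apply: (@le_trans _ _ (2 * z * (2 * W ^+ 2))).
  apply: ler_pM => //; first by rewrite mulr_ge0.
  exact: ler_wpM2r.
by rewrite mulrDr mulr1; lra.
Unshelve. all: by end_near. Qed.

End limit_variance.

(** * The discrete Fejer kernel *)

Section fejer.
Context {R : realType}.

(** Equidistant points of ]- pi, pi]. *)
Definition node (M : nat) (j : 'I_M) : R := 2 * pi * j.+1%:R / M%:R - pi.

(** Orthogonality of the characters on M equidistant nodes, which holds as long
  as the frequency is below M. *)
Lemma sum_cos_nodes (M : nat) (d : int) (z : R) : (`|d| < M)%N ->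
  \sum_(j < M) cos (d%:~R * (z - node j)) = if d == 0 then M%:R else 0.
Proof.
move=> dM; have M0 : (0 < M)%N := leq_ltn_trans (leq0n _) dM.
have [->|d0] := eqVneq d 0.
  by under eq_bigr do rewrite mul0r cos0; rewrite sumr_const card_ord.
pose th : R := 2 * pi * (- d)%:~R / M%:R.
have M0' : M%:R != 0 :> R by rewrite pnatr_eq0 -lt0n.
have s0 : sin (th / 2) != 0.
  have -> : th / 2 = - (pi * (d%:~R / M%:R)).
    by rewrite /th rmorphN/=; lra.
  rewrite sinN oppr_eq0.
  have H (q : R) : 0 < q < 1 -> sin (pi * q) != 0.
    move=> /andP[q0 q1]; rewrite gt_eqF// sin_gt0_pi// mulr_gt0 ?pi_gt0//=.
    by rewrite gtr_pMr// pi_gt0.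
  case: d dM d0 {th} => k /= kM k0.
    apply: H; rewrite -pmulrn divr_gt0 ?ltr0n ?lt0n//=.
      by rewrite ltr_pdivrMr ?ltr0n// mul1r ltr_nat.
    by rewrite -lt0n.
  rewrite NegzE rmorphN/= mulNr mulrN sinN oppr_eq0; apply: H.
  by rewrite -pmulrn divr_gt0 ?ltr0n//= ltr_pdivrMr ?ltr0n// mul1r ltr_nat.
have ff : fourier_frequency M th by exists (- d).
rewrite -[RHS](sum_cos_fourier (d%:~R * (z + pi)) M0 ff s0).
rewrite big_add1/= big_mkord; apply: eq_bigr => j _; congr cos.
by rewrite /node /th rmorphN/=; lra.
Qed.

(** The Fejer kernel, normalized so that its values at q + 1 equidistant nodes
  sum to 1. *)
Definition fejer (q : nat) (y : R) : R :=
  (q.+1 * q)%:R^-1 * \sum_(k < q) \sum_(l < q) cos ((k%:Z - l%:Z)%:~R * y).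

(** The double sum is the squared modulus of an exponential sum. *)
Lemma fejer_ge0 q y : 0 <= fejer q y.
Proof.
rewrite mulr_ge0 ?invr_ge0 ?ler0n//.
have -> : \sum_(k < q) \sum_(l < q) cos ((k%:Z - l%:Z)%:~R * y) =
  (\sum_(k < q) cos (k%:R * y)) ^+ 2 + (\sum_(k < q) sin (k%:R * y)) ^+ 2.
  rewrite !expr2 !mulr_suml -big_split/=; apply: eq_bigr => k _.
  rewrite !mulr_sumr -big_split/=; apply: eq_bigr => l _.
  by rewrite rmorphB/= mulrBl cosB.
by rewrite addr_ge0 ?sqr_ge0.
Qed.

Lemma sum_fejer (q : nat) (z : R) : (0 < q)%N ->
  \sum_(j < q.+1) fejer q (z - node j) = 1.
Proof.
move=> q0; rewrite -mulr_sumr exchange_big/=.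
rewrite (eq_bigr (fun=> q.+1%:R)) => [|k _].
  rewrite sumr_const card_ord -[X in _ * X]mulr_natr -natrM mulVf//.
  by rewrite pnatr_eq0 muln_eq0 -lt0n.
rewrite exchange_big/= (bigD1 k)//= sum_cos_nodes ?subrr ?eqxx// big1 ?addr0// => l lk.
rewrite sum_cos_nodes; last by have := ltn_ord k; have := ltn_ord l; lia.
by rewrite subr_eq0 eqz_nat eq_sym -[_ == _]/(l == k) (negbTE lk).
Qed.

(** The Fejer coefficient of order 1 is 1 - 1 / q; so the weights have a second
  moment of order 1 / q around z. *)
Lemma sum_fejer_cos (q : nat) (z : R) : (0 < q)%N ->
  \sum_(j < q.+1) fejer q (z - node j) * (1 - cos (z - node j)) = q%:R^-1.
Proof.
move=> q0; under eq_bigr do rewrite mulrBr mulr1.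
rewrite sumrB sum_fejer//.
suff -> : \sum_(j < q.+1) fejer q (z - node j) * cos (z - node j) = 1 - q%:R^-1.
  by rewrite opprB addrC subrK.
under eq_bigr do rewrite -mulrA mulr_suml.
rewrite -mulr_sumr exchange_big/=.
have E (k l : 'I_q) : \sum_(j < q.+1) cos ((k%:Z - l%:Z)%:~R * (z - node j)) * cos (z - node j)
  = q.+1%:R / 2 * ((l == k.+1 :> nat)%:R + (k == l.+1 :> nat)%:R).
  have -> : \sum_(j < q.+1) cos ((k%:Z - l%:Z)%:~R * (z - node j)) * cos (z - node j) =
    2^-1 * (\sum_(j < q.+1) cos ((k%:Z - l%:Z + 1)%:~R * (z - node j)) +
            \sum_(j < q.+1) cos ((k%:Z - l%:Z - 1)%:~R * (z - node j))).
    rewrite -big_split/= mulr_sumr; apply: eq_bigr => j _.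
    move: (z - node j) (k%:Z - l%:Z) => yy e.
    rewrite rmorphD rmorphB/= mulrDl mulrBl mul1r cosB cosD.
    lra.
  have lk := ltn_ord k; have ll := ltn_ord l.
  rewrite !sum_cos_nodes; [|lia|lia].
  have -> : (k%:Z - l%:Z + 1 == 0) = (l == k.+1 :> nat) by apply/eqP/eqP; lia.
  have -> : (k%:Z - l%:Z - 1 == 0) = (k == l.+1 :> nat) by apply/eqP/eqP; lia.
  by case: eqP => _; case: eqP => _ /=; lra.
rewrite (eq_bigr (fun k : 'I_q => q.+1%:R / 2 * (\sum_(l < q) (l == k.+1 :> nat)%:R
    + \sum_(l < q) (k == l.+1 :> nat)%:R))); last first.
  move=> k _; under eq_bigr do rewrite mulr_suml.
  rewrite exchange_big/=; under eq_bigr do rewrite E.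
  by rewrite -mulr_sumr big_split.
rewrite -mulr_sumr big_split/=.
have C : \sum_(k < q) \sum_(l < q) (l == k.+1 :> nat)%:R = q%:R - 1 :> R.
  case: q q0 {E} => // q _.
  rewrite big_ord_recr/= [X in _ + X]big1 ?addr0; last first.
    by move=> l _; rewrite ltn_eqF.
  rewrite (eq_bigr (fun=> 1)); last first.
    move=> k _; rewrite (bigD1 (lift ord0 k))//= eqxx big1 ?addr0//.
    by move=> l /negbTE; rewrite -val_eqE/= => ->.
  by rewrite sumr_const card_ord -natr1 addrK.
rewrite [X in _ + X]exchange_big/= C natrM.
have q1 : q%:R != 0 :> R by rewrite pnatr_eq0 -lt0n.
by have q2 : q.+1%:R != 0 :> R by []; field; rewrite q1 addrC natr1 q2.
Qed.

End fejer.

(** * Levy's continuity theorem for finite laws *)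

Section trigonometric_polynomials.
Context {R : realType} {k : nat}.
Implicit Types (t x : 'rV[R]_k) (f g : 'rV[R]_k -> R).

Definition dotp t x : R := \sum_i t 0 i * x 0 i.

Lemma dotpDl s t x : dotp (s + t) x = dotp s x + dotp t x.
Proof. by rewrite -big_split/=; apply: eq_bigr => i _; rewrite mxE mulrDl. Qed.

Lemma dotpBl s t x : dotp (s - t) x = dotp s x - dotp t x.
Proof. by rewrite -sumrB; apply: eq_bigr => i _; rewrite !mxE mulrBl. Qed.

(** Each term is coded by its amplitude, frequency vector and phase; because of
  the phases, cosines suffice and products of cosines are again sums of cosines.
  *)
Definition trigpoly f : Prop := exists s : seq (R * 'rV[R]_k * R),
  forall x, f x = \sum_(q <- s) q.1.1 * cos (dotp q.1.2 x + q.2).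

Lemma trigpoly_cos (a : R) t c : trigpoly (fun x => a * cos (dotp t x + c)).
Proof. by exists [:: (a, t, c)] => x; rewrite big_seq1. Qed.

Lemma trigpoly_cst (a : R) : trigpoly (fun=> a).
Proof.
exists [:: (a, 0, 0)] => x; rewrite big_seq1 /dotp big1 ?addr0 ?cos0 ?mulr1// => i _.
by rewrite mxE mul0r.
Qed.

Lemma trigpolyD f g : trigpoly f -> trigpoly g -> trigpoly (fun x => f x + g x).
Proof.
by move=> [s fs] [s' gs]; exists (s ++ s') => x; rewrite big_cat fs gs.
Qed.

Lemma eq_trigpoly f g : f =1 g -> trigpoly f -> trigpoly g.
Proof. by move=> fg [s fs]; exists s => x; rewrite -fg. Qed.

Lemma trigpoly_sum (I : Type) (r : seq I) (F : I -> 'rV[R]_k -> R) :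
  (forall i, trigpoly (F i)) -> trigpoly (fun x => \sum_(i <- r) F i x).
Proof.
move=> FT; elim: r => [|i r IH].
  by apply: eq_trigpoly (trigpoly_cst 0) => x; rewrite big_nil.
by apply: eq_trigpoly (trigpolyD (FT i) IH) => x; rewrite big_cons.
Qed.

Lemma trigpolyM f g : trigpoly f -> trigpoly g -> trigpoly (fun x => f x * g x).
Proof.
move=> [s fs] [s' gs].
apply: (@eq_trigpoly (fun x => \sum_(q <- s) \sum_(q' <- s')
  (q.1.1 * cos (dotp q.1.2 x + q.2)) * (q'.1.1 * cos (dotp q'.1.2 x + q'.2)))).
  by move=> x; rewrite fs gs mulr_suml; apply: eq_bigr => q _; rewrite mulr_sumr.
apply: trigpoly_sum => -[[a t] c]; apply: trigpoly_sum => -[[a' t'] c'] /=.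
apply: (eq_trigpoly _ (trigpolyD (trigpoly_cos (a * a' / 2) (t + t') (c + c'))
  (trigpoly_cos (a * a' / 2) (t - t') (c - c')))) => x.
rewrite dotpDl dotpBl.
have -> : dotp t x + dotp t' x + (c + c') = (dotp t x + c) + (dotp t' x + c') by lra.
have -> : dotp t x - dotp t' x + (c - c') = (dotp t x + c) - (dotp t' x + c') by lra.
rewrite cosB (cosD (_ + c)); lra.
Qed.

Lemma trigpoly_prod (I : Type) (r : seq I) (F : I -> 'rV[R]_k -> R) :
  (forall i, trigpoly (F i)) -> trigpoly (fun x => \prod_(i <- r) F i x).
Proof.
move=> FT; elim: r => [|i r IH].
  by apply: eq_trigpoly (trigpoly_cst 1) => x; rewrite big_nil.
by apply: eq_trigpoly (trigpolyM (FT i) IH) => x; rewrite big_cons.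
Qed.

Lemma trigpoly_fejer (q : nat) (i : 'I_k) (L z : R) :
  trigpoly (fun x => fejer q (x 0 i / L - z)).
Proof.
pose t (d : R) : 'rV[R]_k := \row_j (if j == i then d / L else 0).
have dt d x : dotp (t d) x = d * (x 0 i / L).
  rewrite /dotp (bigD1 i)//= mxE eqxx big1 ?addr0 => [|j /negbTE ji]; first lra.
  by rewrite mxE ji mul0r.
apply: trigpolyM; first exact: trigpoly_cst.
apply: trigpoly_sum => a; apply: trigpoly_sum => b.
set d := _%:~R.
apply: (eq_trigpoly _ (trigpoly_cos 1 (t d) (- d * z))) => x.
by rewrite dt mul1r mulrBr mulNr.
Qed.

(** Heine's theorem in the form needed for approximation on a grid: only [x] has
  to lie in the box, whereas [y] may be a grid point outside of it. *)
Lemma continuous_box_modulus f (A e : R) : continuous f -> 0 < e ->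
  exists2 del : R, 0 < del & forall x y : 'rV[R]_k, (forall i, `|x 0 i| <= A) ->
    (forall i, `|x 0 i - y 0 i| <= del) -> `|f x - f y| <= e.
Proof.
move=> cf e0.
have cA : compact [set v : 'rV[R]_k | forall i, `[- A, A]%classic (v 0 i)].
  apply: (@rV_compact _ _ (fun=> `[- A, A]%classic)) => i; exact: segment_compact.
pose P (del : R) (x : 'rV[R]_k) := forall y : 'rV[R]_k, (forall i, `|x 0 i - y 0 i| <= del) -> `|f x - f y| <= e.
have e2 : 0 < e / 2 by rewrite divr_gt0.
have := (@compact_near_coveringP _ _).1 cA R (0^'+) P _.
have H x : [set v : 'rV[R]_k | forall i, `[- A, A]%classic (v 0 i)] x ->
    \forall x' \near x & del \near 0^'+, P del x'.
  move=> _; have /cvgrPdist_le/(_ _ e2) := cf x.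
  move=> /nbhs_ballP[r /= r0 fr].
  have r2 : 0 < r / 2 by rewrite divr_gt0.
  exists (ball x (r / 2), [set del | del < r / 2]).
    split => /=; first by apply/nbhs_ballP; exists (r / 2).
    exact: nbhs_right_lt.
  move=> [x' del] /= [[_ xx'] dr] y x'y.
  have fx' : `|f x - f x'| <= e / 2.
    apply: fr; split => // a b; rewrite (ord1 a).
    by apply: le_ball (xx' 0 b); lra.
  have fy : `|f x - f y| <= e / 2.
    apply: fr; split => // a b; rewrite (ord1 a).
    rewrite /ball/= -(subrKA (x' 0 b)); apply: le_lt_trans (ler_normD _ _) _.
    have := xx' 0 b; rewrite /ball/= => h1.
    by have := x'y b; move: h1 dr; lra.
  rewrite -(subrKA (f x)); apply: le_trans (ler_normD _ _) _.
  by rewrite distrC; move: fx' fy; lra.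
move=> /(_ (at_right_proper_filter 0) H) nearA.
have [del [del0 Adel]] : exists del : R, 0 < del /\
    ([set v : 'rV[R]_k | forall i, `[- A, A]%classic (v 0 i)] `<=` P del).
  apply: (@filter_ex _ (0^'+) (at_right_proper_filter 0)); near=> del; split; near: del.
    exact: nbhs_right_gt.
  exact: nearA.
exists del => // x y xA; apply: Adel => i.
by rewrite /= in_itv/= -ler_norml.
Unshelve. all: by end_near. Qed.

(** The function 1 - cos plays the part of the squared distance on the circle.
  The bound 1 + pi is the largest distance between a point of [-1, 1] and a node
  of [- pi, pi]; it stays below 2 pi, where 1 - cos vanishes again. *)
Lemma one_sub_cos_lower (eta : R) : 0 < eta -> eta <= 1 ->
  exists2 c : R, 0 < c & forall y : R, eta <= `|y| -> `|y| <= 1 + pi ->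
    c <= 1 - cos y.
Proof.
move=> eta0 eta1; have pi2 : 2 <= pi :> R by exact: pi_ge2.
have c1 : cos eta < 1.
  rewrite -cos0 ltr_cos ?in_itv/= ?lexx ?pi_ge0 ?(ltW eta0)//.
  by apply: le_trans eta1 _; apply: le_trans pi2; rewrite ler1n.
exists (Num.min (1 - cos eta) 1); first by rewrite lt_min ltr01 subr_gt0 c1.
move=> y; have -> : cos y = cos `|y|.
  by have [y0|y0] := leP 0 y; [rewrite ger0_norm|rewrite ltr0_norm// cosN].
move: `|y| => {}y ey yp; rewrite ge_min.
have [ypi|ypi] := leP y pi.
  apply/orP; left; rewrite lerD2l lerN2.
  move: ey; rewrite le_eqVlt => /predU1P[->//|ey].
  by rewrite ltW// ltr_cos// in_itv/=; apply/andP; split; lra.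
apply/orP; right; rewrite lerDl oppr_ge0.
rewrite -[y](subrK pi) cosDpi oppr_le0.
by rewrite cos_ge0_pihalf//; apply/andP; split; lra.
Qed.

(** A discrete Fejer mean: the values of [f] at the nodes of a grid of the box
  [- L pi, L pi] ^ k, averaged with the product of the Fejer kernels in the
  coordinates.  The weights are nonnegative and sum to 1, and their second
  moment is of order 1 / q, so that Korovkin's argument applies. *)
Lemma trigpoly_approx f (b L e : R) : continuous f -> (forall x, `|f x| <= b) ->
  0 < L -> 0 < e ->
  exists T, [/\ trigpoly T, forall x, `|T x| <= b &
    forall x, (forall i, `|x 0 i| <= L) -> `|T x - f x| <= e].
Proof.
move=> cf fb L0 e0.
have b0 : 0 <= b := le_trans (normr_ge0 _) (fb 0).
have e2 : 0 < e / 2 by rewrite divr_gt0.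
have [del0 del00 fdel0] := continuous_box_modulus L cf e2.
pose eta := Num.min (del0 / L) 1.
have eta0 : 0 < eta by rewrite lt_min ltr01 divr_gt0.
have [|c c0 cosc] := one_sub_cos_lower eta0; first by rewrite ge_min lexx orbT.
have [q [q0 qe]] : exists q : nat, (0 < q)%N /\ 2 * b / c * k%:R / q%:R <= e / 2.
  apply: (@filter_ex _ \oo); near=> q.
  have q0 : (0 < q)%N by near: q; exact: nbhs_infty_gt.
  split => //; rewrite ler_pdivrMr ?ltr0n// -ler_pdivrMl// mulrC.
  by near: q; exact: nbhs_infty_ger.
(* Weights of the grid points: products over the coordinates of Fejer kernels.
   *)
pose Kx (x : 'rV[R]_k) (i : 'I_k) (j : 'I_q.+1) := fejer q (x 0 i / L - node j).
pose grid (J : {ffun 'I_k -> 'I_q.+1}) : 'rV[R]_k := \row_i (L * node (J i)).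
pose wt x (J : {ffun 'I_k -> 'I_q.+1}) := \prod_i Kx x i (J i).
have wt0 x J : 0 <= wt x J by apply: prodr_ge0 => i _; exact: fejer_ge0.
have wt1 x : \sum_J wt x J = 1.
  rewrite -(bigA_distr_bigA (Kx x))/= big1// => i _.
  exact: sum_fejer.
have wt2 x i : \sum_J wt x J * (1 - cos (x 0 i / L - node (J i))) = q%:R^-1.
  pose G (i' : 'I_k) (j : 'I_q.+1) : R :=
    Kx x i' j * (if i' == i then 1 - cos (x 0 i' / L - node j) else 1).
  rewrite (eq_bigr (fun J : {ffun 'I_k -> 'I_q.+1} => \prod_i' G i' (J i'))); last first.
    move=> J _; rewrite big_split/=; congr (_ * _).
    by rewrite (bigD1 i)//= eqxx big1 ?mulr1// => i' /negbTE ->.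
  rewrite -(bigA_distr_bigA G)/= (bigD1 i)//= [X in _ * X]big1 ?mulr1.
    apply: etrans (sum_fejer_cos (x 0 i / L) q0).
    by apply: eq_bigr => j _; rewrite /G eqxx.
  move=> i' /negbTE ii'; under eq_bigr do rewrite /G ii' mulr1.
  exact: sum_fejer.
exists (fun x => \sum_J f (grid J) * wt x J); split.
- apply: trigpoly_sum => J; apply: trigpolyM; first exact: trigpoly_cst.
  by apply: trigpoly_prod => i; exact: trigpoly_fejer.
- move=> x; apply: le_trans (ler_norm_sum _ _ _) _.
  rewrite -[leRHS]mulr1 -(wt1 x) mulr_sumr; apply: ler_sum => J _.
  by rewrite normrM (ger0_norm (wt0 x J)) ler_wpM2r.
move=> x xL.
have -> : \sum_J f (grid J) * wt x J - f x = \sum_J (f (grid J) - f x) * wt x J.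
  by under [RHS]eq_bigr do rewrite mulrBl; rewrite sumrB -mulr_sumr wt1 mulr1.
apply: le_trans (ler_norm_sum _ _ _) _.
apply: (@le_trans _ _ (\sum_J (e / 2 * wt x J +
    2 * b / c * \sum_i wt x J * (1 - cos (x 0 i / L - node (J i)))))); last first.
  rewrite big_split/= -mulr_sumr wt1 mulr1 -mulr_sumr exchange_big/=.
  under eq_bigr do rewrite wt2.
  rewrite sumr_const card_ord -[q%:R^-1 *+ k]mulr_natl mulrA.
  by move: qe; lra.
apply: ler_sum => J _; rewrite normrM (ger0_norm (wt0 x J)).
rewrite -mulr_sumr mulrCA [X in _ <= X + _]mulrC [X in X <= _]mulrC -mulrDr.
rewrite ler_wpM2l//.
have dcos i : 0 <= 1 - cos (x 0 i / L - node (J i)) by rewrite subr_ge0 cos_le1.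
have [near_grid|] := pselect (forall i, `|x 0 i - grid J 0 i| <= del0).
  rewrite -[leLHS]addr0 lerD//; first by rewrite distrC fdel0.
  by rewrite mulr_ge0 ?sumr_ge0// divr_ge0 ?mulr_ge0// ltW.
move=> /existsNP[i /negP]; rewrite -ltNge => far.
apply: (@le_trans _ _ (2 * b)).
  apply: le_trans (ler_normB _ _) _.
  by rewrite mulr_natl mulr2n lerD.
rewrite -[leLHS]add0r lerD ?(ltW e2)//.
rewrite -[leRHS]mulrA ler_peMr ?mulr_ge0// ler_pdivlMl// mulr1.
apply: (@le_trans _ _ (1 - cos (x 0 i / L - node (J i)))); last first.
  by rewrite (bigD1 i)//= lerDl sumr_ge0.
have yE : x 0 i / L - node (J i) = (x 0 i - grid J 0 i) / L.
  by rewrite mxE mulrBl [L * _]mulrC mulfK// gt_eqF.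
apply: cosc.
  rewrite yE normrM normfV (gtr0_norm L0) ge_min ler_pM2r ?invr_gt0//.
  by rewrite (ltW far).
apply: le_trans (ler_normB _ _) _; apply: lerD.
  by rewrite normrM normfV (gtr0_norm L0) ler_pdivrMr// mul1r.
rewrite /node ler_norml; have pi0 := pi_gt0 R.
have h1 : 0 <= (J i).+1%:R / q.+1%:R :> R by rewrite divr_ge0.
have h2 : (J i).+1%:R / q.+1%:R <= 1 :> R by rewrite ler_pdivrMr// mul1r ler_nat.
rewrite -(mulrA (2 * pi)); move: (_ / _) h1 h2 => h h1 h2.
by apply/andP; split; nra.
Unshelve. all: by end_near. Qed.

End trigonometric_polynomials.

Section borel_measurability.
Context {R : realType}.

Lemma continuous_addf (X : topologicalType) (f g : X -> R) : continuous f ->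
  continuous g -> continuous (fun x => f x + g x).
Proof. by move=> cf cg x; apply: cvgD; [exact: cf|exact: cg]. Qed.

Lemma continuous_scalef (X : topologicalType) (c : R) (f : X -> R) : continuous f ->
  continuous (fun x => c * f x).
Proof. by move=> cf x; apply: cvgMr; exact: cf. Qed.

Lemma integrable_scale d (T : measurableType d) (mu : measure T R) (c : R) (f : T -> R) :
  mu.-integrable [set: T] (EFin \o f) -> mu.-integrable [set: T] (EFin \o (fun x => c * f x)).
Proof.
move=> h; rewrite (_ : EFin \o _ = (fun x => c%:E * (EFin \o f) x)%E)//.
exact: integrableZl.
Qed.

Lemma integrable_addf d (T : measurableType d) (mu : measure T R) (f g : T -> R) :
  mu.-integrable [set: T] (EFin \o f) -> mu.-integrable [set: T] (EFin \o g) ->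
  mu.-integrable [set: T] (EFin \o (fun x => f x + g x)).
Proof.
move=> hf hg; rewrite (_ : EFin \o _ = ((EFin \o f) \+ (EFin \o g))%E)//.
exact: integrableD.
Qed.

Lemma integrable_subf d (T : measurableType d) (mu : measure T R) (f g : T -> R) :
  mu.-integrable [set: T] (EFin \o f) -> mu.-integrable [set: T] (EFin \o g) ->
  mu.-integrable [set: T] (EFin \o (fun x => f x - g x)).
Proof.
move=> hf hg; rewrite (_ : EFin \o _ = ((EFin \o f) \- (EFin \o g))%E)//.
exact: integrableB.
Qed.

Lemma borel_open (X : ptopologicalType) (U : set X) : open U ->
  measurable (U : set (borel X)).
Proof. by move=> oU; exact: sub_sigma_algebra. Qed.

Lemma borel_closed (X : ptopologicalType) (U : set X) : closed U ->
  measurable (U : set (borel X)).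
Proof.
by move=> cU; rewrite -(setCK U); apply: measurableC; apply: borel_open; exact: closed_openC.
Qed.

Lemma continuous_borel (X Y : ptopologicalType) (f : X -> Y) : continuous f ->
  measurable_fun [set: borel X] (f : borel X -> borel Y).
Proof.
move=> /continuousP cf.
apply: (@measurability _ _ (borel X) (borel Y) setT f (@open Y)) => // _ [U oU <-].
by rewrite setTI; apply: borel_open; exact: cf.
Qed.

Lemma continuous_borel_realfun (X : ptopologicalType) (f : X -> R) : continuous f ->
  measurable_fun [set: borel X] (f : borel X -> R).
Proof.
move=> /continuousP cf.
apply: (@measurability _ _ (borel X) R setT f (@RGenOInfty.G R)); first exact: RGenOInfty.measurableE.
move=> _ [_ [r ->] <-].
by rewrite setTI; apply: borel_open; apply: cf; exact: rray_open.
Qed.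

Lemma integrable_bounded_continuous (X : ptopologicalType)
    (nu : probability (borel X) R) (f : X -> R) (b : R) :
  continuous f -> (forall x, `|f x| <= b) -> nu.-integrable [set: borel X] (EFin \o f).
Proof.
move=> cf fb; apply: measurable_bounded_integrable => //.
- exact: le_lt_trans (probability_le1 nu measurableT) (ltry _).
- exact: continuous_borel_realfun.
- exists b; split; first exact: num_real.
  by move=> x bx y _ /=; apply: le_trans (fb y) (ltW bx).
Qed.

End borel_measurability.

Section levy_continuity.
Context {R : realType} {k : nat}.
Variables (S : nat -> finType) (p : forall n, S n -> R).
Variables (z : forall n, S n -> 'rV[R]_k) (nu : probability (borel 'rV[R]_k) R).
Arguments p : clear implicits.
Arguments z : clear implicits.
Hypothesis p_ge0 : forall n u, 0 <= p n u.
Hypothesis p_sum1 : forall n, \sum_u p n u = 1.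
Hypothesis char_cvg : forall t c,
  mean (p n) (fun u => cos (dotp t (z n u) + c)) @[n --> \oo] -->
  \int[nu]_x cos (dotp t x + c).
Hypothesis tight : exists2 B : R, 0 <= B & \forall n \near \oo,
  forall i, mean (p n) (fun u => z n u 0 i ^+ 2) <= B.

Lemma dotp_continuous (t : 'rV[R]_k) : continuous (dotp t).
Proof.
move=> x; apply: (@cvg_sum_fin R _ (nbhs x) (nbhs_filter x)) => i.
by apply: continuous_scalef; exact: coord_continuous.
Qed.

Lemma cos_dotp_continuous (t : 'rV[R]_k) (c : R) : continuous (fun x => cos (dotp t x + c)).
Proof.
have h : continuous (fun x => dotp t x + c).
  by apply: continuous_addf; [exact: dotp_continuous|exact: cst_continuous].
by move=> x; apply: (continuous_comp (h x)); exact: continuous_cos.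
Qed.

Let cos_integrable t c :
  nu.-integrable [set: borel 'rV[R]_k] (EFin \o (fun x => cos (dotp t x + c))).
Proof.
apply: (@integrable_bounded_continuous _ _ _ _ 1); first exact: cos_dotp_continuous.
by move=> x; exact: cos_max.
Qed.

Let trigpoly_facts T : trigpoly T -> continuous T /\
  mean (p n) (fun u => T (z n u)) @[n --> \oo] --> \int[nu]_x T x /\
  nu.-integrable [set: borel 'rV[R]_k] (EFin \o T).
Proof.
move=> [s]; elim: s T => [|q s IH] T Ts.
  have -> : T = fun=> 0 by apply/funext => x; rewrite Ts big_nil.
  split; first exact: cst_continuous.
  split; last by apply: (@integrable_bounded_continuous _ _ _ _ 0) => [|x]; [exact: cst_continuous|rewrite normr0].
  rewrite Rintegral_cst// mul0r.
  rewrite [X in X @ _ --> _](_ : _ = fun=> 0); first exact: cvg_cst.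
  by apply/funext => n; rewrite mean_cst.
have {IH} [cT' [lT' iT']] := IH (fun x => \sum_(q <- s) q.1.1 * cos (dotp q.1.2 x + q.2)) (fun=> erefl).
set T' := (fun x => _) in cT' lT' iT'.
have -> : T = fun x => q.1.1 * cos (dotp q.1.2 x + q.2) + T' x.
  by apply/funext => x; rewrite Ts big_cons.
have iq : nu.-integrable [set: borel 'rV[R]_k] (EFin \o (fun x => q.1.1 * cos (dotp q.1.2 x + q.2))).
  exact: integrable_scale.
split.
  by apply: continuous_addf => //; apply: continuous_scalef; exact: cos_dotp_continuous.
split; last exact: integrable_addf.
rewrite RintegralD// RintegralZl//.
under eq_fun do rewrite meanD meanZ.
by apply: cvgD => //; apply: cvgMr; exact: char_cvg.
Qed.

Let box (L : R) : set 'rV[R]_k := [set x | forall i, `|x 0 i| <= L].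

Let measurable_box L : measurable (box L : set (borel 'rV[R]_k)).
Proof.
apply: borel_closed.
have -> : box L = \bigcap_(i in [set: 'I_k]) [set x | `|x 0 i| <= L].
  by apply/seteqP; split => x /=; [move=> H i _; exact: H|move=> H i; exact: H].
apply: closed_bigI => i _.
apply: (@closed_comp _ _ (fun x : 'rV[R]_k => `|x 0 i|) [set y | y <= L]).
  by move=> x _; apply: continuous_comp; [exact: coord_continuous|exact: norm_continuous].
exact: closed_le.
Qed.

(** The complements of the boxes decrease to the empty set. *)
Let nu_tail e : 0 < e -> exists2 L, 0 < L & forall L', L <= L' -> fine (nu (~` box L')) <= e.
Proof.
move=> e0.
have : (nu \o (fun n : nat => ~` box n%:R)) n @[n --> \oo] --> nu (\bigcap_n ~` box n%:R).
  apply: nonincreasing_cvg_mu.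
  - exact: le_lt_trans (probability_le1 nu (measurableC (measurable_box _))) (ltry _).
  - by move=> n; exact: measurableC.
  - by apply: bigcap_measurable => // n _; exact: measurableC.
  - move=> a b ab; apply/subsetPset => x /=; apply: contra_not => H i.
    by apply: le_trans (H i) _; rewrite ler_nat.
have -> : \bigcap_n ~` box n%:R = set0.
  apply/seteqP; split => // x /= H.
  have [n nx] : exists n : nat, forall i, `|x 0 i| <= n%:R.
    exists (Num.truncn (\sum_i `|x 0 i|)).+1 => i.
    apply: (@le_trans _ _ (\sum_i `|x 0 i|)).
      by rewrite (bigD1 i)//= lerDl sumr_ge0.
    by rewrite ltW// truncnS_gt.
  exact: (H n I).
rewrite measure0 => /fine_cvgP[_ /cvgrPdist_le/(_ _ e0)] [N _ HN].
exists N.+1%:R => // L' NL'.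
have := HN N.+1 (leqnSn N); rewrite /= sub0r normrN => h.
apply: le_trans (le_trans (ler_norm _) h).
apply: fine_le; rewrite ?fin_num_measure//; try exact: measurableC.
apply: le_measure; rewrite ?inE; try exact: measurableC.
by move=> x; apply: contra_not => H i; exact: le_trans (H i) NL'.
Qed.

(** On a large box [f] is replaced by a trigonometric polynomial, for which the
  convergence is the hypothesis on characteristic functions. Outside of the box
  both [f] and the polynomial are bounded by [b], and both laws have little mass
  there: for the finite laws this is Chebyshev's inequality. *)
Theorem levy_continuity (f : 'rV[R]_k -> R) (b : R) :
  continuous f -> (forall x, `|f x| <= b) ->
  mean (p n) (fun u => f (z n u)) @[n --> \oo] --> \int[nu]_x f x.
Proof.
move=> cf fb; apply/cvgrPdist_le => e e0.
have b0 : 0 <= b := le_trans (normr_ge0 _) (fb 0).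
have [B B0 nearB] := tight.
have b1 : 0 < 2 * b + 1 by rewrite ltr_wpDl// mulr_ge0.
pose d := e / 5 / (2 * b + 1).
have d0 : 0 < d by rewrite !divr_gt0.
have bd : 2 * b * d <= e / 5.
  by rewrite /d mulrCA ler_piMr ?divr_ge0 ?(ltW e0)// ler_pdivrMr// mul1r lerDl.
have [L0 L00 HL0] := nu_tail d0.
(* Chebyshev needs k B / L ^ 2 <= d *)
pose L := L0 + k%:R * B / d + 1.
have kBd : 0 <= k%:R * B / d.
  by apply: divr_ge0; [apply: mulr_ge0|exact: ltW].
have LL0 : L0 <= L by rewrite /L -addrA lerDl addr_ge0.
have L1 : 1 <= L by rewrite /L lerDr addr_ge0// ltW.
have L_gt0 : 0 < L := lt_le_trans ltr01 L1.
have tail_z : k%:R * B / L ^+ 2 <= d.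
  rewrite ler_pdivrMr ?exprn_gt0// -ler_pdivrMl// [d^-1 * _]mulrC.
  apply: (@le_trans _ _ L); last by rewrite expr2 ler_peMr// ltW.
  by rewrite /L -addrA addrCA lerDl addr_ge0// ltW.
have [T [Tt Tb TL]] := trigpoly_approx cf fb L_gt0 (divr_gt0 e0 (ltr0n R 5)).
have [cT [lT iT]] := trigpoly_facts Tt.
have e5 : 0 < e / 5 by rewrite divr_gt0.
have fi : nu.-integrable [set: borel 'rV[R]_k] (EFin \o f).
  exact: (@integrable_bounded_continuous _ _ _ _ b).
have hnu : `|\int[nu]_x T x - \int[nu]_x f x| <= e / 5 + 2 * b * d.
  rewrite -RintegralB//.
  have iTf : nu.-integrable [set: borel 'rV[R]_k] (EFin \o (fun x => T x - f x)).
    exact: integrable_subf.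
  apply: le_trans (le_normr_Rintegral _ iTf) _ => //.
  have iI : nu.-integrable [set: borel 'rV[R]_k] (EFin \o \1_(~` box L)).
    by apply: integrable_indic => //; exact: measurableC.
  apply: (@le_trans _ _ (\int[nu]_x (e / 5 + 2 * b * \1_(~` box L) x))).
    apply: le_Rintegral => //.
    - exact: integrable_norm.
    - apply: integrable_addf; first exact: finite_measure_integrable_cst.
      exact: integrable_scale.
    move=> x _; rewrite indicE; case: (boolP (x \in ~` box L)) => xL /=.
      rewrite mulr1; apply: le_trans (ler_normB _ _) _.
      apply: (@le_trans _ _ (b + b)); first exact: lerD.
      by rewrite mulr_natl mulr2n lerDr ltW.
    rewrite mulr0 addr0; apply: TL.
    by move: xL; rewrite in_setC negbK inE.
  rewrite RintegralD//; [|exact: finite_measure_integrable_cst|exact: integrable_scale].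
  rewrite RintegralZl// Rintegral_cst// [fine _](_ : _ = 1); last first.
    exact: (congr1 fine (probability_setT nu)).
  rewrite mulr1 lerD2l.
  rewrite ler_wpM2l ?mulr_ge0// /Rintegral integral_indic//; last exact: measurableC.
  by rewrite setIT; exact: HL0.
move/cvgrPdist_le/(_ _ e5) : lT => lT; near=> n.
have hT : `|\int[nu]_x T x - mean (p n) (fun u => T (z n u))| <= e / 5.
  by near: n.
have hB : forall i, mean (p n) (fun u => z n u 0 i ^+ 2) <= B by near: n.
have hn : `|mean (p n) (fun u => T (z n u)) - mean (p n) (fun u => f (z n u))|
   <= e / 5 + 2 * b * d.
  rewrite -meanB; apply: le_trans (normr_mean _ _) _ => //.
  apply: (@le_trans _ _ (mean (p n) (fun u => e / 5 + 2 * b * (\sum_i (z n u 0 i ^+ 2 / L ^+ 2))))).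
    apply: ler_mean => // u.
    have s0 : 0 <= \sum_i (z n u 0 i ^+ 2 / L ^+ 2).
      by apply: sumr_ge0 => i _; rewrite divr_ge0 ?sqr_ge0.
    have [inL|] := pselect (forall i, `|z n u 0 i| <= L).
      by rewrite -[leLHS]addr0 lerD ?TL// mulr_ge0// mulr_ge0.
    move=> /existsNP[i /negP]; rewrite -ltNge => far.
    apply: le_trans (ler_normB _ _) _.
    apply: (@le_trans _ _ (b + b)); first exact: lerD.
    have bs (s : R) : 1 <= s -> b + b <= e / 5 + 2 * b * s by move=> s1; nra.
    apply: bs; rewrite (bigD1 i)//= -[1]addr0 lerD//.
      rewrite ler_pdivlMr ?exprn_gt0// mul1r -[leRHS]real_normK ?num_real//.
      by rewrite lerXn2r ?nnegrE// ltW.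
    by apply: sumr_ge0 => j _; rewrite divr_ge0 ?sqr_ge0.
  rewrite meanD mean_cst// meanZ lerD2l ler_wpM2l ?mulr_ge0//.
  apply: le_trans tail_z; rewrite mean_sum.
  apply: (@le_trans _ _ (\sum_(i < k) B / L ^+ 2)).
    apply: ler_sum => i _.
    rewrite (eq_mean _ (G := fun u => (L ^+ 2)^-1 * z n u 0 i ^+ 2)); last first.
      by move=> u; rewrite mulrC.
    by rewrite meanZ mulrC ler_pM2r ?invr_gt0 ?exprn_gt0.
  by rewrite sumr_const card_ord -[X in X <= _]mulr_natl mulrA.
move: hnu hT hn bd; move: (mean _ _) (mean _ _) (\int[nu]_x T x) (\int[nu]_x f x) => m1 m2 i1 i2.
rewrite !ler_norml => /andP[? ?] /andP[? ?] /andP[? ?] ?; apply/andP; split; lra.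
Unshelve. all: by end_near. Qed.

End levy_continuity.

(** * Normal vectors and their characteristic functions *)

Section normal_characteristic_function.
Context {R : realType}.
Local Notation leb := (@lebesgue_measure R).
Local Notation phi := (@normal_pdf R 0 1).

Lemma cos_affine_continuous (t c : R) : continuous (fun x : R => cos (t * x + c)).
Proof.
move=> x; apply: (cvg_comp (fun x => t * x + c) cos); last exact: continuous_cos.
by apply: cvgD; [apply: cvgMr|]; [exact: cvg_id|exact: cvg_cst].
Qed.

Lemma std_normal_pdfE x : phi x = normal_peak 1 * expR (- (x ^+ 2 / 2)).
Proof.
rewrite normal_pdfE ?oner_eq0// /normal_fun subr0 expr1n mulNr.
by congr (_ * expR (- (_ / _))).
Qed.

Lemma std_normal_pdf_derive (x : R) : is_derive x 1 phi (- x * phi x).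
Proof.
rewrite (_ : phi = fun x => normal_peak 1 * expR (- (x ^+ 2 / 2))); last first.
  by apply/funext => y; exact: std_normal_pdfE.
apply: is_derive_eq; rewrite /GRing.scale/= ; lra.
Qed.

Let peak_gt0 s : s != 0 -> 0 < @normal_peak R s := @normal_peak_gt0 R s.

(** A multiple of the normal density of standard deviation 2: it dominates the
  standard density and its product with |x|, so that both are integrable. *)
Definition normal_majorant (x : R) : R :=
  normal_peak 1 / normal_peak 2 * normal_pdf 0 2 x.

Lemma normal_majorantE x : normal_majorant x = normal_peak 1 * expR (- (x ^+ 2 / 8)).
Proof.
rewrite /normal_majorant normal_pdfE ?pnatr_eq0// mulrA mulfVK; last first.
  by rewrite gt_eqF// peak_gt0// pnatr_eq0.
rewrite /normal_fun subr0 mulNr; congr (_ * expR (- (_ / _))); lra.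
Qed.

Lemma normal_majorant_ge0 x : 0 <= normal_majorant x.
Proof. by rewrite normal_majorantE mulr_ge0 ?expR_ge0 ?normal_peak_ge0. Qed.

Lemma std_normal_pdf_le x : phi x <= normal_majorant x.
Proof.
rewrite std_normal_pdfE normal_majorantE ler_wpM2l ?normal_peak_ge0//.
rewrite ler_expR lerN2; have := sqr_ge0 x; lra.
Qed.

Lemma normal_first_moment_le x : `|x| * phi x <= normal_majorant x.
Proof.
rewrite std_normal_pdfE normal_majorantE mulrCA ler_wpM2l ?normal_peak_ge0//.
have -> : - (x ^+ 2 / 2) = - (x ^+ 2 / 8) + - (x ^+ 2 * 3 / 8) by lra.
rewrite expRD mulrCA ler_piMr ?expR_ge0// expRN ler_pdivrMr ?expR_gt0// mul1r.
apply: le_trans (expR_ge1Dx _).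
have := real_normK (num_real x); set y := `|x| => <-.
have := sqr_ge0 (3 * y - 4); rewrite sqrrB exprMn; lra.
Qed.

Lemma normal_majorant_le x : normal_majorant x <= normal_peak 1.
Proof.
rewrite normal_majorantE ler_piMr ?normal_peak_ge0// -[leRHS]expR0 ler_expR.
by rewrite oppr_le0 divr_ge0 ?sqr_ge0.
Qed.

Lemma integrable_normal_majorant : leb.-integrable setT (EFin \o normal_majorant).
Proof. by apply: integrable_scale; exact: integrable_normal_pdf. Qed.

Let integrable_dominated (f : R -> R) (b : R) : continuous f ->
  (forall x, `|f x| <= b * normal_majorant x) -> leb.-integrable setT (EFin \o f).
Proof.
move=> cf fb; apply: (le_integrable measurableT _ _ (integrable_scale b integrable_normal_majorant)).
  by apply/measurable_EFinP; exact: continuous_measurable_fun.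
move=> x _ /=; rewrite lee_fin; apply: le_trans (fb x) (ler_norm _).
Qed.

Variable c : R.
Let f (t x : R) : R := cos (t * x + c) * phi x.
Let df (t x : R) : R := - x * sin (t * x + c) * phi x.
Let g (t : R) : R := \int[leb]_x f t x.
Let H (t x : R) : R := sin (t * x + c) * phi x.
Let dH (t x : R) : R := t * f t x + df t x.

Let phi_ge0 x : 0 <= phi x := normal_pdf_ge0 0 1 x.

Let dphi := std_normal_pdf_derive.

Let f_derive (t x : R) : is_derive t 1 (f ^~ x) (df t x).
Proof.
rewrite /f; apply: is_derive_eq; rewrite /GRing.scale/= /df; lra.
Qed.

Let H_derive (t x : R) : is_derive x 1 (H t) (dH t x).
Proof.
rewrite /H; have := dphi x => dx; apply: is_derive_eq.
rewrite /GRing.scale/= /dH /f /df; lra.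
Qed.

Let cphi : continuous phi.
Proof. by apply: continuous_normal_pdf; exact: oner_neq0. Qed.

Let cf (t : R) : continuous (f t).
Proof.
by move=> x; apply: cvgM; [exact: cos_affine_continuous|exact: cphi].
Qed.

Let cdf (t : R) : continuous (df t).
Proof.
move=> x; apply: cvgM; last exact: cphi.
apply: cvgM; first by apply: cvgN; exact: cvg_id.
apply: (cvg_comp (fun x => t * x + c) sin); last exact: continuous_sin.
by apply: cvgD; [apply: cvgMr|]; [exact: cvg_id|exact: cvg_cst].
Qed.

Let f_le (t x : R) : `|f t x| <= 1 * normal_majorant x.
Proof.
rewrite normrM (ger0_norm (phi_ge0 x)); apply: ler_pM => //.
  exact: cos_max.
exact: std_normal_pdf_le.
Qed.

Let df_le (t x : R) : `|df t x| <= 1 * normal_majorant x.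
Proof.
rewrite mul1r !normrM normrN (ger0_norm (phi_ge0 x)) mulrAC.
apply: le_trans (normal_first_moment_le x); rewrite ler_piMr ?sin_max// mulr_ge0//.
Qed.

Let int_f (t : R) : leb.-integrable setT (EFin \o f t).
Proof. exact: (integrable_dominated (b := 1)). Qed.

Let int_df (t : R) : leb.-integrable setT (EFin \o df t).
Proof. exact: (integrable_dominated (b := 1)). Qed.

(** Differentiation under the integral sign. *)
Let g_derive (t : R) : is_derive t 1 g (\int[leb]_x df t x).
Proof.
have Ia : `]t - 1, t + 1[%classic t by rewrite /= in_itv/=; apply/andP; split; lra.
have h1 x y : `]t - 1, t + 1[%classic x -> [set: R] y -> derivable (f ^~ y) x 1.
  by move=> _ _; have [] := f_derive x y.
have h2 x y : `]t - 1, t + 1[%classic x -> [set: R] y ->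
    `|partial1of2 f x y| <= normal_majorant y.
  move=> _ _; rewrite partial1of2E; have [_ ->] := f_derive x y.
  by rewrite -[leRHS]mul1r.
have h0 x : `]t - 1, t + 1[%classic x -> leb.-integrable setT (EFin \o f x) by [].
apply: DeriveDef.
  exact: (derivable_under_integral measurableT Ia h0 h1 normal_majorant_ge0 integrable_normal_majorant h2).
rewrite -derive1E.
rewrite (differentiation_under_integral measurableT Ia h0 h1 normal_majorant_ge0 integrable_normal_majorant h2).
apply: eq_Rintegral => y _; rewrite partial1of2E.
by have [_ ->] := f_derive t y.
Qed.

Let int_dH (t : R) : leb.-integrable setT (EFin \o dH t).
Proof. by apply: integrable_addf => //; exact: integrable_scale. Qed.

(** The integral of a derivative over the whole line, where the primitive
  vanishes at both ends. *)
Let integral_dH (t : R) : \int[leb]_x dH t x = 0.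
Proof.
have cdH : continuous (dH t).
  by apply: continuous_addf; [apply: continuous_scalef; exact: cf|exact: cdf].
have cH : continuous (H t).
  move=> x; have [dx _] := H_derive t x.
  exact/differentiable_continuous/derivable1_diffP.
pose I (n : nat) : set R := `[- n.+1%:R, n.+1%:R]%classic.
pose fn (n : nat) := (EFin \o dH t) \_ (I n).
have mdH : measurable_fun setT (EFin \o dH t).
  by apply/measurable_EFinP; exact: continuous_measurable_fun.
have mfn n : measurable_fun setT (fn n).
  have mI : measurable (I n) by exact: measurable_itv.
  exact: ((measurable_restrictT _ mI).1 (measurable_funTS mdH)).
have fn_cvg x : fn n x @[n --> \oo] --> (EFin \o dH t) x.
  apply: cvg_near_cst; near=> n; rewrite /fn patchE mem_set//.
  rewrite /I/= in_itv/= -ler_norml; apply: (@le_trans _ _ n%:R); last by rewrite ler_nat.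
  near: n; exact: nbhs_infty_ger.
have ae1 : {ae leb, forall x, [set: R] x -> fn ^~ x @ \oo --> (EFin \o dH t) x}.
  by apply: aeW => x _; exact: fn_cvg.
have ae2 : {ae leb, forall x n, [set: R] x -> (`|fn n x| <= (abse \o (EFin \o dH t)) x)%E}.
  apply: aeW => x n _; rewrite /fn patchE; case: ifP => //= _.
  by rewrite normr0 lee_fin.
have [_ _] := @dominated_convergence _ _ _ leb setT measurableT fn _ (abse \o (EFin \o dH t)) mfn mdH ae1 (integrable_abse (int_dH t)) ae2.
have fn_int : (fun n => \int[leb]_x fn n x)%E = (fun n => (H t n.+1%:R - H t (- n.+1%:R))%:E).
  apply/funext => n; rewrite -integral_mkcond.
  apply: continuous_FTC2.
  - by rewrite (@lt_trans _ _ 0)// oppr_lt0.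
  - exact: continuous_subspaceT.
  - split; first by move=> x _; have [] := H_derive t x.
      by apply: cvg_at_right_filter; exact: cH.
    by apply: cvg_at_left_filter; exact: cH.
  - by move=> x _; rewrite derive1E; have [_ ->] := H_derive t x.
move=> lim_dom.
have : (fun n => (H t n.+1%:R - H t (- n.+1%:R))%:E) @ \oo --> (0%:E : \bar R).
  apply/cvg_EFin; first exact: nearW.
  apply/cvgr0Pnorm_le => e e0; near=> n.
  have n0 : 0 < n.+1%:R :> R by [].
  have HN (x : R) : n.+1%:R <= `|x| -> `|H t x| <= normal_peak 1 / n.+1%:R.
    move=> nx; rewrite normrM (ger0_norm (phi_ge0 x)).
    apply: (@le_trans _ _ (phi x)); first by rewrite ler_piMl// sin_max.
    rewrite ler_pdivlMr//; apply: le_trans (normal_majorant_le x).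
    apply: le_trans (normal_first_moment_le x).
    by rewrite mulrC ler_wpM2r.
  apply: le_trans (ler_normB _ _) _.
  apply: le_trans (lerD (HN _ _) (HN _ _)) _; rewrite ?normrN ?normr_nat//.
  rewrite -mulrDl ler_pdivrMr// -ler_pdivrMl//.
  apply: (@le_trans _ _ n%:R); last by rewrite ler_nat.
  near: n; exact: nbhs_infty_ger.
rewrite -fn_int => lim0.
have := cvg_unique _ lim_dom lim0.
by rewrite /Rintegral => ->.
Unshelve. all: by end_near. Qed.

(** Integration by parts, since - x phi x is the derivative of phi. *)
Let g_ode (t : R) : \int[leb]_x df t x = - t * g t.
Proof.
have := integral_dH t; rewrite /dH RintegralD//; last exact: integrable_scale.
rewrite RintegralZl// -/(g t); lra.
Qed.

Let integral_normal (h : R -> R) (b : R) : continuous h -> (forall x, `|h x| <= b) ->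
  \int[normal_prob 0 1]_x h x = \int[leb]_x (h x * phi x).
Proof.
move=> ch hb; rewrite /Rintegral; congr fine.
have mh : measurable_fun setT (EFin \o h).
  by apply/measurable_EFinP; exact: continuous_measurable_fun.
have ih : (normal_prob 0 1).-integrable setT (EFin \o h).
  apply: measurable_bounded_integrable => //.
  - exact: le_lt_trans (probability_le1 (normal_prob 0 1) measurableT) (ltry _).
  - exact: continuous_measurable_fun.
  - exists b; split; first exact: num_real.
    by move=> x bx y _ /=; apply: le_trans (hb y) (ltW bx).
under [RHS]eq_integral do rewrite EFinM.
rewrite -(Radon_Nikodym_change_of_variables (normal_prob_dominates 0 1))//=.
apply: ae_eq_integral => //.
- apply: emeasurable_funM => //; apply: (measurable_int leb).
  by apply: Radon_Nikodym_integrable; exact: normal_prob_dominates.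
- apply: emeasurable_funM => //=; apply/measurableT_comp => //=.
  exact: measurable_normal_pdf.
- apply: ae_eqe_mul2l => /=.
  rewrite Radon_NikodymE//=; first exact: normal_prob_dominates.
  move=> dom; case: cid => /= k [h1 h2 h3].
  apply: integral_ae_eq => //=.
  + by apply/measurableT_comp => //; exact: measurable_normal_pdf.
  + by move=> E _ mE; rewrite -h3.
Qed.

(** As a function of t the left-hand side satisfies g' = - t g, whence it is a
  multiple of expR (- t ^ 2 / 2), and its value at 0 is cos c. The phase c makes
  the real integrals carry the full characteristic function. *)
Lemma normal_char (t : R) :
  \int[normal_prob 0 1]_x cos (t * x + c) = expR (- (t ^+ 2 / 2)) * cos c.
Proof.
rewrite (integral_normal (b := 1)) => [||x]; first last.
  exact: cos_max.
  exact: cos_affine_continuous.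
rewrite -/(g t).
pose k s := g s * expR (s ^+ 2 / 2).
have dk (s : R) : is_derive s 1 k 0.
  have := g_derive s => ds; rewrite g_ode in ds.
  rewrite /k; apply: is_derive_eq; rewrite /GRing.scale/=; lra.
have := @is_derive_0_is_cst R k t 0 dk.
have g0 : g 0 = cos c.
  rewrite /g /f; under eq_Rintegral do rewrite mul0r add0r.
  rewrite RintegralZl//; last exact: integrable_normal_pdf.
  by rewrite /Rintegral integral_normal_pdf mulr1.
rewrite /k g0 expr0n/= mul0r expR0 mulr1 => <-.
by rewrite mulrCA -expRD addNr expR0 mulr1.
Qed.

End normal_characteristic_function.

Section borel_row_vectors.
Context {R : realType}.

(** Open sets of row vectors are countable unions of rational cubes, so that
  measurability into the Borel sets can be checked coordinatewise. *)
Lemma measurable_fun_rV d (T : measurableType d) (l : nat) (F : T -> 'rV[R]_l) :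
  (forall i, measurable_fun [set: T] (fun w => F w 0 i)) ->
  measurable_fun [set: T] (F : T -> borel 'rV[R]_l).
Proof.
move=> mF.
apply: (@measurability _ _ T (borel 'rV[R]_l) setT F (@open 'rV[R]_l)) => // _ [U oU <-].
rewrite setTI.
pose cube (q : {ffun 'I_l -> rat} * nat) : set 'rV[R]_l :=
  [set x | forall i, `|x 0 i - ratr (q.1 i)| < q.2.+1%:R^-1].
have -> : F @^-1` U = \bigcup_q (if `[< cube q `<=` U >] then F @^-1` (cube q) else set0).
  apply/seteqP; split => [w /= FU|w [q _]]; last first.
    by case: asboolP => // h /h.
  have /nbhs_ballP[e /= e0 eU] : nbhs (F w) U by exact: open_nbhs_nbhs.
  have [n ne] : exists n : nat, n.+1%:R^-1 < e / 2.
    have e2 : 0 < e / 2 by rewrite divr_gt0.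
    have [n _ H] := near_infty_natSinv_lt (PosNum e2).
    by exists n; apply: (H n) => /=.
  have rat_ex (i : 'I_l) : exists r : rat, `|F w 0 i - ratr r| < n.+1%:R^-1.
    have [|r] := @rat_in_itvoo R (F w 0 i - n.+1%:R^-1) (F w 0 i + n.+1%:R^-1).
      by rewrite ltrD2l gt0_cp// invr_gt0.
    rewrite in_itv/= => /andP[r1 r2]; exists r.
    by move: (n.+1%:R^-1) r1 r2 => z r1 r2; rewrite ltr_norml; apply/andP; split; lra.
  pose q : {ffun 'I_l -> rat} := [ffun i => sval (cid (rat_ex i))].
  exists (q, n) => //.
  have qF : cube (q, n) (F w).
    by move=> i /=; rewrite ffunE; case: cid.
  case: asboolP => // -[] y yq; apply: eU; split => // a i; rewrite (ord1 a).
  rewrite /ball/= -(subrKA (ratr (q i))); apply: le_lt_trans (ler_normD _ _) _.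
  have := qF i; have := yq i; rewrite /= distrC.
  by move: (n.+1%:R^-1) ne => z; lra.
apply: countable_bigcupT_measurable; first exact: countableP.
move=> q; case: asboolP => _; last exact: measurable0.
have -> : F @^-1` cube q = \bigcap_(i in [set: 'I_l])
    ((fun w => F w 0 i) @^-1` ball (ratr (q.1 i) : R) (q.2.+1%:R^-1 : R)).
  apply/seteqP; split => w /= H i; first by move=> _; rewrite /ball/= distrC; exact: H.
  by have := H i I; rewrite /ball/= distrC.
apply: fin_bigcap_measurable => // i _.
rewrite -[X in measurable X]setTI; apply: mF => //.
exact: measurable_ball.
Qed.

End borel_row_vectors.

Section image_probability.
Context {R : realType} d d' (T : measurableType d) (T' : measurableType d').

Lemma image_probability (P : probability T R) (f : T -> T') :
  measurable_fun [set: T] f ->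
  exists Q : probability T' R, (forall B, Q B = P (f @^-1` B)) /\
   forall (h : T' -> R) (b : R), measurable_fun [set: T'] h -> (forall y, `|h y| <= b) ->
     \int[Q]_y h y = \int[P]_x h (f x).
Proof.
move=> mf.
pose X : {mfun T >-> T'} := HB.pack f (isMeasurableFun.Build _ _ _ _ f mf).
exists (distribution P X : probability T' R); split => // h b mh hb.
rewrite /Rintegral; congr fine.
apply: (@integral_distribution _ _ _ _ _ P X (EFin \o h)).
  exact/measurable_EFinP.
apply: (@measurable_bounded_integrable _ _ _ P (h \o f)) => //.
- exact: le_lt_trans (probability_le1 P measurableT) (ltry _).
- exact: measurableT_comp.
- exists b; split; first exact: num_real.
  by move=> x bx y _ /=; apply: le_trans (hb _) (ltW bx).
Qed.

End image_probability.

Section standard_normal_vector.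
Context {R : realType}.

Definition cons_rV l (z : R * 'rV[R]_l) : 'rV[R]_l.+1 :=
  \row_i (if unlift ord0 i is Some j then z.2 0 j else z.1).

Lemma cons_rV0 l z : @cons_rV l z 0 ord0 = z.1.
Proof. by rewrite mxE unlift_none. Qed.

Lemma cons_rVS l z j : @cons_rV l z 0 (lift ord0 j) = z.2 0 j.
Proof. by rewrite mxE liftK. Qed.

Lemma measurable_coord l (i : 'I_l) :
  measurable_fun [set: borel 'rV[R]_l] (fun v : borel 'rV[R]_l => (v : 'rV[R]_l) 0 i).
Proof. by apply: continuous_borel_realfun; exact: coord_continuous. Qed.

Lemma measurable_coord_box l (B : 'I_l -> set R) : (forall i, measurable (B i)) ->
  measurable ([set x | forall i, B i (x 0 i)] : set (borel 'rV[R]_l)).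
Proof.
move=> mB; pose S : set (borel 'rV[R]_l) :=
  \bigcap_(i in [set: 'I_l]) ((fun v : 'rV[R]_l => v 0 i) @^-1` B i).
have mS : measurable S.
  apply: fin_bigcap_measurable => // i _.
  by rewrite -[X in measurable X]setTI; exact: measurable_coord.
suff E : S = [set x | forall i, B i (x 0 i)] by rewrite E in mS.
by apply/seteqP; split => x /= H i; [exact: H|move=> _; exact: H].
Qed.

Lemma measurable_cons_rV l :
  measurable_fun [set: (R * borel 'rV[R]_l)%type]
    (@cons_rV l : R * borel 'rV[R]_l -> borel 'rV[R]_l.+1).
Proof.
apply: measurable_fun_rV => i.
have [j ->|->] := unliftP ord0 i.
  under eq_fun do rewrite cons_rVS.
  by apply: (measurableT_comp (measurable_coord j)); exact: measurable_snd.
under eq_fun do rewrite cons_rV0.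
exact: measurable_fst.
Qed.

(** Induction on the dimension: one more independent normal coordinate is
  prepended through a product measure, and its characteristic function
  multiplies the previous one by Fubini's theorem. *)
Theorem standard_normal_exists (l : nat) : exists gam : probability (borel 'rV[R]_l) R,
  is_std_normal gam /\ forall t c,
  \int[gam]_z cos (dotp t z + c) = expR (- (dotp t t / 2)) * cos c.
Proof.
elim: l => [|l [gam [gamN gamC]]].
  exists (dirac (0 : borel 'rV[R]_0) : probability _ R); split.
    move=> B mB; rewrite big_ord0.
    by rewrite /= /dirac indicE mem_set//=; case.
  move=> t c; rewrite /Rintegral integral_dirac//=; last first.
    by apply/measurable_EFinP; apply: continuous_borel_realfun; exact: cos_dotp_continuous.
  by rewrite indicE in_setT mul1r /dotp !big_ord0 mul0r oppr0 expR0 mul1r add0r.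
have [Q [QE QI]] := image_probability ((normal_prob 0 1 \x gam)%E : probability _ R) (measurable_cons_rV (l := l)).
exists Q; split.
  move=> B mB; rewrite QE.
  have -> : cons_rV (l := l) @^-1` [set x | forall i, B i (x 0 i)] =
      B ord0 `*` [set x : 'rV[R]_l | forall i, B (lift ord0 i) (x 0 i)].
    apply/seteqP; split => -[x v] /=.
      move=> H; split; first by have := H ord0; rewrite cons_rV0.
      by move=> i; have := H (lift ord0 i); rewrite cons_rVS.
    move=> [H0 H1] i; have [j ->|->] := unliftP ord0 i; first by rewrite cons_rVS.
    by rewrite cons_rV0.
  have mE : measurable ([set x | forall i, B (lift ord0 i) (x 0 i)] : set (borel 'rV[R]_l)).
    exact: (@measurable_coord_box l (fun i => B (lift ord0 i)) (fun i => mB _)).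
  have PE := product_measure1E (normal_prob 0 1 : probability _ R) gam (mB ord0) mE.
  apply: (etrans (congr1 fine PE)); rewrite fineM ?fin_num_measure//; last exact: mB.
  by rewrite big_ord_recl; congr (_ * _); exact: gamN.
move=> t c.
pose t' : 'rV[R]_l := \row_j t 0 (lift ord0 j).
have dotE (z : R * 'rV[R]_l) : dotp t (cons_rV z) = t 0 ord0 * z.1 + dotp t' z.2.
  rewrite /dotp big_ord_recl cons_rV0; congr (_ + _).
  by apply: eq_bigr => j _; rewrite cons_rVS mxE.
have mcos : measurable_fun [set: borel 'rV[R]_l.+1] (fun x : borel 'rV[R]_l.+1 => cos (dotp t x + c)).
  by apply: continuous_borel_realfun; exact: cos_dotp_continuous.
rewrite (QI _ 1 mcos) => [|x]; last exact: cos_max.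
pose h (z : R * borel 'rV[R]_l) : R := cos (dotp t (cons_rV z) + c).
have ih : ((normal_prob 0 1 \x gam)%E).-integrable [set: (R * borel 'rV[R]_l)%type] (EFin \o h).
  apply: measurable_bounded_integrable => //.
  - exact: le_lt_trans (probability_le1 ((normal_prob 0 1 \x gam)%E : probability _ R) measurableT) (ltry _).
  - by apply: (measurableT_comp mcos); exact: measurable_cons_rV.
  - exists 1; split; first exact: num_real.
    by move=> x bx y _ /=; apply: le_trans (cos_max _) (ltW bx).
rewrite /Rintegral -(integral12_prod_meas1 ih).
transitivity (\int[normal_prob 0 1]_x (expR (- (dotp t' t' / 2)) * cos (t 0 ord0 * x + c))).
  congr fine; apply: eq_integral => x _; rewrite /fubini_F /= -gamC /Rintegral fineK.
    by apply: eq_integral => v _; rewrite /h dotE /=; congr (cos _)%:E; lra.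
  apply: integrable_fin_num => //.
  apply: (@integrable_bounded_continuous _ _ _ _ 1); first exact: cos_dotp_continuous.
  by move=> y; exact: cos_max.
rewrite RintegralZl//; last first.
  apply: measurable_bounded_integrable => //.
  - exact: le_lt_trans (probability_le1 (normal_prob 0 1 : probability _ R) measurableT) (ltry _).
  - by apply: continuous_measurable_fun; exact: cos_affine_continuous.
  - exists 1; split; first exact: num_real.
    by move=> x bx y _ /=; apply: le_trans (cos_max _) (ltW bx).
rewrite normal_char mulrA -expRD.
have -> : dotp t t = t 0 ord0 ^+ 2 + dotp t' t'.
  rewrite /dotp big_ord_recl -expr2; congr (_ + _).
  by apply: eq_bigr => j _; rewrite !mxE.
by congr (expR _ * _); lra.
Qed.

End standard_normal_vector.

Section normal_vector.
Context {R : realType}.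

Lemma dotp_mulmx l k (t : 'rV[R]_k) (z : 'rV[R]_l) (M : 'M[R]_(l, k)) :
  dotp t (z *m M) = dotp (t *m M^T) z.
Proof.
rewrite /dotp; under eq_bigr do rewrite mxE mulr_sumr.
rewrite exchange_big/=; apply: eq_bigr => j _.
by rewrite mxE mulr_suml; apply: eq_bigr => i _; rewrite !mxE; lra.
Qed.

Lemma normal_exists l k (M : 'M[R]_(l, k)) :
  exists nu : probability (borel 'rV[R]_k) R, is_normal nu 0 (M^T *m M) /\
  forall t c, \int[nu]_x cos (dotp t x + c) =
    expR (- (dotp (t *m M^T) (t *m M^T) / 2)) * cos c.
Proof.
have [gam [gamN gamC]] := @standard_normal_exists R l.
pose F (z : 'rV[R]_l) : 'rV[R]_k := 0 + z *m M.
have mF : measurable_fun [set: borel 'rV[R]_l] (F : borel 'rV[R]_l -> borel 'rV[R]_k).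
  apply: measurable_fun_rV => i; apply: continuous_borel_realfun.
  have -> : (fun z : borel 'rV[R]_l => F z 0 i) = dotp (col i M)^T.
    apply/funext => z; rewrite /F add0r mxE /dotp.
    by apply: eq_bigr => j _; rewrite !mxE mulrC.
  exact: dotp_continuous.
have [nu [nuE nuI]] := image_probability gam mF.
exists nu; split; first by exists l, M, gam; split => // B mB; rewrite nuE.
move=> t c; rewrite (nuI _ 1) => [||x]; first last.
- exact: cos_max.
- by apply: continuous_borel_realfun; exact: cos_dotp_continuous.
rewrite -gamC; apply: eq_Rintegral => z _.
by rewrite /F add0r dotp_mulmx.
Qed.

End normal_vector.

(** * Vague convergence at equivalent thresholds *)

Lemma mx_norm_le {R : realType} {m n : nat} (M : 'M[R]_(m, n)) (r : R) : 0 <= r ->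
  (forall i j, `|M i j| <= r) -> `|M| <= r.
Proof.
by move=> r0 Mr; rewrite /Num.norm/= mx_normrE; apply/bigmax_leP; split => // -[i j] _.
Qed.

Lemma mx_norm_ge {R : realType} {m n : nat} (M : 'M[R]_(m, n)) i j : `|M i j| <= `|M|.
Proof.
rewrite [leRHS]/Num.norm/= mx_normrE.
exact: (le_bigmax _ (fun ij => `|M ij.1 ij.2|) (i, j)).
Qed.

Section compactified_space.
Context {R : realType} {k d : nat}.
Local Notation E := 'M[\bar R]_(k, d).
Implicit Types (x y : E) (C : set E).

(** The compactification is metrized by the bounded map x / (1 + |x|), applied
  to every entry. *)
Definition contract_mx x : 'M[R]_(k, d) := map_mx (@contract R) x.

Definition cdist x y : R := `|contract_mx x - contract_mx y|.

Lemma cdist_ltP x y (e : R) : 0 < e -> ball x e y <-> cdist x y < e.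
Proof.
move=> e0; rewrite /cdist.
have -> : (`|contract_mx x - contract_mx y| < e : Prop) =
    ball (contract_mx x) e (contract_mx y).
  by rewrite mx_norm_ball.
split=> -[_ H]; split => // i j; have := H i j; rewrite /ball/= /ereal_ball !mxE.
  by [].
by [].
Qed.

Lemma cdist_sym x y : cdist x y = cdist y x. Proof. exact: distrC. Qed.

Lemma cdist_triangle x y z : cdist x z <= cdist x y + cdist y z.
Proof. exact: ler_distD. Qed.

Lemma cdist_refl x : cdist x x = 0. Proof. by rewrite /cdist subrr normr0. Qed.

Definition cdist_set C x : R := inf [set cdist x c | c in C].

Lemma cdist_set_le C x c : C c -> cdist_set C x <= cdist x c.
Proof.
move=> Cc; apply: ge_inf; last by exists c.
by exists 0 => _ [y _ <-]; exact: normr_ge0.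
Qed.

Lemma cdist_set_lipschitz C x y : C !=set0 -> cdist_set C x <= cdist x y + cdist_set C y.
Proof.
move=> C0; rewrite -lerBlDl; have [c0 Cc0] := C0.
apply: lb_le_inf; first by exists (cdist y c0), c0.
move=> _ [c Cc <-]; rewrite lerBlDl.
exact: le_trans (cdist_set_le x Cc) (cdist_triangle x y c).
Qed.

Lemma cdist_set_eq0 C x : C !=set0 -> closed C -> cdist_set C x <= 0 -> C x.
Proof.
move=> C0 cC x0; apply: cC => B /nbhs_ballP[e /= e0 eB].
have [_ [c Cc <-] ce] : exists2 r, [set cdist x c | c in C] r & r < e.
  have [c0 Cc0] := C0.
  have hi : has_inf [set cdist x c | c in C].
    split; first by exists (cdist x c0), c0.
    by exists 0 => _ [y _ <-]; exact: normr_ge0.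
  have [r Cr re] := inf_adherent e0 hi; exists r => //.
  by apply: lt_le_trans re _; rewrite -[leRHS]add0r lerD2r.
by exists c; split => //; apply: eB; apply/cdist_ltP.
Qed.

Lemma cdist_continuous (f : E -> R) (K : R) :
  (forall x y, `|f x - f y| <= K * cdist x y) -> continuous f.
Proof.
move=> fK x; apply/(@cvgrPdist_lt _ _ _ (nbhs x) (nbhs_filter x)) => e e0.
have K1 : 0 < `|K| + 1 by rewrite ltr_wpDl.
apply/nbhs_ballP; exists (e / (`|K| + 1)); first by rewrite /= divr_gt0.
move=> y /cdist_ltP; rewrite divr_gt0// => /(_ isT); rewrite ltr_pdivlMr// => xy.
apply: le_lt_trans (fK x y) _; apply: le_lt_trans xy.
rewrite mulrC ler_wpM2l//; last by rewrite (le_trans (ler_norm _))// lerDl.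
exact: normr_ge0.
Qed.

Lemma bounded_away_of_dist (C : set E) (r : R) : 0 < r ->
  (forall x, C x -> r <= cdist (const_mx 0%E) x) -> bounded_away C.
Proof.
move=> r0 Cr clo; have := clo (ball (const_mx 0%E) r) _.
case; first by apply/nbhs_ballP; exists r.
by move=> x [/Cr + /cdist_ltP]; move=> h /(_ r0); rewrite ltNge h.
Qed.

Lemma dist_of_bounded_away (C : set E) : bounded_away C -> exists2 r : R, 0 < r &
  forall x, C x -> r <= cdist (const_mx 0%E) x.
Proof.
move=> aw; apply: contrapT => H; apply: aw => B /nbhs_ballP[r /= r0 rB].
apply: contrapT => CB; apply: H; exists r => // x Cx; rewrite leNgt; apply/negP => h.
by apply: CB; exists x; split => //; apply: rB; apply/cdist_ltP.
Qed.

(** The bound does not depend on u, not even near infinity; this makes changes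
  of scale uniformly small on the compactification. *)
Lemma contract_scale (c u : R) : 0 < c ->
  `|contract (c * u)%:E - contract u%:E| <= `|c - 1|.
Proof.
move=> c0 /=; have u0 := normr_ge0 u.
have d1 : 0 < 1 + `|c * u| by rewrite ltr_pwDl.
have d2 : 0 < 1 + `|u| by rewrite ltr_pwDl.
have -> : c * u / (1 + `|c * u|) - u / (1 + `|u|) =
   (c - 1) * (u / ((1 + `|c * u|) * (1 + `|u|))).
  rewrite normrM (gtr0_norm c0); rewrite normrM (gtr0_norm c0) in d1.
  by field; rewrite !gt_eqF.
rewrite normrM ler_piMr// normrM normfV (gtr0_norm (mulr_gt0 d1 d2)).
rewrite ler_pdivrMr ?mulr_gt0// mul1r.
have := normr_ge0 (c * u); nra.
Qed.

(** Replacing the threshold a by an equivalent one moves all rescaled points by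
  a uniformly small distance, which a neighbourhood of a set can absorb. *)
Lemma cdist_erescale (a s : R) (y : 'M[R]_(k, d)) : 0 < a -> 0 < s ->
  cdist (erescale s y) (erescale a y) <= `|a / s - 1|.
Proof.
move=> a0 s0; apply: mx_norm_le => // i j.
rewrite !mxE /=.
have -> : s^-1 * y i j = (a / s) * (a^-1 * y i j) by field; rewrite !gt_eqF.
by apply: contract_scale; rewrite divr_gt0.
Qed.

End compactified_space.

Section indicator_bounds.
Context {R : realType} d (T : measurableType d) (m : {measure set T -> \bar R}).

Lemma integrable_indicator (D : set T) : measurable D -> (m D < +oo)%E ->
  m.-integrable [set: T] (EFin \o \1_D).
Proof.
move=> mD mDoo; apply/integrableP; split.
  by apply/measurable_EFinP; exact: measurable_indic.
rewrite (eq_integral (EFin \o \1_D)) => [|x _]; last by rewrite /= ger0_norm.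
by rewrite integral_indic// setIT.
Qed.

Variables (D : set T) (g : T -> R).
Hypothesis mD : measurable D.
Hypothesis mDoo : (m D < +oo)%E.
Hypothesis g_itv : forall x, (0 <= g x) && (g x <= 1).
Hypothesis mg : measurable_fun [set: T] g.

Let iD : m.-integrable [set: T] (EFin \o \1_D).
Proof. exact: integrable_indicator. Qed.

Let Rintegral_indicator : \int[m]_x (\1_D x) = fine (m D).
Proof. by rewrite /Rintegral integral_indic// setIT. Qed.

Lemma integrable_test (S : set T) : measurable S -> (m S < +oo)%E ->
  (forall x, g x != 0 -> S x) -> m.-integrable [set: T] (EFin \o g).
Proof.
move=> mS mSoo gS; have iS : m.-integrable [set: T] (EFin \o \1_S).
  exact: integrable_indicator.
apply: (le_integrable measurableT _ _ iS); first exact/measurable_EFinP.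
move=> x _ /=; rewrite lee_fin.
have /andP[g0 g1] := g_itv x; rewrite ger0_norm// indicE.
have [->|/gS Sx] := eqVneq (g x) 0; first by rewrite normr_ge0.
by rewrite mem_set// normr1.
Qed.

Lemma measure_le_Rintegral : m.-integrable [set: T] (EFin \o g) ->
  (forall x, D x -> g x = 1) -> fine (m D) <= \int[m]_x g x.
Proof.
move=> ig gD; rewrite -Rintegral_indicator; apply: le_Rintegral => // x _.
rewrite indicE; case: (boolP (x \in D)) => [/set_mem/gD ->//|_].
by have /andP[] := g_itv x.
Qed.

Lemma Rintegral_le_measure : (forall x, g x != 0 -> D x) -> \int[m]_x g x <= fine (m D).
Proof.
move=> gD; rewrite -Rintegral_indicator; apply: le_Rintegral => //.
  exact: integrable_test gD.
move=> x _; rewrite indicE; have [->|/gD Dx] := eqVneq (g x) 0.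
  exact: ler0n.
by rewrite mem_set//; have /andP[] := g_itv x.
Qed.

End indicator_bounds.

Section portmanteau.
Context {R : realType} {k d : nat}.
Local Notation E := 'M[\bar R]_(k, d).
Implicit Types (C B : set E) (x y : E).

(** The standard approximations of indicators: [outer_test] is 1 within
  distance [del] of [C] and 0 beyond [2 del]; [inner_test] is 0 within distance
  [del] of [C] and 1 beyond [2 del]. *)
Definition outer_test C (del : R) x : R :=
  Num.max 0 (Num.min 1 (2 - cdist_set C x / del)).

Definition inner_test C (del : R) x : R :=
  Num.max 0 (Num.min 1 (cdist_set C x / del - 1)).

Let clamp_lipschitz (u v : R) :
  `|Num.max 0 (Num.min 1 u) - Num.max 0 (Num.min 1 v)| <= `|u - v|.
Proof.
have := ler_norm (u - v); have := ler_norm (v - u); rewrite distrC.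
rewrite ler_norml => ? ?.
rewrite !maxEle !minEle.
by case: (leP 1 u) => ?; case: (leP 1 v) => ?; do ?[case: ifPn; rewrite -?ltNge => ?];
  apply/andP; split; lra.
Qed.

Let dist_quot C (del : R) x y : C !=set0 -> 0 < del ->
  `|cdist_set C x / del - cdist_set C y / del| <= del^-1 * cdist x y.
Proof.
move=> C0 del0; rewrite -mulrBl normrM normfV (gtr0_norm del0) mulrC.
rewrite ler_pM2l ?invr_gt0// ler_norml.
have := cdist_set_lipschitz x y C0; have := cdist_set_lipschitz y x C0.
by rewrite (cdist_sym y x) => h1 h2; apply/andP; split; lra.
Qed.

Lemma outer_test_continuous C (del : R) : C !=set0 -> 0 < del ->
  continuous (outer_test C del).
Proof.
move=> C0 del0; apply: (@cdist_continuous _ _ _ _ del^-1) => x y.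
apply: le_trans (clamp_lipschitz _ _) _.
rewrite (_ : _ - _ = cdist_set C y / del - cdist_set C x / del); last lra.
by rewrite distrC; exact: dist_quot.
Qed.

Lemma inner_test_continuous C (del : R) : C !=set0 -> 0 < del ->
  continuous (inner_test C del).
Proof.
move=> C0 del0; apply: (@cdist_continuous _ _ _ _ del^-1) => x y.
apply: le_trans (clamp_lipschitz _ _) _.
rewrite (_ : _ - _ = cdist_set C x / del - cdist_set C y / del); last lra.
exact: dist_quot.
Qed.

Let clamp_itv (u : R) : (0 <= Num.max 0 (Num.min 1 u)) && (Num.max 0 (Num.min 1 u) <= 1).
Proof. by rewrite le_max lexx/= ge_max ler01/= ge_min lexx. Qed.

Lemma outer_test_itv C (del : R) x : (0 <= outer_test C del x) && (outer_test C del x <= 1).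
Proof. exact: clamp_itv. Qed.

Lemma inner_test_itv C (del : R) x : (0 <= inner_test C del x) && (inner_test C del x <= 1).
Proof. exact: clamp_itv. Qed.

Lemma outer_test1 C (del : R) x : 0 < del -> cdist_set C x <= del -> outer_test C del x = 1.
Proof.
move=> del0 xd; rewrite /outer_test; have : cdist_set C x / del <= 1.
  by rewrite ler_pdivrMr// mul1r.
by move=> h; rewrite min_l ?max_r//; lra.
Qed.

Lemma outer_test_neq0 C (del : R) x : 0 < del -> outer_test C del x != 0 ->
  cdist_set C x <= 2 * del.
Proof.
move=> del0; apply: contra_neqT; rewrite -ltNge => h.
rewrite /outer_test max_l// ge_min; apply/orP; right.
by rewrite subr_le0 ler_pdivlMr// ltW.
Qed.

Lemma inner_test1 C (del : R) x : 0 < del -> 2 * del <= cdist_set C x -> inner_test C del x = 1.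
Proof.
move=> del0 xd; rewrite /inner_test; have : 2 <= cdist_set C x / del.
  by rewrite ler_pdivlMr.
by move=> h; rewrite min_l ?max_r//; lra.
Qed.

Lemma inner_test_neq0 C (del : R) x : 0 < del -> inner_test C del x != 0 ->
  del < cdist_set C x.
Proof.
move=> del0; apply: contra_neqT; rewrite -leNgt => h.
rewrite /inner_test max_l// ge_min; apply/orP; right.
by rewrite subr_le0 ler_pdivrMr// mul1r.
Qed.

Variable mu : {measure set (borel E) -> \bar R}.
Hypothesis mu_radon : forall B : set (borel E), measurable B -> bounded_away B -> (mu B < +oo)%E.
Context {dsp : measure_display} {T : measurableType dsp}.
Variables (P : probability T R) (Y : T -> 'M[R]_(k, d)) (a : nat -> R).
Hypothesis mY : measurable_fun [set: T] (Y : T -> borel 'M[R]_(k, d)).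
Hypothesis vague : forall f, vague_test f ->
  (n%:R%:E * \int[P]_w (f (erescale (a n) (Y w)))%:E)%E @[n --> \oo] -->
  (\int[mu]_x (f x)%:E)%E.

Let measurable_dist_le C (r : R) : C !=set0 ->
  measurable ([set x | cdist_set C x <= r] : set (borel E)).
Proof.
move=> C0; apply: borel_closed.
apply: (@closed_comp _ _ (cdist_set C) [set y | y <= r]); last exact: closed_le.
move=> x _; apply: (@cdist_continuous _ _ _ _ 1) => {}x y.
have := @dist_quot C 1 x y C0 ltr01.
by rewrite !divr1 invr1.
Qed.

Lemma erescale_continuous (s : R) : continuous (@erescale R k d s).
Proof.
move=> y B [D nD sDB].
exists (fun i j => [set r | D i j (s^-1 * r)%:E]) => [i j|y' H].
  have := nD i j; rewrite !mxE => h.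
  have cs : {for y i j, continuous (fun r : R => (s^-1 * r)%:E)}.
    apply: (@continuous_comp _ _ _ (fun r : R => s^-1 * r) EFin).
      by apply: cvgMr; exact: cvg_id.
    by apply: cvg_EFin; [exact: nearW|exact: cvg_id].
  exact: cs _ h.
by apply: sDB => i j; rewrite !mxE; exact: H.
Qed.

Lemma measurable_erescale (s : R) (B : set (borel E)) : measurable B ->
  measurable [set w | B (erescale s (Y w))].
Proof.
move=> mB; have := measurableT_comp (continuous_borel (@erescale_continuous s)) mY.
by move=> /(_ measurableT _ mB); rewrite setTI.
Qed.

Let outer_vague C (r del : R) : C !=set0 -> 0 < r -> 0 < del -> del <= r / 4 ->
  (forall x, C x -> r <= cdist (const_mx 0%E) x) ->
  bounded_away [set x | cdist_set C x <= 2 * del] /\ vague_test (outer_test C del).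
Proof.
move=> C0 r0 del0 delr Cr.
have aw : bounded_away [set x | cdist_set C x <= 2 * del].
  apply: (@bounded_away_of_dist _ _ _ _ (r / 2)); first by rewrite divr_gt0.
  move=> x /= xd; have h : r <= cdist_set C (const_mx 0%E).
    apply: lb_le_inf; first by have [c Cc] := C0; exists (cdist (const_mx 0%E) c), c.
    by move=> _ [c Cc <-]; exact: Cr.
  by have := cdist_set_lipschitz (const_mx 0%E) x C0; lra.
split => //; split; first exact: outer_test_continuous.
  by move=> x; have /andP[] := outer_test_itv C del x.
move=> clo; apply: aw; apply: closure_subset clo => x /=.
exact: outer_test_neq0.
Qed.

Let vague_real (f : E -> R) (S : set (borel E)) : vague_test f ->
  (forall x, (0 <= f x) && (f x <= 1)) -> measurable S -> bounded_away S ->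
  (forall x, f x != 0 -> S x) ->
  n%:R * \int[P]_w f (erescale (a n) (Y w)) @[n --> \oo] --> \int[mu]_x f x.
Proof.
move=> fv f01 mS awS fS; have [cf f0 _] := fv.
have := vague fv.
have imu : mu.-integrable [set: borel E] (EFin \o f).
  have mf : measurable_fun [set: borel E] (f : borel E -> R) by exact: continuous_borel_realfun.
  exact (@integrable_test _ _ (borel E) mu f f01 mf S mS (mu_radon mS awS) fS).
have ip n : P.-integrable [set: T] (EFin \o (fun w => f (erescale (a n) (Y w)))).
  apply: (@integrable_test _ _ _ _ _ _ _ [set: T]) => //.
    have mf : measurable_fun [set: borel E] (f : borel E -> R) by exact: continuous_borel_realfun.
    apply: (measurableT_comp mf).
    exact: (measurableT_comp (continuous_borel (@erescale_continuous (a n))) mY).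
  exact: le_lt_trans (probability_le1 P measurableT) (ltry _).
rewrite -[X in _ --> X]fineK; last exact: integrable_fin_num.
move=> /fine_cvg; apply: cvg_trans; apply: near_eq_cvg; near=> n.
rewrite /= /Rintegral fineM//; exact: (integrable_fin_num measurableT (ip n)).
Unshelve. all: by end_near. Qed.

Context {I : Type} {F : set_system I} {FF : ProperFilter F}.
Variables (n : I -> nat) (s : I -> R).
Hypothesis n_cvg : n i @[i --> F] --> \oo.
Hypothesis s_gt0 : \forall i \near F, 0 < s i.
Hypothesis a_gt0 : \forall i \near F, 0 < a (n i).
Hypothesis ratio_cvg : a (n i) / s i @[i --> F] --> (1 : R).

(** The test function is 1 in a neighbourhood of C, so it bounds the indicator
  of C from above even after the change of scale. *)
Lemma limsup_closed_scaled (C : set E) (e : R) : 0 < e -> closed C -> bounded_away C ->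
  \forall i \near F, (n i)%:R * fine (P [set w | C (erescale (s i) (Y w))]) <=
    fine (mu C) + e.
Proof.
move=> e0 cC aw.
have mC : measurable (C : set (borel E)) by exact: borel_closed.
have muC_ge0 : 0 <= fine (mu C) by rewrite fine_ge0.
have [C0|/set0P C0] := eqVneq C set0.
  near=> i; rewrite [X in P X](_ : _ = set0); last by rewrite C0; apply/seteqP; split.
  by rewrite measure0 mulr0 addr_ge0// ltW.
have [r r0 Cr] := dist_of_bounded_away aw.
pose del (j : nat) : R := r / 4 / j.+1%:R.
have del0 j : 0 < del j by rewrite !divr_gt0.
have delr j : del j <= r / 4.
  by rewrite ler_pdivrMr// ler_peMr ?ler1n// divr_ge0// ltW.
have OV j := outer_vague C0 r0 (del0 j) (delr j) Cr.
pose nb (j : nat) : set (borel E) := [set x | cdist_set C x <= 2 * del j].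
have mnb j : measurable (nb j) by exact: measurable_dist_le.
have nboo j : (mu (nb j) < +oo)%E by apply: mu_radon => //; have [] := OV j.
have nb_cvg : mu (nb j) @[j --> \oo] --> mu C.
  have <- : \bigcap_j nb j = C.
    apply/seteqP; split => x; last first.
      move=> Cx j _; rewrite /nb/=; apply: le_trans (cdist_set_le x Cx) _.
      by rewrite cdist_refl mulr_ge0// ltW.
    move=> H; apply: cdist_set_eq0 => //; apply/ler_addgt0Pr => e' e'0; rewrite add0r.
    have [j je] : exists j, 2 * del j <= e'.
      apply: (@filter_ex _ \oo); near=> j.
      rewrite /del mulrA ler_pdivrMr// -ler_pdivrMl//.
      apply: (@le_trans _ _ j%:R); last by rewrite ler_nat.
      near: j; exact: nbhs_infty_ger.
    exact: le_trans (H j Logic.I) je.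
  apply: nonincreasing_cvg_mu => //; first exact: bigcap_measurable.
  move=> i j ij; apply/subsetPset => x; rewrite /nb/= => h; apply: le_trans h _.
  rewrite ler_pM2l// /del ler_pM2l ?divr_gt0// lef_pV2 ?posrE//.
  by rewrite ler_nat.
have muCoo : (mu C < +oo)%E by exact: mu_radon.
have [j Hj] : exists j, fine (mu (nb j)) <= fine (mu C) + e / 2.
  have e2 : 0 < e / 2 by rewrite divr_gt0.
  have : fine (mu (nb j)) @[j --> \oo] --> fine (mu C).
    by apply: fine_cvg; rewrite fineK// ge0_fin_numE.
  move=> /cvgrPdist_le/(_ _ e2)[j _ H]; exists j.
  by have := H j (leqnn j); rewrite /= ler_norml => /andP[]; lra.
have [awj vj] := OV j.
pose f := outer_test C (del j).
have f01 := outer_test_itv C (del j).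
have fnb x : f x != 0 -> nb j x by exact: outer_test_neq0.
have lim_f := vague_real vj f01 (mnb j) awj fnb.
have mf : measurable_fun [set: borel E] (f : borel E -> R).
  by apply: continuous_borel_realfun; have [] := vj.
have intf : \int[mu]_x f x <= fine (mu (nb j)).
  exact: Rintegral_le_measure.
have e2 : 0 < e / 2 by rewrite divr_gt0.
move/cvgrPdist_le/(_ _ e2) : lim_f => lim_f.
have near1 := n_cvg lim_f.
move/cvgrPdist_le/(_ _ (del0 j)) : ratio_cvg => near2.
near=> i.
have h1 : `|\int[mu]_x f x - (n i)%:R * \int[P]_w f (erescale (a (n i)) (Y w))| <= e / 2.
  by near: i.
have si : 0 < s i by near: i.
have ai : 0 < a (n i) by near: i.
have h2 : `|1 - a (n i) / s i| <= del j by near: i.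
have h3 : fine (P [set w | C (erescale (s i) (Y w))]) <=
    \int[P]_w f (erescale (a (n i)) (Y w)).
  have mfc : measurable_fun [set: T] (fun w => f (erescale (a (n i)) (Y w))).
    apply: (measurableT_comp mf).
    exact: (measurableT_comp (continuous_borel (@erescale_continuous (a (n i)))) mY).
  have Poo (D : set T) : measurable D -> (P D < +oo)%E.
    by move=> mD; exact: le_lt_trans (probability_le1 P mD) (ltry _).
  apply: measure_le_Rintegral => //.
  - exact: measurable_erescale.
  - by apply: Poo; exact: measurable_erescale.
  - by apply: (@integrable_test _ _ _ _ _ _ _ [set: T]) => //; exact: Poo.
  move=> w Cw; apply: outer_test1 => //.
  apply: le_trans (cdist_set_le _ Cw) _; rewrite cdist_sym.
  by apply: le_trans (cdist_erescale _ ai si) _; rewrite distrC.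
apply: (@le_trans _ _ ((n i)%:R * \int[P]_w f (erescale (a (n i)) (Y w)))).
  by rewrite ler_wpM2l.
by move: h1; rewrite ler_norml => /andP[]; lra.
Unshelve. all: by end_near. Qed.

Let integrable_pullback (f : E -> R) i : continuous f ->
  (forall x, (0 <= f x) && (f x <= 1)) ->
  P.-integrable [set: T] (EFin \o (fun w => f (erescale (a i) (Y w)))).
Proof.
move=> cf f01.
have mf : measurable_fun [set: borel E] (f : borel E -> R) by exact: continuous_borel_realfun.
have mfc : measurable_fun [set: T] (fun w => f (erescale (a i) (Y w))).
  apply: (measurableT_comp mf).
  exact: (measurableT_comp (continuous_borel (@erescale_continuous (a i))) mY).
apply: (@integrable_test _ _ _ _ _ _ _ [set: T]) => //.
exact: le_lt_trans (probability_le1 P measurableT) (ltry _).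
Qed.

(** The test function vanishes near the complement of G, so it bounds the
  indicator of G from below even after the change of scale. *)
Lemma liminf_open_scaled (G : set E) (e : R) : 0 < e -> open G -> bounded_away G ->
  \forall i \near F, fine (mu G) - e <=
    (n i)%:R * fine (P [set w | G (erescale (s i) (Y w))]).
Proof.
move=> e0 oG aw.
have mG : measurable (G : set (borel E)) by exact: borel_open.
(* G is bounded away from the origin, which is thus a point of C. *)
pose C := ~` G; have cC : closed C by exact: open_closedC.
have C0 : C !=set0 by exists (const_mx 0%E) => G0; apply: aw; exact: subset_closure.
pose del (j : nat) : R := j.+1%:R^-1.
have del0 j : 0 < del j by rewrite invr_gt0.
have GP x : 0 < cdist_set C x -> G x.
  move=> x0; apply: contrapT => nGx; move: x0; apply/negP; rewrite -leNgt.
  by apply: le_trans (cdist_set_le x (nGx : C x)) _; rewrite cdist_refl.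
pose nb (j : nat) : set (borel E) := [set x | 2 * del j <= cdist_set C x].
have nbG j : nb j `<=` G.
  by move=> x h; apply: GP; apply: lt_le_trans h; rewrite mulr_gt0.
have mnb j : measurable (nb j).
  apply: borel_closed.
  apply: (@closed_comp _ _ (cdist_set C) [set y | 2 * del j <= y]); last exact: closed_ge.
  move=> x _; apply: (@cdist_continuous _ _ _ _ 1) => {}x y.
  by have := @dist_quot C 1 x y C0 ltr01; rewrite !divr1 invr1.
have muGoo : (mu G < +oo)%E by exact: mu_radon.
have nboo j : (mu (nb j) < +oo)%E.
  by apply: le_lt_trans muGoo; apply: le_measure; rewrite ?inE//; exact: nbG.
have nb_cvg : mu (nb j) @[j --> \oo] --> mu G.
  have <- : \bigcup_j nb j = G.
    apply/seteqP; split => x; first by move=> [j _ /nbG].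
    move=> Gx; have x0 : 0 < cdist_set C x.
      by rewrite ltNge; apply/negP => /(cdist_set_eq0 C0 cC); apply.
    have [j je] : exists j, 2 * del j <= cdist_set C x.
      apply: (@filter_ex _ \oo); near=> j.
      rewrite /del ler_pdivrMr// -ler_pdivrMl//.
      apply: (@le_trans _ _ j%:R); last by rewrite ler_nat.
      near: j; exact: nbhs_infty_ger.
    by exists j.
  apply: nondecreasing_cvg_mu => //; first exact: bigcup_measurable.
  move=> i j ij; apply/subsetPset => x; rewrite /nb/= => h; apply: le_trans h.
  rewrite ler_pM2l// /del lef_pV2 ?posrE//.
  by rewrite ler_nat.
have e2 : 0 < e / 2 by rewrite divr_gt0.
have [j Hj] : exists j, fine (mu G) - e / 2 <= fine (mu (nb j)).
  have : fine (mu (nb j)) @[j --> \oo] --> fine (mu G).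
    by apply: fine_cvg; rewrite fineK// ge0_fin_numE.
  move=> /cvgrPdist_le/(_ _ e2)[j _ H]; exists j.
  by have := H j (leqnn j); rewrite /= ler_norml => /andP[]; lra.
pose f := inner_test C (del j).
have f01 : forall x, (0 <= f x) && (f x <= 1) := inner_test_itv C (del j).
have cf : continuous f by exact: inner_test_continuous.
have fG x : f x != 0 -> G x.
  by move=> /(inner_test_neq0 (del0 j)) h; apply: GP; apply: lt_trans h.
have vf : vague_test f.
  split=> [//|x|clo]; first by have /andP[] := f01 x.
  by apply: aw; apply: closure_subset clo.
have lim_f := vague_real vf f01 mG aw fG.
have mf : measurable_fun [set: borel E] (f : borel E -> R).
  exact: continuous_borel_realfun.
have imu : mu.-integrable [set: borel E] (EFin \o f).
  exact (@integrable_test _ _ (borel E) mu f f01 mf G mG muGoo fG).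
have intf : fine (mu (nb j)) <= \int[mu]_x f x.
  apply: (@measure_le_Rintegral _ _ (borel E) mu (nb j) f (mnb j) (nboo j) f01 imu).
  by move=> x h; exact: inner_test1.
move/cvgrPdist_le/(_ _ e2) : lim_f => lim_f.
have near1 := n_cvg lim_f.
move/cvgrPdist_le/(_ _ (del0 j)) : ratio_cvg => near2.
near=> i.
have h1 : `|\int[mu]_x f x - (n i)%:R * \int[P]_w f (erescale (a (n i)) (Y w))| <= e / 2.
  by near: i.
have si : 0 < s i by near: i.
have ai : 0 < a (n i) by near: i.
have h2 : `|1 - a (n i) / s i| <= del j by near: i.
have mGs := measurable_erescale (s i) mG.
have h3 : \int[P]_w f (erescale (a (n i)) (Y w)) <=
    fine (P [set w | G (erescale (s i) (Y w))]).
  have mfc : measurable_fun [set: T] (fun w => f (erescale (a (n i)) (Y w))).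
    by have /measurable_int/measurable_EFinP := integrable_pullback (n i) cf f01.
  apply: Rintegral_le_measure => //.
    exact: le_lt_trans (probability_le1 P mGs) (ltry _).
  move=> w /(inner_test_neq0 (del0 j)) h; apply: GP.
  have := cdist_set_lipschitz (erescale (a (n i)) (Y w)) (erescale (s i) (Y w)) C0.
  have := cdist_erescale (Y w) ai si; rewrite cdist_sym.
  by rewrite distrC in h2; lra.
apply: (@le_trans _ _ ((n i)%:R * \int[P]_w f (erescale (a (n i)) (Y w)))); last first.
  by rewrite ler_wpM2l.
by move: h1; rewrite ler_norml => /andP[]; lra.
Unshelve. all: by end_near. Qed.

(** The portmanteau theorem for thresholds s that are only equivalent to the
  normalizing sequence: the closure and the interior of B have the same mass. *)
Theorem vague_cvg_scaled (B : set (borel E)) : measurable B -> bounded_away B ->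
  continuity_set mu B ->
  (n i)%:R * fine (P [set w | B (erescale (s i) (Y w))]) @[i --> F] --> fine (mu B).
Proof.
move=> mB aw cB.
have awc : bounded_away (closure B) by rewrite /bounded_away -(closure_id _).1//; exact: closed_closure.
have awi : bounded_away (interior B).
  by move=> clo; apply: aw; apply: closure_subset clo; exact: interior_subset.
have mc : measurable (closure B : set (borel E)).
  by apply: borel_closed; exact: closed_closure.
have mi : measurable (interior B : set (borel E)).
  by apply: borel_open; exact: open_interior.
have ci : mu (closure B) = mu (interior B).
  have -> : closure B = interior B `|` (closure B `\` interior B).
    apply/seteqP; split => x.
      by case: (pselect (interior B x)); [left|right].
    by case=> [/interior_subset/subset_closure//|[]].
  rewrite measureU//; last 2 first.
  - exact: measurableD.
  - by rewrite setDIK.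
  by transitivity (mu (interior B) + 0)%E; [congr (_ + _)%E; exact: cB|rewrite adde0].
have le1 : (mu B <= mu (closure B))%E.
  by apply: le_measure; rewrite ?inE//; exact: subset_closure.
have le2 : (mu (interior B) <= mu B)%E.
  by apply: le_measure; rewrite ?inE//; exact: interior_subset.
have Bi : mu B = mu (interior B) by apply/eqP; rewrite eq_le le2 -ci le1.
have Bc : mu B = mu (closure B) by rewrite ci.
apply/cvgrPdist_le => e e0.
have up := limsup_closed_scaled e0 (@closed_closure _ B) awc.
have lo := liminf_open_scaled e0 (@open_interior _ B) awi.
near=> i.
have hu : (n i)%:R * fine (P [set w | closure B (erescale (s i) (Y w))]) <=
    fine (mu (closure B)) + e by near: i.
have hl : fine (mu (interior B)) - e <=
    (n i)%:R * fine (P [set w | interior B (erescale (s i) (Y w))]) by near: i.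
rewrite -Bc in hu; rewrite -Bi in hl.
have Pfin (D : set T) : measurable D -> P D \is a fin_num by move=> mD; exact: fin_num_measure.
have mono (D1 D2 : set (borel E)) : measurable D1 -> measurable D2 -> D1 `<=` D2 ->
    (n i)%:R * fine (P [set w | D1 (erescale (s i) (Y w))]) <=
    (n i)%:R * fine (P [set w | D2 (erescale (s i) (Y w))]).
  move=> m1 m2 D12; rewrite ler_wpM2l// fine_le//; try by apply: Pfin; exact: measurable_erescale.
  apply: le_measure; rewrite ?inE; try exact: measurable_erescale.
  by move=> w; exact: D12.
have := mono _ _ mB mc (@subset_closure _ B).
have := mono _ _ mi mB (@interior_subset _ B).
move: hu hl; rewrite ler_norml => *; apply/andP; split; lra.
Unshelve. all: by end_near. Qed.

End portmanteau.

(** * Norms and large vectors *)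

Section norms.
Context {R : realType} {d : nat} (N : 'rV[R]_d -> R).
Hypothesis norm_N : is_norm N.

Lemma norm_zero : N 0 = 0.
Proof. by have [_ NZ _] := norm_N; rewrite -(scale0r 0) NZ normr0 mul0r. Qed.

Lemma norm_opp x : N (- x) = N x.
Proof. by have [_ NZ _] := norm_N; rewrite -scaleN1r NZ normrN1 mul1r. Qed.

Lemma norm_ge0 x : 0 <= N x.
Proof.
have [ND _ _] := norm_N; have := ND x (- x); rewrite subrr norm_zero norm_opp; lra.
Qed.

Lemma norm_le_sup : exists2 C : R, 0 < C & forall x, N x <= C * `|x|.
Proof.
have [ND NZ _] := norm_N.
exists (1 + \sum_(i < d) N (delta_mx 0 i)) => [|x].
  by rewrite ltr_pwDl// sumr_ge0// => i _; exact: norm_ge0.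
have NS (I : Type) (s : seq I) (f : I -> 'rV[R]_d) : N (\sum_(i <- s) f i) <= \sum_(i <- s) N (f i).
  elim/big_ind2 : _ => [|u v x1 x2 h1 h2|//]; first by rewrite norm_zero.
  by apply: le_trans (ND _ _) _; exact: lerD.
rewrite {1}[x]row_sum_delta; apply: le_trans (NS _ _ _) _.
rewrite mulrDl mul1r mulr_suml -[leLHS]add0r lerD//.
apply: ler_sum => i _; rewrite NZ mulrC ler_wpM2l//; first exact: norm_ge0.
exact: mx_norm_ge.
Qed.

Lemma is_norm_continuous : continuous N.
Proof.
have [ND NZ _] := norm_N; have [C C0 NC] := norm_le_sup.
move=> x; apply/(@cvgrPdist_lt _ _ _ (nbhs x) (nbhs_filter x)) => e e0.
apply/nbhs_ballP; exists (e / C); first by rewrite /= divr_gt0.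
move=> y; rewrite -ball_normE/= ltr_pdivlMr// mulrC => xy.
apply: le_lt_trans xy; apply: le_trans (NC (x - y)); rewrite ler_norml.
have := ND (x - y) y; have := ND (y - x) x; rewrite !subrK -(norm_opp (x - y)) opprB.
by move=> *; apply/andP; split; lra.
Qed.

(** The minimum of the norm on the compact unit sphere of the sup norm is
  positive. *)
Lemma norm_ge_sup : exists2 c : R, 0 < c & forall x, c * `|x| <= N x.
Proof.
have [ND NZ N0] := norm_N.
pose S : set 'rV[R]_d := [set x | `|x| = 1].
have cS : compact S.
  apply: bounded_closed_compact.
    by exists 1; split => // t t1 x /= ->; exact: ltW.
  apply: (@closed_comp _ _ (fun x : 'rV[R]_d => `|x|) [set 1]); last exact: closed_eq.
  by move=> x _; exact: norm_continuous.
have [S0|/set0P S0] := eqVneq S set0.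
  exists 1 => // x; rewrite mul1r.
  have [->|x0] := eqVneq x 0; first by rewrite normr0 norm_ge0.
  exfalso; suff : S (`|x|^-1 *: x) by rewrite S0.
  by rewrite /S/= normrZ normfV normr_id mulVf// normr_eq0.
have [c] := @EVT_min_rV R d N S S0 cS (continuous_subspaceT is_norm_continuous).
rewrite inE => cSc cmin.
have c0 : c != 0.
  by apply: contra_eq_neq cSc => ->; rewrite normr0 eq_sym oner_eq0.
exists (N c) => [|x].
  by rewrite lt_neqAle norm_ge0 andbT eq_sym; apply: contra_neq c0 => /N0.
have [->|x0] := eqVneq x 0; first by rewrite normr0 mulr0 norm_ge0.
have nx : 0 < `|x| by rewrite normr_gt0.
have := cmin (`|x|^-1 *: x); rewrite inE NZ normfV normr_id => H.
rewrite mulrC -ler_pdivlMl// H// /S/= normrZ normfV normr_id mulVf// gt_eqF//.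
Qed.

End norms.

Section large_vectors.
Context {R : realType} {d : nat} (N : 'rV[R]_d -> R).
Hypothesis norm_N : is_norm N.
Local Notation E := 'M[\bar R]_(1, d).

(** Points with some infinite coordinate count as large; as the complement of a
  compact set, [beyond t] is open. *)
Definition beyond (t : R) : set E := ~` [set map_mx EFin v | v in [set v | N v <= t]].

Lemma map_EFin_inj : injective (map_mx EFin : 'rV[R]_d -> E).
Proof. by move=> u v /matrixP uv; apply/matrixP => i j; have := uv i j; rewrite !mxE => -[]. Qed.

Lemma beyond_EFin t v : beyond t (map_mx EFin v) <-> t < N v.
Proof.
rewrite ltNge; split => [H|/negP H [u /= ut /map_EFin_inj uv]]; last by rewrite -uv in H.
by apply/negP => vt; apply: H; exists v.
Qed.

Lemma beyond_erescale t s v : 0 < s -> beyond t (erescale s v) <-> t * s < N v.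
Proof.
have [_ NZ _] := norm_N.
by move=> s0; rewrite beyond_EFin NZ normfV (gtr0_norm s0) ltr_pdivlMl// mulrC.
Qed.

Let matrix_hausdorff : hausdorff_space E.
Proof.
move=> p q pq; suff : cdist p q <= 0.
  rewrite /cdist normr_le0 subr_eq0 => /eqP/matrixP h.
  apply/matrixP => i j; have := h i j; rewrite !mxE.
  exact: contract_inj.
apply/ler_addgt0Pr => e e0; rewrite add0r.
have e2 : 0 < e / 2 by rewrite divr_gt0.
have [z [/cdist_ltP]] := pq _ _ (nbhsx_ballx p _ e2) (nbhsx_ballx q _ e2).
move=> /(_ e2) h1 /cdist_ltP => /(_ e2) h2.
have := cdist_triangle p z q; rewrite (cdist_sym z q); lra.
Qed.

Lemma open_beyond t : open (beyond t).
Proof.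
apply: closed_openC; apply: compact_closed; first exact: matrix_hausdorff.
have -> : [set map_mx EFin v | v in [set v | N v <= t]] =
    @erescale R 1 d 1 @` [set v | N v <= t].
  by apply/seteqP; split => _ [v vt <-]; exists v => //; rewrite /erescale invr1 scale1r.
apply: continuous_compact; first by apply: continuous_subspaceT; exact: erescale_continuous.
apply: bounded_closed_compact.
  have [c c0 Nc] := norm_ge_sup norm_N.
  exists (t / c); split => [|u uc v]; first exact: num_real.
  move=> /= vt; apply: le_trans (ltW uc).
  by rewrite ler_pdivlMr// mulrC (le_trans (Nc v)).
apply: (@closed_comp _ _ N [set x | x <= t]); last exact: closed_le.
by move=> x _; exact: is_norm_continuous.
Qed.

(** The finite points with N < t form an open set, because the real line is open
  in its compactification. *)
Lemma closure_beyond t' t : t' < t -> closure (beyond t) `<=` beyond t'.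
Proof.
move=> t't x clx [v /= vt' vx]; move: clx; rewrite -{}vx => clx.
have : nbhs v [set u | N u < t].
  apply: open_nbhs_nbhs; split; last exact: le_lt_trans t't.
  apply: (@open_comp _ _ N [set x | x < t]); last exact: open_lt.
  by move=> y _; exact: is_norm_continuous.
move=> [D nD sD].
pose V : set E := [set y | forall i j, (EFin @` D i j) (y i j)].
have [|y []] := clx V.
  exists (fun i j => EFin @` D i j) => // i j.
  by rewrite mxE; exact: nbhs_image_EFin (nD i j).
move=> Hy yD; apply: Hy; exists (map_mx fine y) => /=.
  apply/ltW; apply: sD => i j; rewrite mxE.
  by have [r Dr <-] := yD i j.
by apply/matrixP => i j; rewrite !mxE; have [r Dr <-] := yD i j.
Qed.

Lemma bounded_away_beyond t : 0 < t -> bounded_away (beyond t).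
Proof.
move=> t0 /(closure_beyond t0); rewrite (_ : const_mx 0%E = map_mx EFin 0); last first.
  by apply/matrixP => i j; rewrite !mxE.
by move/beyond_EFin; rewrite norm_zero// ltxx.
Qed.

Lemma edilate_beyond u t : 0 < u -> [set edilate u x | x in beyond t] = beyond (u * t).
Proof.
have [_ NZ _] := norm_N.
have dE s v : edilate s (map_mx EFin v) = map_mx EFin (s *: v) :> E.
  by apply/matrixP => i j; rewrite !mxE.
have dK (s : R) : s != 0 -> cancel (edilate s) (edilate s^-1 : E -> E).
  move=> s0 x; apply/matrixP => i j; rewrite !mxE muleA -EFinM mulVf//.
  by rewrite mul1e.
move=> u0; apply/seteqP; split => [_ [x xt <-]|x xut].
  move=> [v /= vut vx]; apply: xt; exists (u^-1 *: v) => /=.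
    by rewrite NZ normfV (gtr0_norm u0) ler_pdivrMl.
  by rewrite -dE vx dK// gt_eqF.
exists (edilate u^-1 x); last by rewrite -{1}(invrK u) dK// invr_eq0 gt_eqF.
move=> [v /= vt vx]; apply: xut; exists (u *: v) => /=.
  by rewrite NZ (gtr0_norm u0) ler_pM2l.
by rewrite -dE vx -{1}(invrK u) dK// invr_eq0 gt_eqF.
Qed.

(** The contracted distance to the origin is at most the sup norm, which is at
  most a multiple of N. *)
Lemma bounded_away_sub_beyond (A : set E) : bounded_away A -> exists2 e : R, 0 < e & A `<=` beyond e.
Proof.
have [c c0 Nc] := norm_ge_sup norm_N.
move=> /dist_of_bounded_away[r r0 Ar]; exists (c * (r / 2)).
  by rewrite mulr_gt0// divr_gt0.
move=> x Ax [v /= vr vx]; have := Ar x Ax; apply/negP; rewrite -ltNge.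
have : `|v| <= r / 2 by rewrite -(ler_pM2l c0) (le_trans (Nc v)).
move=> vr2; apply: (@le_lt_trans _ _ (r / 2)); last lra.
rewrite /cdist -vx; apply: mx_norm_le => [|i j]; first lra.
apply: le_trans vr2; apply: le_trans (mx_norm_ge v i j).
rewrite !mxE /= normr0 addr0 mul0r sub0r normrN normrM normfV.
have h := normr_ge0 (v i j); have h1 : 0 < 1 + `|v i j| by rewrite ltr_pwDl.
by rewrite (gtr0_norm h1) ler_pdivrMr// ler_peMr// lerDl.
Qed.

End large_vectors.

(** * Regular variation along real thresholds *)

Lemma vec_mx_continuous {R : realType} (n d : nat) :
  continuous (vec_mx : 'rV[R]_(n * d) -> 'M[R]_(n, d)).
Proof.
move=> v B /nbhs_ballP[e /= e0 eB]; apply/nbhs_ballP; exists e => // u [_ vu].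
by apply: eB; split => // i j; rewrite !mxE; exact: vu.
Qed.

Section regular_variation.
Context {R : realType} {dsp : measure_display} {T : measurableType dsp}.
Variables (P : probability T R) (d : nat) (X : int -> T -> 'rV[R]_d).
Hypothesis X_meas : random_vectors X.

Lemma measurable_block n (t : 'I_n -> int) :
  measurable_fun [set: T] (block X t : T -> borel 'M[R]_(n, d)).
Proof.
have -> : block X t = vec_mx \o (fun w => mxvec (block X t w)).
  by apply/funext => w /=; rewrite mxvecK.
apply: (measurableT_comp (continuous_borel (@vec_mx_continuous R n d))).
apply: measurable_fun_rV => k; case/mxvec_indexP: k => i j.
under eq_fun do rewrite mxvecE mxE.
exact: (measurableT_comp (@measurable_coord R d j) (X_meas (t i))).
Qed.

Lemma block1E (w : T) : block X (fun i : 'I_1 => i%:Z) w = X 0 w.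
Proof. by apply/matrixP => i j; rewrite mxE !ord1. Qed.

Variable N : 'rV[R]_d -> R.
Hypothesis norm_N : is_norm N.

Definition tail (x : R) : R := fine (P [set w | x < N (X 0 w)]).

Lemma measurable_tail x : measurable [set w | x < N (X 0 w)].
Proof.
have mN : measurable_fun [set: borel 'rV[R]_d] (N : borel 'rV[R]_d -> R).
  by apply: continuous_borel_realfun; exact: is_norm_continuous.
have := measurableT_comp mN (X_meas 0).
move=> /(_ measurableT `]x, +oo[%classic (measurable_itv _)); rewrite setTI.
by congr measurable; apply/seteqP; split => w /=; rewrite in_itv/= andbT.
Qed.

Lemma tail_ge0 x : 0 <= tail x.
Proof. exact: fine_ge0. Qed.

Lemma tail_le x y : x <= y -> tail y <= tail x.
Proof.
move=> xy; rewrite fine_le//; try by apply: fin_num_measure; exact: measurable_tail.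
apply: le_measure; rewrite ?inE; try exact: measurable_tail.
by move=> w /=; exact: le_lt_trans.
Qed.

Lemma tail_beyond t s : 0 < s ->
  fine (P [set w | beyond N t (erescale s (block X (fun i : 'I_1 => i%:Z) w))]) = tail (t * s).
Proof.
move=> s0; congr (fine (P _)); apply/seteqP; split => w /=; rewrite block1E.
  by move/(beyond_erescale norm_N _ _ s0).
by move=> h; apply/(beyond_erescale norm_N _ _ s0).
Qed.

Variables (alpha : R) (a : nat -> R).
Variable mu : forall h : nat, {measure set (borel 'M[\bar R]_(h.+1, d)) -> \bar R}.
Hypothesis alpha_gt0 : 0 < alpha.
Hypothesis X_rv : regularly_varying P X N alpha a mu.

Let a_gt0 : \forall n \near \oo, 0 < a n.
Proof. by have [/cvgryPgt/(_ 0)] := X_rv. Qed.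

Let radon h : forall B : set (borel 'M[\bar R]_(h.+1, d)),
  measurable B -> bounded_away B -> (mu h B < +oo)%E.
Proof. by have [_ _ /(_ h)[[_ ?] _ _ _]] := X_rv. Qed.

Let vague h : forall f, vague_test f ->
  (n%:R%:E * \int[P]_w (f (erescale (a n) (block X (fun i : 'I_h.+1 => i%:Z) w)))%:E)%E
  @[n --> \oo] --> (\int[mu h]_x (f x)%:E)%E.
Proof. by have [_ _ /(_ h)[_ _ ? _]] := X_rv. Qed.

Let M : R := fine (mu 0%N (beyond N 1)).

Let mbeyond t : measurable (beyond N t : set (borel 'M[\bar R]_(1, d))).
Proof. by apply: borel_open; exact: open_beyond. Qed.

Let mu_beyond t : 0 < t -> fine (mu 0%N (beyond N t)) = t `^ (- alpha) * M.
Proof.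
move=> t0; have [_ _ /(_ 0%N)[_ _ _ /(_ t _ t0 (mbeyond 1))]] := X_rv.
rewrite edilate_beyond// mulr1 => ->; rewrite fineM//.
by rewrite ge0_fin_numE//; apply: radon => //; exact: bounded_away_beyond.
Qed.

Let ratio1 : a n / a n @[n --> \oo] --> (1 : R).
Proof.
apply: cvg_near_cst; near=> n; rewrite divff//.
by rewrite gt_eqF//; near: n; exact: a_gt0.
Unshelve. all: by end_near. Qed.

Let tail_le_near t' t e : 0 < t' -> t' < t -> 0 < e ->
  \forall n \near \oo, n%:R * tail (t * a n) <= t' `^ (- alpha) * M + e.
Proof.
move=> t'0 t't e0.
have aw : bounded_away (closure (beyond N t)).
  rewrite /bounded_away -(closure_id _).1; last exact: closed_closure.
  by apply: bounded_away_beyond => //; exact: lt_trans t't.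
have := limsup_closed_scaled (FF := eventually_filter) (@radon 0) (measurable_block _) (@vague 0) (@cvg_id _ _)
  a_gt0 a_gt0 ratio1 e0 (@closed_closure _ _) aw.
apply: filterS2 a_gt0 => n an0 H.
rewrite -mu_beyond// -(tail_beyond t an0).
have mc : measurable (closure (beyond N t) : set (borel 'M[\bar R]_(1, d))).
  by apply: borel_closed; exact: closed_closure.
apply: (le_trans _ (le_trans H _)).
  rewrite ler_wpM2l// fine_le//; try by apply: fin_num_measure; apply: measurable_erescale => //; exact: measurable_block.
  apply: le_measure; rewrite ?inE; try by apply: measurable_erescale => //; exact: measurable_block.
  by move=> w; exact: subset_closure.
rewrite lerD2r fine_le//.
- by rewrite ge0_fin_numE//; exact: radon.
- by rewrite ge0_fin_numE//; apply: radon => //; exact: bounded_away_beyond.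
by apply: le_measure; rewrite ?inE//; exact: closure_beyond.
Qed.

Let tail_ge_near t e : 0 < t -> 0 < e ->
  \forall n \near \oo, t `^ (- alpha) * M - e <= n%:R * tail (t * a n).
Proof.
move=> t0 e0.
have := liminf_open_scaled (FF := eventually_filter) (@radon 0) (measurable_block _) (@vague 0) (@cvg_id _ _)
  a_gt0 a_gt0 ratio1 e0 (open_beyond norm_N (t:=t)) (bounded_away_beyond norm_N t0).
apply: filterS2 a_gt0 => n an0.
by rewrite mu_beyond// tail_beyond.
Qed.

Let n_tail_cvg : n%:R * tail (a n) @[n --> \oo] --> (1 : R).
Proof.
have [_ + _] := X_rv; move=> /fine_cvg; apply: cvg_trans; apply: near_eq_cvg.
apply: nearW => n /=; rewrite fineM//.
by apply: fin_num_measure; exact: measurable_tail.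
Qed.

Let M_le1 : M <= 1.
Proof.
apply/ler_addgt0Pr => e e0; have e2 : 0 < e / 2 by rewrite divr_gt0.
move/cvgrPdist_le/(_ _ e2) : n_tail_cvg => h.
have [n [+]] := @filter_ex _ \oo _ _ (filterI (tail_ge_near ltr01 e2) h).
by rewrite powR1 !mul1r ler_norml => ? /andP[]; lra.
Qed.

Let M_ge t : 0 < t -> t < 1 -> 1 <= t `^ (- alpha) * M.
Proof.
move=> t0 t1.
apply/ler_addgt0Pr => e e0; have e2 : 0 < e / 2 by rewrite divr_gt0.
move/cvgrPdist_le/(_ _ e2) : n_tail_cvg => h.
have [n [+]] := @filter_ex _ \oo _ _ (filterI (tail_le_near t0 t1 e2) h).
by rewrite mul1r ler_norml => ? /andP[]; lra.
Qed.

(** With its counterpart below 1, this shows that n * tail x can only be close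
  to 1 if x is close to a n: homogeneity makes the limits at t * a n fall
  strictly on either side of 1. *)
Let tail_gt1 t : 1 < t -> exists2 q, q < 1 & \forall n \near \oo, n%:R * tail (t * a n) <= q.
Proof.
move=> t1; pose t' := (1 + t) / 2.
have t'1 : 1 < t' by rewrite /t'; lra.
have t't : t' < t by rewrite /t'; lra.
have t'0 : 0 < t' by apply: lt_trans t'1.
have p1 : t' `^ (- alpha) < 1.
  rewrite powRN invf_lt1 ?powR_gt0//.
  have -> : 1 = 1 `^ alpha :> R by rewrite powR1.
  by apply: gt0_ltr_powR => //; rewrite ?nnegrE ltW.
have pM : t' `^ (- alpha) * M < 1.
  by apply: le_lt_trans p1; rewrite ler_piMr// powR_ge0.
pose e := (1 - t' `^ (- alpha) * M) / 2.
have e0 : 0 < e by rewrite /e divr_gt0// subr_gt0.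
by exists (t' `^ (- alpha) * M + e); [rewrite /e; lra|exact: tail_le_near].
Qed.

Let tail_lt1 t : 0 < t -> t < 1 ->
  exists2 q, 1 < q & \forall n \near \oo, q <= n%:R * tail (t * a n).
Proof.
move=> t0 t1; pose t' := (1 + t) / 2.
have t'1 : t' < 1 by rewrite /t'; lra.
have t't : t < t' by rewrite /t'; lra.
have t'0 : 0 < t' by apply: lt_trans t't.
have pM : 1 < t `^ (- alpha) * M.
  apply: le_lt_trans (M_ge t'0 t'1) _; rewrite ltr_pM2r; last first.
    have := M_ge t'0 t'1; have := powR_ge0 t' (- alpha); nra.
  rewrite !powRN ltf_pV2 ?posrE ?powR_gt0//.
  by apply: gt0_ltr_powR => //; rewrite ?nnegrE ltW.
pose e := (t `^ (- alpha) * M - 1) / 2.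
have e0 : 0 < e by rewrite /e divr_gt0// subr_gt0.
by exists (t `^ (- alpha) * M - e); [rewrite /e; lra|exact: tail_ge_near].
Qed.

Lemma tail_gt0 x : 0 < tail x.
Proof.
have [/cvgryPge/(_ x) ax _ _] := X_rv.
have h0 : (0 : R) < 2^-1 by rewrite invr_gt0.
move/cvgrPdist_le/(_ _ h0) : n_tail_cvg => h.
have [n [xa]] := @filter_ex _ \oo _ _ (filterI ax h).
rewrite ler_norml => /andP[_ H].
apply: lt_le_trans (tail_le xa).
have p : 0 < n%:R * tail (a n) by lra.
rewrite lt_neqAle tail_ge0 andbT; apply/eqP => t0.
by rewrite -t0 mulr0 ltxx in p.
Qed.

Lemma tail_cvg0 : tail x @[x --> +oo] --> (0 : R).
Proof.
apply/cvgrPdist_le => e e0.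
have h1 : (0 : R) < 1 by [].
move/cvgrPdist_le/(_ _ h1) : n_tail_cvg => h.
have [n [ne]] := @filter_ex _ \oo _ _ (filterI (nbhs_infty_gtr (2 / e)) h).
rewrite ler_norml => /andP[H _].
near=> x; rewrite sub0r normrN ger0_norm ?tail_ge0//.
apply: (@le_trans _ _ (tail (a n))).
  by apply: tail_le; near: x; exact: (nbhs_pinfty_ge (num_real _)).
have n0 : 0 < n%:R :> R by apply: le_lt_trans ne; rewrite divr_ge0// ltW.
rewrite -(ler_pM2l n0); move: ne; rewrite ltr_pdivrMr// => ne; lra.
Unshelve. all: by end_near. Qed.

(** The sample size to which [x] is the natural threshold. *)
Let size_at (x : R) : nat := Num.truncn (tail x)^-1.

Let size_at_tail : (size_at x)%:R * tail x @[x --> +oo] --> (1 : R).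
Proof.
apply/cvgrPdist_le => e e0; move/cvgrPdist_le/(_ _ e0) : tail_cvg0.
apply: filterS => x; rewrite sub0r normrN ger0_norm ?tail_ge0// => te.
have t0 := tail_gt0 x; have ti : 0 <= (tail x)^-1 by rewrite invr_ge0 ltW.
have /andP[] := truncn_itv ti; rewrite -/(size_at x) -(ler_pM2r t0) mulVf ?gt_eqF// => h1.
rewrite -(ltr_pM2r t0) mulVf ?gt_eqF// -natr1 mulrDl mul1r => h2.
by rewrite ler_norml; apply/andP; split; lra.
Qed.

Let size_at_cvg : size_at x @[x --> +oo] --> \oo.
Proof.
apply/(@cvgrnyP R); apply/cvgryPge => A.
have A1 : 0 < (`|A| + 1)^-1 by rewrite invr_gt0 ltr_wpDl.
move/cvgrPdist_le/(_ _ A1) : tail_cvg0.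
apply: filterS => x; rewrite sub0r normrN ger0_norm ?tail_ge0// => te.
have t0 := tail_gt0 x; have ti : 0 <= (tail x)^-1 by rewrite invr_ge0 ltW.
have /andP[_] := truncn_itv ti; rewrite -/(size_at x) -natr1 => h.
have : `|A| + 1 <= (tail x)^-1 by rewrite -[leLHS]invrK lef_pV2 ?posrE// invr_gt0 ltr_wpDl.
have := ler_norm A; lra.
Qed.

Let size_at_ratio : a (size_at x) / x @[x --> +oo] --> (1 : R).
Proof.
apply/cvgrPdist_le => e e0; pose del := e / (1 + e).
have e1 : 0 < 1 + e by lra.
have del0 : 0 < del by rewrite divr_gt0.
have del1 : del < 1 by rewrite ltr_pdivrMr// mul1r; lra.
have dele : del <= e by rewrite ler_pdivrMr//; nra.
have [|q1 q11 H1] := @tail_gt1 (1 + del); first by lra.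
have [| |q2 q21 H2] := @tail_lt1 (1 - del); [by lra|by lra|].
have near1 := size_at_cvg H1; have near2 := size_at_cvg H2; have near3 := size_at_cvg a_gt0.
have s1 : \forall x \near +oo, q1 < (size_at x)%:R * tail x.
  have e'0 : 0 < (1 - q1) / 2 by lra.
  move/cvgrPdist_le/(_ _ e'0) : size_at_tail; apply: filterS => x.
  by rewrite ler_norml => /andP[]; lra.
have s2 : \forall x \near +oo, (size_at x)%:R * tail x < q2.
  have e'0 : 0 < (q2 - 1) / 2 by lra.
  move/cvgrPdist_le/(_ _ e'0) : size_at_tail; apply: filterS => x.
  by rewrite ler_norml => /andP[]; lra.
near=> x.
have x0 : 0 < x by near: x; exact: (nbhs_pinfty_gt (num_real _)).
have b1 : (size_at x)%:R * tail ((1 + del) * a (size_at x)) <= q1 by near: x.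
have b2 : q2 <= (size_at x)%:R * tail ((1 - del) * a (size_at x)) by near: x.
have b3 : 0 < a (size_at x) by near: x.
have b4 : q1 < (size_at x)%:R * tail x by near: x.
have b5 : (size_at x)%:R * tail x < q2 by near: x.
have up : x < (1 + del) * a (size_at x).
  rewrite ltNge; apply/negP => h; have := ler_wpM2l (ler0n R (size_at x)) (tail_le h); lra.
have lo : (1 - del) * a (size_at x) < x.
  rewrite ltNge; apply/negP => h; have := ler_wpM2l (ler0n R (size_at x)) (tail_le h); lra.
have Hlo : a (size_at x) / x <= 1 + e.
  rewrite ler_pdivrMr//; have : (1 + e) * (1 - del) = 1 by rewrite /del; field; rewrite gt_eqF.
  nra.
have Hup : 1 - e <= a (size_at x) / x.
  rewrite ler_pdivlMr//; have : (1 - del) * (1 + del) <= 1 by nra.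
  nra.
by rewrite ler_norml; apply/andP; split; lra.
Unshelve. all: by end_near. Qed.

(** The sample size is matched to the real threshold [x] so that the threshold
  [a n] of that size is equivalent to [x]. *)
Lemma rv_cvg_real h (B : set (borel 'M[\bar R]_(h.+1, d))) :
  measurable B -> bounded_away B -> continuity_set (mu h) B ->
  fine (P [set w | B (erescale x (block X (fun i : 'I_h.+1 => i%:Z) w))]) / tail x
    @[x --> +oo] --> fine (mu h B).
Proof.
move=> mB aw cB.
have x_gt0 : \forall x \near +oo, 0 < (x : R) by exact: (nbhs_pinfty_gt (num_real _)).
have /= H := vague_cvg_scaled (FF := @proper_pinfty_nbhs R) (@radon h) (measurable_block _) (@vague h) size_at_cvg
  x_gt0 (size_at_cvg a_gt0) size_at_ratio mB aw cB.
have PF : ProperFilter (+oo : set_system R) by exact: proper_pinfty_nbhs.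
have HM : (size_at x)%:R *
    fine (P [set w | B (erescale x (block X (fun i : 'I_h.+1 => i%:Z) w))]) *
    ((size_at x)%:R * tail x)^-1 @[x --> +oo] --> fine (mu h B) * 1^-1.
  by apply: cvgM => //; apply: cvgV => //; exact: oner_neq0.
rewrite -[X in _ --> X]mulr1 -[X in _ * X]invr1; apply: cvg_trans HM; apply: near_eq_cvg.
have n1 : \forall n \near \oo, (0 < n)%N by exists 1%N.
have n2 := size_at_cvg n1; near=> x; have n0 : (0 < size_at x)%N by near: x.
have n0' : (size_at x)%:R != 0 :> R by rewrite pnatr_eq0 -lt0n.
by field; rewrite n0' gt_eqF ?tail_gt0.
Unshelve. all: by end_near. Qed.

Lemma rv_cvg_seq h (m : nat -> nat) (B : set (borel 'M[\bar R]_(h.+1, d))) :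
  m n @[n --> \oo] --> \oo ->
  measurable B -> bounded_away B -> continuity_set (mu h) B ->
  (m n)%:R * fine (P [set w | B (erescale (a (m n)) (block X (fun i : 'I_h.+1 => i%:Z) w))])
    @[n --> \oo] --> fine (mu h B).
Proof.
move=> m_cvg mB aw cB.
apply: (vague_cvg_scaled (@radon h) (measurable_block _) (@vague h) m_cvg
  (m_cvg _ a_gt0) (m_cvg _ a_gt0) _ mB aw cB).
apply: cvg_near_cst; have an0 := m_cvg _ a_gt0; near=> n.
by rewrite divff// gt_eqF//; near: n.
Unshelve. all: by end_near. Qed.

End regular_variation.

(** * Exceedances of a stationary mixing sequence *)

Section finite_law.
Context {R : realType} {dsp : measure_display} {T : measurableType dsp}.
Variables (P : probability T R) (S : finType) (U : T -> S).
Hypothesis mU : forall u, measurable [set w | U w = u].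

Definition law (u : S) : R := fine (P [set w | U w = u]).

Lemma law_ge0 u : 0 <= law u. Proof. exact: fine_ge0. Qed.

Let fun_of_U (g : S -> R) w : g (U w) = \sum_u g u * \1_[set w | U w = u] w.
Proof.
rewrite (bigD1 (U w))//= big1 => [|u uU]; first by rewrite indicE mem_set// mulr1 addr0.
by rewrite indicE memNset ?mulr0// => /= Uu; rewrite Uu eqxx in uU.
Qed.

Let iterm (g : S -> R) u : P.-integrable [set: T] (fun w => (g u * \1_[set w | U w = u] w)%:E).
Proof.
rewrite (_ : (fun w => _) = (fun w => (g u)%:E * (EFin \o \1_[set w | U w = u]) w)%E); last first.
  by apply/funext => w; rewrite EFinM.
apply: integrableZl => //; apply: integrable_indicator; first exact: mU.
by apply: le_lt_trans (probability_le1 P _) (ltry _); exact: mU.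
Qed.

Lemma integral_finite (g : S -> R) : (\int[P]_w (g (U w))%:E)%E = (mean law g)%:E.
Proof.
under eq_integral => w _ do rewrite fun_of_U -sumEFin.
rewrite integral_sum// /mean -sumEFin; apply: eq_bigr => u _.
under eq_integral => w _ do rewrite EFinM.
rewrite integralZl//; last first.
  apply: integrable_indicator; first exact: mU.
  by apply: le_lt_trans (probability_le1 P _) (ltry _); exact: mU.
rewrite integral_indic// setIT mulrC EFinM; congr (_ * _)%E.
by rewrite fineK//; apply: fin_num_measure; exact: mU.
Qed.

Lemma measurable_event (Q : pred S) : measurable [set w | Q (U w)].
Proof.
rewrite (_ : mkset _ = \bigcup_(u in [set u | Q u]) [set w | U w = u]).
  by apply: fin_bigcup_measurable => // u _; exact: mU.
apply/seteqP; split => w /=; first by move=> QU; exists (U w).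
by move=> [u Qu /= ->].
Qed.

Lemma law_event (Q : pred S) : fine (P [set w | Q (U w)]) = mean law (fun u => (Q u)%:R).
Proof.
rewrite -[RHS]/(fine (mean law (fun u => (Q u)%:R))%:E) -integral_finite; congr fine.
rewrite -[in LHS](setIT [set w | Q (U w)]) -integral_indic//; last exact: measurable_event.
apply: eq_integral => w _; rewrite indicE; case: (boolP (Q (U w))) => h.
  by rewrite mem_set.
by rewrite memNset//= => h'; rewrite h' in h.
Qed.

Lemma law_sum1 : \sum_u law u = 1.
Proof.
have := law_event xpredT; rewrite /mean => H.
rewrite -[RHS](congr1 fine (probability_setT P)) (_ : setT = [set w | xpredT (U w)]); last first.
  by apply/seteqP; split.
by rewrite H; apply: eq_bigr => u _; rewrite mulr1.
Qed.

End finite_law.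

Section exceedances.
Context {R : realType} {dsp : measure_display} {T : measurableType dsp}.
Variables (P : probability T R) (d : nat) (X : int -> T -> 'rV[R]_d).
Hypothesis X_meas : random_vectors X.
Hypothesis X_stat : strictly_stationary P X.
Variable A : set 'rV[\bar R]_d.
Hypothesis A_borel : measurable (A : set (borel 'rV[\bar R]_d)).

Definition exceeds (s : R) (t : int) (w : T) : bool := `[< A (erescale s (X t w)) >].

(** The observation times start at 1; the shift [z] serves to place the origin
  of time between past and future. *)
Definition pattern (s : R) n (z : int) (w : T) : {ffun 'I_n -> bool} :=
  [ffun t : 'I_n => exceeds s (t.+1%:Z + z) w].

Lemma measurable_exceedance s (b : bool) :
  measurable ([set v | `[< A (erescale s v) >] = b] : set (borel 'rV[R]_d)).
Proof.
have m1 : measurable ([set v | A (erescale s v)] : set (borel 'rV[R]_d)).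
  have := continuous_borel (@erescale_continuous R 1 d s).
  by move=> /(_ measurableT _ A_borel); rewrite setTI.
have -> : [set v | `[< A (erescale s v) >] = b] =
    (if b then [set v | A (erescale s v)] else ~` [set v | A (erescale s v)]) :> set (borel 'rV[R]_d).
  apply/seteqP; split => v /=; case: asboolP => //; case: b => //.
by case: b => //; exact: measurableC.
Qed.

Lemma row_continuous (S : pseudoMetricType R) n k (i : 'I_n) :
  continuous (row i : 'M[S]_(n, k) -> 'rV[S]_k).
Proof.
move=> v B /nbhs_ballP[e /= e0 eB]; apply/nbhs_ballP; exists e => // u [_ vu].
by apply: eB; split => // a j; rewrite !mxE; exact: vu.
Qed.

(** A pattern is an event on a block of vectors, to which stationarity applies.
  *)
Lemma stationary_pattern s n z : law P (pattern s n z) =1 law P (pattern s n 0).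
Proof.
move=> u; pose B : set (borel 'M[R]_(n, d)) :=
  \bigcap_(t in [set: 'I_n]) [set x : 'M[R]_(n, d) | `[< A (erescale s (row t x)) >] = u t].
have mB : measurable B.
  apply: fin_bigcap_measurable => // t _.
  have := continuous_borel (@row_continuous R n d t).
  by move=> /(_ measurableT _ (measurable_exceedance s (u t))); rewrite setTI.
have E z' : [set w | pattern s n z' w = u] =
    [set w | B (block X (fun t : 'I_n => t.+1%:Z + z') w)].
  have bE (t : 'I_n) w : row t (block X (fun t : 'I_n => t.+1%:Z + z') w) = X (t.+1%:Z + z') w.
    by apply/matrixP => i j; rewrite !mxE !ord1.
  apply/seteqP; split => w /= => [H t _|H].
    by rewrite /= bE -H ffunE.
  by apply/ffunP => t; rewrite ffunE -(H t Logic.I) /= bE.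
rewrite /law !E; congr fine.
have -> : [set w | B (block X (fun t : 'I_n => t.+1%:Z + z) w)] =
    [set w | B (block X (fun t : 'I_n => (t.+1%:Z + 0) + z) w)].
  by congr mkset; apply/funext => w; congr (B (block X _ w)); apply/funext => t; rewrite addr0.
exact: X_stat.
Qed.

(** The event is a finite union of cylinders over the times in [D]. *)
Lemma sigma_of_pattern s n z (D : pred 'I_n) (Sx : set int) (Q : pred {ffun 'I_n -> bool}) :
  depends_on D Q -> (forall t : 'I_n, D t -> Sx (t.+1%:Z + z)) ->
  sigma_of X Sx [set w | Q (pattern s n z w)].
Proof.
move=> QD DS; rewrite /sigma_of.
set G := bigcup _ _.
have -> : [set w | Q (pattern s n z w)] =
   \bigcup_(u in [set u | Q u]) \bigcap_(t in [set t | D t])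
      [set w | exceeds s (t.+1%:Z + z) w = u t].
  apply/seteqP; split => w /=.
    by move=> Qw; exists (pattern s n z w) => // t Dt /=; rewrite ffunE.
  move=> [u Qu H]; rewrite (QD _ u)// => t Dt; rewrite ffunE; exact: H.
have : measurable (\bigcup_(u in [set u | Q u]) \bigcap_(t in [set t | D t])
      [set w | exceeds s (t.+1%:Z + z) w = u t] : set (g_sigma_algebraType G)).
  apply: fin_bigcup_measurable => // u _; apply: fin_bigcap_measurable => // t Dt.
  apply: sub_sigma_algebra; exists (t.+1%:Z + z); first exact: DS.
  exists [set v | `[< A (erescale s v) >] = u t]; first exact: measurable_exceedance.
  by rewrite setTI.
by [].
Qed.

Lemma measurable_pattern s n z u : measurable [set w | pattern s n z w = u].
Proof.
rewrite (_ : [set w | _] = \bigcap_(t in [set: 'I_n]) [set w | exceeds s (t.+1%:Z + z) w = u t]).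
  apply: fin_bigcap_measurable => // t _.
  by have := X_meas (t.+1%:Z + z) measurableT (measurable_exceedance s (u t)); rewrite setTI.
apply/seteqP; split => w /=; first by move=> <- t _ /=; rewrite ffunE.
by move=> H; apply/ffunP => t; rewrite ffunE; exact: H.
Qed.

Lemma mixing_rate_ge (C D : set T) (h : nat) :
  sigma_of X [set s | s <= 0] C -> sigma_of X [set s | h%:Z <= s] D ->
  `|fine (P (C `&` D)) - fine (P C) * fine (P D)| <= mixing_rate P X h.
Proof.
have mS (S : set int) : sigma_of X S `<=` measurable.
  apply: smallest_sub; first exact: sigma_algebra_measurable.
  by move=> _ [t St [B mB <-]]; exact: X_meas.
move=> sC sD; apply: ub_le_sup; last by exists C => //; exists D.
exists 2 => _ [C' /mS mC [D' /mS mD <-]].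
have p01 (S : set T) : measurable S -> 0 <= fine (P S) <= 1.
  move=> mS'; rewrite fine_ge0//= -[leRHS]/(fine (1%:E)) fine_le ?fin_num_measure//.
  exact: probability_le1.
have /andP[h1 h2] := p01 _ mC; have /andP[h3 h4] := p01 _ mD.
have /andP[h5 h6] := p01 _ (measurableI _ _ mC mD).
by rewrite ler_norml; apply/andP; split; nra.
Qed.

Definition exceed_prob (s : R) : R := fine (P [set w | A (erescale s (X 0 w))]).

Definition joint_prob (s : R) (h : nat) : R :=
  fine (P [set w | A (erescale s (X h%:Z w)) /\ A (erescale s (X 0 w))]).

Definition exceed_cov (s : R) (h : nat) : R := joint_prob s h - exceed_prob s ^+ 2.

Local Notation p s n := (law P (pattern s n 0)).

Let eq_law S (q q' : S -> R) : q =1 q' -> q = q'.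
Proof. by move=> /funext. Qed.

Lemma exceed_mean s n (t : 'I_n) : mean (p s n) (fun u => (u t)%:R) = exceed_prob s.
Proof.
rewrite -(eq_law (stationary_pattern s (- t.+1%:Z))) -(law_event P (@measurable_pattern s n _) (fun u => u t)).
congr (fine (P _)); apply/seteqP; split => w /=; rewrite ffunE addrN /exceeds.
  by move/asboolP.
by move=> h; apply/asboolP.
Qed.

Lemma exceed_mean2 s n (t t' : 'I_n) :
  mean (p s n) (fun u => (u t)%:R * (u t')%:R) = joint_prob s (dist t t').
Proof.
wlog tt : t t' / (t' <= t)%N.
  move=> H; have [tt|/ltnW tt] := leqP t' t; first exact: H.
  rewrite (_ : dist t t' = dist t' t); last by rewrite /dist addnC.
  by rewrite -H//; apply: eq_mean => u; rewrite mulrC.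
rewrite -(eq_law (stationary_pattern s (- t'.+1%:Z))).
rewrite (eq_mean _ (G := fun u : {ffun 'I_n -> bool} => (u t && u t')%:R)); last first.
  by move=> u; case: (u t); case: (u t'); rewrite ?mulr1 ?mulr0.
rewrite -(law_event P (@measurable_pattern s n _) (fun u => u t && u t')).
have -> : dist t t' = (t - t')%N by rewrite /dist; lia.
have E : t.+1%:Z - t'.+1%:Z = (t - t')%N%:Z by lia.
congr (fine (P _)); apply/seteqP; split => w /=; rewrite !ffunE addrN E /exceeds.
  by move=> /andP[/asboolP h1 /asboolP h2].
by move=> [h1 h2]; apply/andP; split; apply/asboolP.
Qed.

Lemma mean_centered s n (t : 'I_n) : mean (p s n) (centered (exceed_prob s) t) = 0.
Proof.
rewrite (meanB _ (fun u : {ffun 'I_n -> bool} => (u t)%:R) (fun=> exceed_prob s)) exceed_mean mean_cst ?subrr//.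
exact (law_sum1 P (@measurable_pattern s n 0)).
Qed.

Lemma mean_centered2 s n (t t' : 'I_n) :
  mean (p s n) (fun u => centered (exceed_prob s) t u * centered (exceed_prob s) t' u) =
  exceed_cov s (dist t t').
Proof.
set q := exceed_prob s.
rewrite (eq_mean _ (G := fun u : {ffun 'I_n -> bool} => (u t)%:R * (u t')%:R -
    (q * (u t)%:R + (q * (u t')%:R + - q ^+ 2)))); last first.
  by move=> u; rewrite /centered; ring.
rewrite meanB meanD meanZ meanD meanZ !exceed_mean mean_cst; last first.
  exact (law_sum1 P (@measurable_pattern s n 0)).
by rewrite exceed_mean2 /exceed_cov -/q; ring.
Qed.

Lemma exceed_prob_itv s : 0 <= exceed_prob s <= 1.
Proof.
have mA : measurable [set w | A (erescale s (X 0 w))].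
  have := X_meas 0 measurableT (measurable_exceedance s true); rewrite setTI.
  by congr measurable; apply/seteqP; split => w /= => [/asboolP//|h]; apply/asboolP.
rewrite fine_ge0//= -[leRHS]/(fine (1%:E)) fine_le ?fin_num_measure//.
exact: probability_le1.
Qed.

(** By stationarity the pattern may be shifted by - a; then the first event lies
  in the past of time 0 and the second one in the future of time r. *)
Lemma pattern_mixing s n (r a : nat) (Q1 Q2 : pred {ffun 'I_n -> bool}) :
  depends_on (fun t : 'I_n => (t < a)%N) Q1 ->
  depends_on (fun t : 'I_n => (a + r <= t)%N) Q2 ->
  `|cov (p s n) (fun u => (Q1 u)%:R) (fun u => (Q2 u)%:R)| <= mixing_rate P X r.
Proof.
move=> d1 d2; rewrite /cov -(eq_law (stationary_pattern s (- a%:Z))).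
have mp := @measurable_pattern s n (- a%:Z).
rewrite (eq_mean _ (G := fun u : {ffun 'I_n -> bool} => (Q1 u && Q2 u)%:R)); last first.
  by move=> u; case: (Q1 u); case: (Q2 u); rewrite ?mulr1 ?mulr0.
rewrite -(law_event P mp (fun u => Q1 u && Q2 u)) -!(law_event P mp).
rewrite (_ : [set w | Q1 _ && Q2 _] =
   [set w | Q1 (pattern s n (- a%:Z) w)] `&` [set w | Q2 (pattern s n (- a%:Z) w)]); last first.
  by apply/seteqP; split => w /= => [/andP[]|[-> ->]].
apply: mixing_rate_ge.
- by apply: (@sigma_of_pattern s n _ _ _ Q1 d1) => t /= ta; lia.
- by apply: (@sigma_of_pattern s n _ _ _ Q2 d2) => t /= ta; lia.
Qed.

(** The exceedance at time 0 belongs to the past, the one at time h to the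
  future. *)
Lemma exceed_cov_le s h : `|exceed_cov s h| <= mixing_rate P X h.
Proof.
have mA : measurable ([set v | A (erescale s v)] : set (borel 'rV[R]_d)).
  rewrite (_ : mkset _ = [set v | `[< A (erescale s v) >] = true]).
    exact: measurable_exceedance.
  by apply/seteqP; split => w /= => [h'|/asboolP//]; apply/asboolP.
have sA (S : set int) t : S t -> sigma_of X S [set w | A (erescale s (X t w))].
  move=> St; apply: sub_sigma_algebra; exists t => //.
  by exists [set v | A (erescale s v)] => //; rewrite setTI.
have E : fine (P [set w | A (erescale s (X h%:Z w))]) = exceed_prob s.
  pose t0 : 'I_h.+1 := ord_max.
  rewrite -(exceed_mean s t0) -(eq_law (stationary_pattern s (- 1))).
  rewrite -(law_event P (@measurable_pattern s _ _) (fun u => u t0)).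
  congr (fine (P _)); apply/seteqP; split => w /=; rewrite ffunE /exceeds;
    rewrite (_ : h.+1%:Z - 1 = h%:Z); [|lia| |lia].
    by move=> h'; apply/asboolP.
  by move/asboolP.
rewrite /exceed_cov expr2 -{1}E (mulrC (fine _)) /joint_prob.
rewrite (_ : mkset _ = [set w | A (erescale s (X 0 w))] `&` [set w | A (erescale s (X h%:Z w))]).
  by apply: mixing_rate_ge; apply: sA => //=.
by apply/seteqP; split => w /= [].
Qed.

End exceedances.

(** * Extremogram and exceedance covariances *)

Lemma limn_esup_lt {R : realType} (u : nat -> \bar R) (x : \bar R) :
  (limn_esup u < x)%E -> \forall n \near \oo, (u n < x)%E.
Proof.
move=> /ereal_inf_lt[_ [V nV <-] Vx]; apply: filterS nV => n Vn.
by apply: le_lt_trans Vx; apply: ereal_sup_ubound; exists n.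
Qed.

Section exceedance_limits.
Context {R : realType} {dsp : measure_display} {T : measurableType dsp}.
Variables (P : probability T R) (d : nat) (X : int -> T -> 'rV[R]_d).
Variables (N : 'rV[R]_d -> R) (alpha : R) (a : nat -> R).
Variable mu : forall h : nat, {measure set (borel 'M[\bar R]_(h.+1, d)) -> \bar R}.
Variables (A : set 'rV[\bar R]_d) (m r : nat -> nat).
Hypothesis norm_N : is_norm N.
Hypothesis X_meas : random_vectors X.
Hypothesis X_stat : strictly_stationary P X.
Hypothesis alpha_gt0 : 0 < alpha.
Hypothesis X_rv : regularly_varying P X N alpha a mu.
Hypothesis A_borel : measurable (A : set (borel 'rV[\bar R]_d)).
Hypothesis A_away : bounded_away A.
Hypothesis A_cont : continuity_set (mu 0%N) A.
Hypothesis A_cont_both : forall h : nat, (0 < h)%N ->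
  continuity_set (mu h) [set x | A (row ord0 x) /\ A (row ord_max x)].
Hypothesis A_pos : (0 < mu 0%N A)%E.
Hypothesis condM : condition_M P X N a m r.

Local Notation muA := (fine (mu 0%N A)).
Local Notation rho h := (extremogram P X A (h : nat)%:Z).

Let m_cvg : m n @[n --> \oo] --> \oo.
Proof. by have [_ [] ] := condM. Qed.

Let pairA h : set 'M[\bar R]_(h.+1, d) := [set x | A (row ord0 x) /\ A (row ord_max x)].
Arguments pairA : clear implicits.

Let pairA_away h : bounded_away (pairA h).
Proof.
have [e e0 Ae] := dist_of_bounded_away A_away.
apply: (@bounded_away_of_dist _ _ _ _ e) => // x [/Ae + _].
move=> /le_trans; apply; apply: mx_norm_le => [|i j]; first exact: normr_ge0.
by rewrite !mxE; apply: le_trans (mx_norm_ge _ ord0 j); rewrite !mxE.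
Qed.

Let pairA_measurable h : measurable (pairA h : set (borel 'M[\bar R]_(h.+1, d))).
Proof.
have mrow (i : 'I_h.+1) : measurable ([set x | A (row i x)] : set (borel 'M[\bar R]_(h.+1, d))).
  have := continuous_borel (@row_continuous R (\bar R) h.+1 d i).
  by move=> /(_ measurableT _ A_borel); rewrite setTI.
exact: measurableI (mrow ord0) (mrow ord_max).
Qed.

Let pairAE s h : joint_prob P X A s h =
  fine (P [set w | pairA h (erescale s (block X (fun i : 'I_h.+1 => i%:Z) w))]).
Proof.
congr (fine (P _)); apply/seteqP; split => w; rewrite /pairA /=.
  have rE (i : 'I_h.+1) : row i (erescale s (block X (fun i : 'I_h.+1 => i%:Z) w)) =
      erescale s (X (i : nat)%:Z w).
    by apply/matrixP => j k; rewrite !mxE ord1.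
  by rewrite !rE => -[].
have rE (i : 'I_h.+1) : row i (erescale s (block X (fun i : 'I_h.+1 => i%:Z) w)) =
    erescale s (X (i : nat)%:Z w).
  by apply/matrixP => j k; rewrite !mxE ord1.
by rewrite !rE => -[].
Qed.

Let singleAE s : exceed_prob P X A s =
  fine (P [set w | A (erescale s (block X (fun i : 'I_1 => i%:Z) w))]).
Proof. by congr (fine (P _)); apply/seteqP; split => w /=; rewrite block1E. Qed.

Lemma muA_gt0 : 0 < muA.
Proof.
rewrite fine_gt0// A_pos/=.
by have [_ _ /(_ 0%N)[[_ h] _ _ _]] := X_rv; exact: h.
Qed.

Let joint0 s : joint_prob P X A s 0 = exceed_prob P X A s.
Proof. by congr (fine (P _)); apply/seteqP; split => w /=; [case|by move=> h; split]. Qed.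

Let exceed_tail : exceed_prob P X A x / tail P X N x @[x --> +oo] --> muA.
Proof.
have := rv_cvg_real X_meas norm_N alpha_gt0 X_rv A_borel A_away A_cont.
by apply: cvg_trans; apply: near_eq_cvg; near=> x; rewrite singleAE.
Unshelve. all: by end_near. Qed.

Let limit_pair h : R := if h is 0%N then muA else fine (mu h (pairA h)).

Let joint_tail h : joint_prob P X A x h / tail P X N x @[x --> +oo] --> limit_pair h.
Proof.
case: h => [|h]; last first.
  have := rv_cvg_real X_meas norm_N alpha_gt0 X_rv (@pairA_measurable h.+1) (@pairA_away h.+1)
    (A_cont_both (ltn0Sn h)).
  by apply: cvg_trans; apply: near_eq_cvg; near=> x; rewrite pairAE.
move: exceed_tail.
by apply: cvg_trans; apply: near_eq_cvg; near=> x; rewrite joint0.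
Unshelve. all: by end_near. Qed.

(** The numerator and the denominator of the conditional probability are both of
  the order of the tail of the norm. *)
Lemma extremogram_limit h : rho h = limit_pair h / muA.
Proof.
have PF : ProperFilter (+oo : set_system R) by exact: proper_pinfty_nbhs.
apply: cvg_lim => //.
have H : (joint_prob P X A x h / tail P X N x) * (exceed_prob P X A x / tail P X N x)^-1
    @[x --> +oo] --> limit_pair h * muA^-1.
  apply: cvgM; first exact: joint_tail.
  by apply: cvgV exceed_tail; rewrite gt_eqF// muA_gt0.
apply: cvg_trans H; apply: near_eq_cvg; near=> x.
rewrite absz_nat -/(joint_prob P X A x h) -/(exceed_prob P X A x).
rewrite invfM invrK mulrACA [_ / _ * _]mulrC.
have t0 := tail_gt0 X_meas norm_N X_rv x.
by rewrite mulVf ?gt_eqF// mul1r.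
Unshelve. all: by end_near. Qed.

Lemma rho_ge0 h : 0 <= rho h.
Proof.
by rewrite extremogram_limit divr_ge0//; case: h => [|h] /=; rewrite fine_ge0.
Qed.

Lemma rhoN (h : int) : extremogram P X A (- h) = extremogram P X A h.
Proof. by rewrite /extremogram abszN. Qed.

Lemma exceed_prob_cvg : (m n)%:R * exceed_prob P X A (a (m n)) @[n --> \oo] --> muA.
Proof.
have := rv_cvg_seq X_meas X_rv m_cvg A_borel A_away A_cont.
by apply: cvg_trans; apply: near_eq_cvg; near=> x; rewrite singleAE.
Unshelve. all: by end_near. Qed.

Lemma joint_prob_cvg h :
  (m n)%:R * joint_prob P X A (a (m n)) h @[n --> \oo] --> muA * rho h.
Proof.
rewrite extremogram_limit mulrC divfK ?gt_eqF ?muA_gt0//.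
case: h => [|h]; last first.
  have := rv_cvg_seq X_meas X_rv m_cvg (@pairA_measurable h.+1) (@pairA_away h.+1)
    (A_cont_both (ltn0Sn h)).
  by apply: cvg_trans; apply: near_eq_cvg; near=> x; rewrite pairAE.
move: exceed_prob_cvg.
by apply: cvg_trans; apply: near_eq_cvg; near=> x; rewrite joint0.
Unshelve. all: by end_near. Qed.

Let m_ger (A0 : R) : \forall n \near \oo, A0 <= (m n)%:R.
Proof.
have /(@cvgrnyP R)/cvgryPge := m_cvg.
exact.
Qed.

Let m_inv_cvg0 : (m n)%:R^-1 @[n --> \oo] --> (0 : R).
Proof.
apply/cvgrPdist_le => e e0; near=> n.
have h : e^-1 <= (m n)%:R by near: n; exact: m_ger.
have e1 : 0 < e^-1 by rewrite invr_gt0.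
have m0 : 0 < (m n)%:R :> R by exact: lt_le_trans h.
rewrite sub0r normrN ger0_norm ?invr_ge0 ?ler0n// -[leRHS]invrK lef_pV2//.
Unshelve. all: by end_near. Qed.

(** Since m p converges, m p ^ 2 = (m p) ^ 2 / m. *)
Let mp2_cvg0 : (m n)%:R * exceed_prob P X A (a (m n)) ^+ 2 @[n --> \oo] --> (0 : R).
Proof.
have H : ((m n)%:R * exceed_prob P X A (a (m n))) * ((m n)%:R * exceed_prob P X A (a (m n)))
   * (m n)%:R^-1 @[n --> \oo] --> muA * muA * 0.
  apply: cvgM; last exact: m_inv_cvg0.
  apply: cvgM; exact: exceed_prob_cvg.
rewrite mulr0 in H; apply: cvg_trans H; apply: near_eq_cvg; near=> n.
have m0 : 0 < (m n)%:R :> R by apply: (@lt_le_trans _ _ 1) => //; near: n; exact: m_ger.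
by field; rewrite gt_eqF.
Unshelve. all: by end_near. Qed.

Lemma exceed_cov_cvg h :
  (m n)%:R * exceed_cov P X A (a (m n)) h @[n --> \oo] --> muA * rho h.
Proof.
have -> : (fun n => (m n)%:R * exceed_cov P X A (a (m n)) h) = (fun n =>
    (m n)%:R * joint_prob P X A (a (m n)) h - (m n)%:R * exceed_prob P X A (a (m n)) ^+ 2).
  by apply/funext => n; rewrite /exceed_cov mulrBr.
rewrite -[X in _ --> X]subr0; apply: cvgB; first exact: joint_prob_cvg.
exact: mp2_cvg0.
Qed.

Lemma mixing_rate_ge0 h : 0 <= mixing_rate P X h.
Proof.
exact: le_trans (normr_ge0 _) (exceed_cov_le X_meas X_stat A_borel 1 h).
Qed.

(** Beyond the lag [r n] the covariances are controlled by strong mixing. *)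
Lemma far_cov_cvg0 (e : R) : 0 < e -> \forall n \near \oo, forall l,
  (m n)%:R * \sum_(r n <= h < l) `|exceed_cov P X A (a (m n)) h| <= e.
Proof.
move=> e0; have [_ _ Hm _] := condM.
move: Hm => /fine_cvgP[fin] /cvgrPdist_le/(_ _ e0) H.
near=> n => l.
have fn : ((m n)%:R%:E * \sum_(r n <= h <oo) (mixing_rate P X h)%:E)%E \is a fin_num.
  by near: n.
have Hn : `|0 - fine ((m n)%:R%:E * \sum_(r n <= h <oo) (mixing_rate P X h)%:E)%E| <= e.
  by near: n; exact: H.
rewrite sub0r normrN in Hn.
apply: le_trans (le_trans (ler_norm _) Hn).
rewrite -lee_fin fineK// EFinM; apply: lee_wpmul2l; first by rewrite lee_fin.
apply: (@le_trans _ _ (\sum_(r n <= h < l) (mixing_rate P X h)%:E)%E).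
  rewrite sumEFin lee_fin; apply: ler_sum => h _.
  exact: exceed_cov_le.
apply: nneseries_lim_ge => h _ _; rewrite lee_fin; exact: mixing_rate_ge0.
Unshelve. all: by end_near. Qed.

Let measurable_both eps s h :
  measurable [set w | (eps * s < N (X h%:Z w))%R /\ (eps * s < N (X 0 w))%R].
Proof.
have mN : measurable_fun [set: borel 'rV[R]_d] (N : borel 'rV[R]_d -> R).
  by apply: continuous_borel_realfun; exact: is_norm_continuous.
have mt t : measurable [set w | eps * s < N (X t w)].
  have := measurableT_comp mN (X_meas t).
  move=> /(_ measurableT `]eps * s, +oo[%classic (measurable_itv _)); rewrite setTI.
  by congr measurable; apply/seteqP; split => w /=; rewrite in_itv/= andbT.
exact: (measurableI _ _ (mt h%:Z) (mt 0)).
Qed.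

Let measurable_jointset s h :
  measurable [set w | A (erescale s (X h%:Z w)) /\ A (erescale s (X 0 w))].
Proof.
have mt t : measurable [set w | A (erescale s (X t w))].
  have := X_meas t measurableT (measurable_exceedance A_borel s true); rewrite setTI.
  by congr measurable; apply/seteqP; split => w /= => [/asboolP//|h']; apply/asboolP.
exact: (measurableI _ _ (mt h%:Z) (mt 0)).
Qed.

Let joint_le_norm : exists2 eps : R, 0 < eps & forall s h, 0 < s ->
  ((joint_prob P X A s h)%:E <=
  P [set w | (eps * s < N (X h%:Z w))%R /\ (eps * s < N (X 0 w))%R])%E.
Proof.
have [eps eps0 Aeps] := bounded_away_sub_beyond norm_N A_away.
exists eps => // s h s0; rewrite /joint_prob fineK; last exact: fin_num_measure.
apply: le_measure; rewrite ?inE; [exact: measurable_jointset|exact: measurable_both|].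
by move=> w /= [/Aeps/(beyond_erescale norm_N _ _ s0) h1 /Aeps/(beyond_erescale norm_N _ _ s0) h2].
Qed.

(** The anti-clustering condition handles the lags up to [r n], strong mixing
  those beyond. *)
Lemma exceed_cov_tail (e : R) : 0 < e -> exists k, \forall n \near \oo,
  (m n)%:R * \sum_(k <= h < n) `|exceed_cov P X A (a (m n)) h| <= e.
Proof.
move=> e0; have [_ [_ _ _ rm] _ anti] := condM.
have [eps eps0 Jeps] := joint_le_norm.
have e3 : 0 < e / 3 by rewrite divr_gt0.
have [k Hk] : exists k, (limn_esup (fun n => (m n)%:R%:E * \sum_(k <= h < (r n).+1)
            P [set w | (eps * a (m n) < N (X h%:Z w))%R
              /\ (eps * a (m n) < N (X 0 w))%R]) < (e / 3)%:E)%E.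
  have := anti _ eps0 => /fine_cvgP[fin] /cvgrPdist_lt/(_ _ e3) H.
  have [k [f]] := @filter_ex _ \oo _ _ (filterI fin H).
  rewrite sub0r normrN => h; exists k.
  by rewrite -(fineK f) lte_fin (le_lt_trans (ler_norm _) h).
exists k; have near1 := limn_esup_lt Hk; have near2 := far_cov_cvg0 e3.
have rm1 : (r n).+1%:R * exceed_prob P X A (a (m n)) * ((m n)%:R * exceed_prob P X A (a (m n)))
    @[n --> \oo] --> (0 : R).
  have H : ((r n)%:R / (m n)%:R + (m n)%:R^-1) * ((m n)%:R * exceed_prob P X A (a (m n)))
      * ((m n)%:R * exceed_prob P X A (a (m n))) @[n --> \oo] --> (0 + 0) * muA * muA.
    apply: cvgM; last exact: exceed_prob_cvg.
    apply: cvgM; last exact: exceed_prob_cvg.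
    by apply: cvgD.
  rewrite addr0 !mul0r in H; apply: cvg_trans H; apply: near_eq_cvg; near=> n.
  have m0 : 0 < (m n)%:R :> R by apply: (@lt_le_trans _ _ 1) => //; near: n; exact: m_ger.
  by rewrite -natr1; field; rewrite gt_eqF.
move: rm1 => /cvgrPdist_le/(_ _ e3) near3.
have near4 : \forall n \near \oo, 0 < a (m n).
  by have [/cvgryPgt/(_ 0) a0 _ _] := X_rv; exact: m_cvg a0.
near=> n.
have am0 : 0 < a (m n) by near: n.
have h1 : ((m n)%:R%:E * \sum_(k <= h < (r n).+1)
            P [set w | (eps * a (m n) < N (X h%:Z w))%R
              /\ (eps * a (m n) < N (X 0 w))%R] < (e / 3)%:E)%E by near: n.
have h2 : forall l, (m n)%:R * \sum_(r n <= h < l) `|exceed_cov P X A (a (m n)) h| <= e / 3 by near: n.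
have h3 : `|0 - (r n).+1%:R * exceed_prob P X A (a (m n)) * ((m n)%:R * exceed_prob P X A (a (m n)))| <= e / 3 by near: n.
set q := exceed_prob P X A (a (m n)) in h3 *.
have h1' : (m n)%:R * \sum_(k <= h < (r n).+1) joint_prob P X A (a (m n)) h <= e / 3.
  rewrite -lee_fin; apply: le_trans (ltW h1); rewrite EFinM -sumEFin.
  apply: lee_wpmul2l; first by rewrite lee_fin.
  by apply: lee_sum => h _; exact: Jeps.
(* The lags from k to r, where the covariance is at most the joint probability
   plus the squared marginal one, and the lags from r on. *)
have split3 : \sum_(k <= h < n) `|exceed_cov P X A (a (m n)) h| <=
   \sum_(k <= h < (r n).+1) joint_prob P X A (a (m n)) h + (r n).+1%:R * q ^+ 2 +
   \sum_(r n <= h < n) `|exceed_cov P X A (a (m n)) h|.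
  have cle h : `|exceed_cov P X A (a (m n)) h| <= joint_prob P X A (a (m n)) h + q ^+ 2.
    apply: le_trans (ler_normB _ _) _.
    by rewrite (ger0_norm (sqr_ge0 _)) ger0_norm// fine_ge0.
  have mid : \sum_(k <= h < (r n).+1) `|exceed_cov P X A (a (m n)) h| <=
     \sum_(k <= h < (r n).+1) joint_prob P X A (a (m n)) h + (r n).+1%:R * q ^+ 2.
    apply: (@le_trans _ _ (\sum_(k <= h < (r n).+1) (joint_prob P X A (a (m n)) h + q ^+ 2))).
      by apply: ler_sum => h _.
    rewrite big_split/= lerD2l big_const_nat iter_addr_0 -[X in X <= _]mulr_natl.
    by rewrite ler_wpM2r ?sqr_ge0// ler_nat leq_subr.
  apply: le_trans (lerD mid (lexx _)).
  have [nr|rn] := leqP n (r n).+1.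
    rewrite -[leLHS]addr0 lerD//; last by apply: sumr_ge0 => h _.
    have [nk|kn] := leqP n k; first by rewrite big_geq// sumr_ge0.
    rewrite (@big_cat_nat _ _ _ n _ (r n).+1)//=; last exact: ltnW.
    by rewrite lerDl sumr_ge0.
  have [kr|rk] := leqP k (r n).+1.
    rewrite (@big_cat_nat _ _ _ (r n).+1 _ n)//=; last exact: ltnW.
    rewrite lerD2l (@big_cat_nat _ _ _ (r n).+1 (r n) n)//=; last exact: ltnW.
    by rewrite lerDr sumr_ge0.
  rewrite -[leLHS]add0r lerD ?sumr_ge0//.
  have [nk|kn] := leqP n k; first by rewrite [X in X <= _]big_geq// sumr_ge0.
  rewrite [leRHS](@big_cat_nat _ _ _ k _ n)//=; [|by apply: ltnW; apply: ltnW|exact: ltnW].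
  by rewrite lerDr sumr_ge0.
apply: le_trans (ler_wpM2l (ler0n _ _) split3) _.
rewrite !mulrDr; have := h2 n; move: h3; rewrite sub0r normrN => /(le_trans (ler_norm _)).
move=> h3 h2'; rewrite (_ : (m n)%:R * ((r n).+1%:R * q ^+ 2) = (r n).+1%:R * q * ((m n)%:R * q)).
  lra.
ring.
Unshelve. all: by end_near. Qed.

End exceedance_limits.

(** * Central limit theorem for a triangular array of rare events *)

Section triangular_array.
Context {R : realType}.
Variables (m r : nat -> nat) (p : forall n, {ffun 'I_n -> bool} -> R) (q xi : nat -> R).
Variables (cc : nat -> nat -> R) (gam : nat -> R).
Hypothesis p_ge0 : forall n u, 0 <= @p n u.
Hypothesis p_sum1 : forall n, \sum_u @p n u = 1.
Hypothesis q_itv : forall n, 0 <= q n <= 1.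
Hypothesis mean_J : forall n (t : 'I_n), mean (@p n) (centered (q n) t) = 0.
Hypothesis mean_JJ : forall n (s t : 'I_n),
  mean (@p n) (fun u => centered (q n) s u * centered (q n) t u) = cc n (dist s t).
Hypothesis mixing : forall n (a : nat) (Q1 Q2 : pred {ffun 'I_n -> bool}),
  depends_on (fun t : 'I_n => (t < a)%N) Q1 ->
  depends_on (fun t : 'I_n => (a + r n <= t)%N) Q2 ->
  `|cov (@p n) (fun u => (Q1 u)%:R) (fun u => (Q2 u)%:R)| <= xi n.
Hypothesis m_cvg : m n @[n --> \oo] --> \oo.
Hypothesis mn_cvg : (m n)%:R / n%:R @[n --> \oo] --> (0 : R).
Hypothesis rm_cvg : (r n)%:R / (m n)%:R @[n --> \oo] --> (0 : R).
Hypothesis kxi_cvg : (n %/ m n)%:R * xi n @[n --> \oo] --> (0 : R).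
Hypothesis m3_cvg : Num.sqrt (2 * (m n)%:R / n%:R) * (m n)%:R @[n --> \oo] --> (0 : R).
Hypothesis cc_cvg : forall h, (m n)%:R * cc n h @[n --> \oo] --> gam h.
Hypothesis cc_tail : forall e : R, 0 < e -> exists k, \forall n \near \oo,
  (m n)%:R * \sum_(k <= h < n) `|cc n h| <= e.
Hypothesis cc_far : forall e : R, 0 < e -> \forall n \near \oo, forall l,
  (m n)%:R * \sum_(r n <= h < l) `|cc n h| <= e.

Variables (K : nat) (x y : 'I_K -> R) (om : nat -> 'I_K -> R) (lam : 'I_K -> R).
Hypothesis om_diff : forall i j, i != j -> oscillating (fun n => om n i - om n j).
Hypothesis om_sum : forall i j, oscillating (fun n => om n i + om n j).
Hypothesis om_cvg : forall i, om n i @[n --> \oo] --> lam i.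
Variable L : R.
Hypothesis L_def :
  \sum_(h < n) lag_weight h * gam h * trig_autocov x y lam h @[n --> \oo] --> L.

Let kappa n : R := Num.sqrt (2 * (m n)%:R / n%:R).
Let w n (t : 'I_n) : R := trig_weight x y om n t.+1.
Let W : R := trig_bound x y.
Let small n : R := (n %/ m n * r n + m n)%N%:R.
Let Ctot n : R := \sum_(h < n) `|cc n h|.
Let Cfar n : R := \sum_(h < n | (r n <= h)%N) `|cc n h|.

Definition trig_total n (u : {ffun 'I_n -> bool}) : R :=
  \sum_(t < n) trig_weight x y om n t.+1 * centered (q n) t u.

Let kappa_sqr n : kappa n ^+ 2 = 2 * (m n)%:R / n%:R.
Proof. by rewrite sqr_sqrtr// divr_ge0. Qed.

Lemma trig_total_variance_cvg :
  kappa n ^+ 2 * mean (@p n) (fun u => trig_total u ^+ 2) @[n --> \oo] --> L.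
Proof.
have := variance_cvg cc_cvg cc_tail om_diff om_sum om_cvg L_def.
apply: cvg_trans; apply: near_eq_cvg; apply: nearW => n.
rewrite kappa_sqr; congr (_ * _).
by rewrite (@mean_sqr_sum _ _ _ (@p n) (@centered R n (q n)) (cc n) (@w n) (@mean_JJ n) xpredT).
Qed.

Let n_gt0 : \forall n \near \oo, 0 < n%:R :> R.
Proof. by near=> n; rewrite ltr0n; near: n; exact: nbhs_infty_gt. Unshelve. all: by end_near. Qed.

Let m_gt0 : \forall n \near \oo, (0 < m n)%N.
Proof. by have n1 : \forall n \near \oo, (0 < n)%N; [exists 1%N|exact: m_cvg n1]. Qed.

(** A fraction r / m of each block is dropped, and an incomplete block of fewer
  than m times. *)
Let small_cvg : small n / n%:R @[n --> \oo] --> (0 : R).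
Proof.
have H : (r n)%:R / (m n)%:R + (m n)%:R / n%:R @[n --> \oo] --> (0 + 0 : R) by exact: cvgD.
rewrite addr0 in H; apply: (squeeze_cvgr _ (cvg_cst 0) H).
near=> n; have n0 : 0 < n%:R :> R by near: n.
have m0 : (0 < m n)%N by near: n.
rewrite divr_ge0//= /small natrD mulrDl lerD2r natrM.
rewrite ler_pdivrMr// mulrAC ler_pdivlMr ?ltr0n// mulrAC (mulrC _ n%:R) ler_wpM2r//.
by rewrite -natrM ler_nat leq_divM.
Unshelve. all: by end_near. Qed.

Let small_tot_cvg : small n / n%:R * ((m n)%:R * Ctot n) @[n --> \oo] --> (0 : R).
Proof.
have [B [B0 HB]] := total_cov_bounded cc_cvg cc_tail.
have H : small n / n%:R * B @[n --> \oo] --> (0 * B : R).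
  by apply: cvgM; [exact: small_cvg|exact: cvg_cst].
rewrite mul0r in H; apply: (squeeze_cvgr _ (cvg_cst 0) H).
near=> n; have h : (m n)%:R * Ctot n <= B by near: n.
have C0 : 0 <= (m n)%:R * Ctot n by rewrite mulr_ge0// sumr_ge0.
have s0 : 0 <= small n / n%:R by rewrite divr_ge0.
by rewrite mulr_ge0//= ler_wpM2l.
Unshelve. all: by end_near. Qed.

Let far_cvg : (m n)%:R * Cfar n @[n --> \oo] --> (0 : R).
Proof.
apply/cvgrPdist_le => e e0; apply: filterS (cc_far e0) => n /(_ n).
rewrite big_geq_mkord/= -/(Cfar n) sub0r normrN ger0_norm//.
by rewrite mulr_ge0// sumr_ge0.
Qed.

Let gap n : R := kappa n ^+ 2 *
  (W ^+ 2 * (2 * small n * (2 * Ctot n) + n%:R * (2 * Cfar n))).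

Let gap_cvg : gap n @[n --> \oo] --> (0 : R).
Proof.
have H : W ^+ 2 * (8 * (small n / n%:R * ((m n)%:R * Ctot n)) + 4 * ((m n)%:R * Cfar n))
    @[n --> \oo] --> (W ^+ 2 * (8 * 0 + 4 * 0) : R).
  by apply: cvgMr; apply: cvgD; apply: cvgMr.
rewrite !mulr0 addr0 mulr0 in H; apply: cvg_trans H; apply: near_eq_cvg; near=> n.
have n0 : 0 < n%:R :> R by near: n.
by rewrite /gap kappa_sqr; field; rewrite gt_eqF.
Unshelve. all: by end_near. Qed.

Let err_cvg (e : R) : kappa n ^+ 2 * (W ^+ 2 * small n * (2 * Ctot n)) / e @[n --> \oo] --> (0 : R).
Proof.
have H : (4 * W ^+ 2) / e * (small n / n%:R * ((m n)%:R * Ctot n))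
    @[n --> \oo] --> ((4 * W ^+ 2) / e * 0 : R).
  by apply: cvgMr.
rewrite mulr0 in H; apply: cvg_trans H; apply: near_eq_cvg; near=> n.
have n0 : 0 < n%:R :> R by near: n.
rewrite kappa_sqr; have [->|e0] := eqVneq e 0; first by rewrite invr0 !mulr0 mul0r.
by field; rewrite e0 gt_eqF.
Unshelve. all: by end_near. Qed.

(** Every error in the blocking estimate is a product of a bounded factor, such
  as m times the total covariance, and one that tends to 0: the mixing
  coefficients times the number of blocks, the size of a block, the proportion
  of dropped times, or the covariances beyond lag r. *)
Theorem trig_total_clt (c0 : R) :
  mean (@p n) (fun u => cos (Num.sqrt (2 * (m n)%:R / n%:R) * trig_total u + c0))
    @[n --> \oo] --> expR (- (L / 2)) * cos c0.
Proof.
pose V n : R := kappa n ^+ 2 * mean (@p n) (fun u => trig_total u ^+ 2).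
have V_cvg : V n @[n --> \oo] --> L := trig_total_variance_cvg.
have W0 : 0 <= W := trig_bound_ge0 x y.
pose eta n : R := kappa n * W * (m n)%:R.
have eta_cvg : eta n @[n --> \oo] --> (0 : R).
  have H : W * (kappa n * (m n)%:R) @[n --> \oo] --> (W * 0 : R) by apply: cvgMr.
  rewrite mulr0 in H; apply: cvg_trans H; apply: near_eq_cvg; apply: nearW => n.
  by rewrite /eta; ring.
have lim_V : expR (- (V n / 2)) * cos c0 @[n --> \oo] --> expR (- (L / 2)) * cos c0.
  apply: cvgM; last exact: cvg_cst.
  apply: (@continuous_cvg _ _ _ _ _ (fun n => - (V n / 2)) expR); first exact: continuous_expR.
  by apply: cvgN; apply: cvgM => //; exact: cvg_cst.
suff D : mean (@p n) (fun u => cos (kappa n * trig_total u + c0)) - expR (- (V n / 2)) * cos c0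
    @[n --> \oo] --> (0 : R).
  have H : (mean (@p n) (fun u => cos (kappa n * trig_total u + c0)) -
      expR (- (V n / 2)) * cos c0) + expR (- (V n / 2)) * cos c0
      @[n --> \oo] --> 0 + expR (- (L / 2)) * cos c0 by exact: cvgD.
  rewrite add0r in H; apply: cvg_trans H; apply: near_eq_cvg.
  by apply: nearW => n /=; rewrite subrK.
apply/cvgrPdist_le => e e0; pose e' := e / 2; have e'0 : 0 < e' by rewrite /e' divr_gt0.
pose bound n : R := (n %/ m n)%:R * (2 * (4 * xi n)) + 3 * eta n * (V n + gap n) +
  (e' + kappa n ^+ 2 * (W ^+ 2 * small n * (2 * Ctot n)) / e') + gap n.
have bound_cvg : bound n @[n --> \oo] --> (8 * 0 + 3 * 0 * (L + 0) + (e' + 0) + 0 : R).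
  apply: cvgD => //; apply: cvgD; last by apply: cvgD; [exact: cvg_cst|exact: err_cvg].
  apply: cvgD.
    have H : 8 * ((n %/ m n)%:R * xi n) @[n --> \oo] --> (8 * 0 : R) by apply: cvgMr.
    by apply: cvg_trans H; apply: near_eq_cvg; apply: nearW => n; ring.
  apply: cvgM; first by apply: cvgMr.
  exact: cvgD.
have bE : 8 * 0 + 3 * 0 * (L + 0) + (e' + 0) + 0 = e' :> R by ring.
rewrite {}bE in bound_cvg.
move/cvgrPdist_le/(_ _ e'0) : bound_cvg => nearb.
have rm : \forall n \near \oo, (r n <= m n)%N.
  move/cvgrPdist_le/(_ _ ltr01) : rm_cvg => H; near=> n.
  have m0 : (0 < m n)%N by near: n.
  have : `|0 - (r n)%:R / (m n)%:R| <= 1 :> R by near: n.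
  by rewrite sub0r normrN ger0_norm ?divr_ge0// ler_pdivrMr ?ltr0n// mul1r ler_nat.
move/cvgrPdist_le/(_ _ ltr01) : eta_cvg => neareta.
near=> n; have m0 : (0 < m n)%N by near: n.
have r_le : (r n <= m n)%N by near: n.
have eta1 : eta n <= 1.
  have : `|0 - eta n| <= 1 by near: n.
  by rewrite sub0r normrN; exact: le_trans (ler_norm _).
have b1 : `|e' - bound n| <= e' by near: n.
rewrite sub0r normrN.
have block_le : kappa n * W * (m n)%:R <= eta n by [].
have := mean_cos_gaussian m0 r_le (@p_ge0 n) (@p_sum1 n) (q_itv n) (@mean_J n)
  (@mean_JJ n) (@mixing n) (fun t : 'I_n => trig_weight_le x y om n t.+1)
  (sqrtr_ge0 _ : 0 <= kappa n) eta1 W0 block_le c0 e'0.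
move=> /le_trans; apply; rewrite -/(bound n).
by move: b1; rewrite ler_norml => /andP[]; rewrite /e'; lra.
Unshelve. all: by end_near. Qed.

End triangular_array.

(** * The spectral density as a cosine series *)

Section spectral_density_series.
Context {R : realType} (rho : int -> R).
Hypothesis rhoN : forall h, rho (- h) = rho h.
Hypothesis rho_ge0 : forall h : nat, 0 <= rho h%:Z.
Hypothesis rho_sum : (\sum_(1 <= h <oo) (rho h%:Z)%:E < +oo)%E.

(** The terms of index h and - h are equal. *)
Lemma spectral_psumE lam n : complex.Re (spectral_psum rho lam n) =
  \sum_(h < n.+1) lag_weight h * rho h%:Z * cos (lam * h%:R).
Proof.
rewrite /spectral_psum raddf_sum/=.
pose F (h : int) : R := rho h * cos (lam * h%:~R).
have FN h : F (- h) = F h by rewrite /F rhoN rmorphN/= mulrN cosN.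
transitivity (\sum_(0 <= j < n.*2.+1) F (j%:Z - n%:Z)).
  rewrite big_mkord; apply: eq_bigr => j _.
  by rewrite /F /= mul0r subr0 cosN mulrC [lam * _]mulrC mulrC.
rewrite -addnn -addnS (@big_cat_nat _ _ _ n)//= ?leq_addr//.
rewrite -{3}[n]add0n big_addn addnC addnK.
rewrite big_nat_rev/= add0n.
rewrite [X in X + _](_ : _ = \sum_(0 <= i < n) F (i.+1)%:Z); last first.
  apply: eq_big_nat => i /andP[_ iN]; rewrite -FN; congr F.
  by lia.
rewrite [X in _ + X](_ : _ = \sum_(0 <= i < n.+1) F i%:Z); last first.
  apply: eq_bigr => i _; congr F; by lia.
rewrite [X in _ + X]big_nat_recl//= addrCA -big_split/=.
rewrite -(big_mkord xpredT (fun h : nat => lag_weight h * rho h%:Z * cos (lam * h%:R))).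
rewrite [RHS]big_nat_recl//=; congr (_ + _).
  by rewrite /lag_weight/= /F mul1r.
by apply: eq_bigr => i _; rewrite /lag_weight/= /F; ring.
Qed.

Let term lam (h : nat) : R := lag_weight h * rho h%:Z * cos (lam * h%:R).

(** The series converges absolutely because the extremogram is summable. *)
Lemma spectral_series_cvg lam :
  \sum_(h < n) lag_weight h * rho h%:Z * cos (lam * h%:R) @[n --> \oo] -->
  spectral_density rho lam.
Proof.
have crho : cvgn (series (fun h => rho h%:Z)).
  apply: nondecreasing_is_cvgn.
    by apply/nondecreasing_seqP => n; rewrite /series/= big_nat_recr//= lerDl.
  exists (rho 0 + fine (\sum_(1 <= h <oo) (rho h%:Z)%:E)%E) => _ [n _ <-].
  rewrite /series/=; case: n => [|n].
    rewrite big_geq// addr_ge0// ?rho_ge0// fine_ge0//.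
    by apply: nneseries_ge0 => h _ _; rewrite lee_fin.
  rewrite big_nat_recl//= lerD2l -lee_fin fineK; last first.
    rewrite ge0_fin_numE//.
    by apply: nneseries_ge0 => h _ _; rewrite lee_fin.
  rewrite -sumEFin.
  have := @nneseries_lim_ge R (fun h => (rho h%:Z)%:E) xpredT 1 n.+1.
  rewrite big_add1/=; apply.
  by move=> h _ _; rewrite lee_fin.
have cterm : cvgn (series (term lam)).
  apply: normed_cvg.
  apply: (@series_le_cvg _ _ (fun h => 2 * rho h%:Z)).
  - by move=> h; exact: normr_ge0.
  - by move=> h; rewrite mulr_ge0.
  - move=> h /=; rewrite /term !normrM (ger0_norm (rho_ge0 h)).
    rewrite -[leRHS]mulr1; apply: ler_pM => //.
    + by rewrite mulr_ge0.
    + rewrite ler_wpM2r// /lag_weight; case: ifP => _; rewrite ger0_norm ?ler1n//.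
    + by rewrite ler_norml cos_geN1 cos_le1.
  rewrite (_ : series _ = (fun n => 2 * series (fun h => rho h%:Z) n)); last first.
    by apply/funext => n; rewrite /series/= mulr_sumr.
  by apply: is_cvgMr.
have sE : (fun n => \sum_(h < n) lag_weight h * rho h%:Z * cos (lam * h%:R)) = series (term lam).
  by apply/funext => n; rewrite /series/= big_mkord.
have H : \sum_(h < n) lag_weight h * rho h%:Z * cos (lam * h%:R) @[n --> \oo] --> limn (series (term lam)).
  by rewrite sE.
suff -> : spectral_density rho lam = limn (series (term lam)) by [].
apply: cvg_lim => //.
rewrite (_ : (fun n => complex.Re (spectral_psum rho lam n)) = [sequence series (term lam) n.+1]_n).
  by rewrite cvg_shiftS.
by apply/funext => n; rewrite spectral_psumE /= /series/= big_mkord.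
Qed.

End spectral_density_series.

(** * Convergence of the periodogram ordinates *)

Section periodogram_limit.
Context {R : realType} {dsp : measure_display} {T : measurableType dsp}.
Variables (P : probability T R) (d : nat) (X : int -> T -> 'rV[R]_d).
Variables (N : 'rV[R]_d -> R) (alpha : R) (a : nat -> R).
Variable mu : forall h : nat, {measure set (borel 'M[\bar R]_(h.+1, d)) -> \bar R}.
Variables (A : set 'rV[\bar R]_d) (m r : nat -> nat).
Hypothesis norm_N : is_norm N.
Hypothesis X_meas : random_vectors X.
Hypothesis X_stat : strictly_stationary P X.
Hypothesis alpha_gt0 : 0 < alpha.
Hypothesis X_rv : regularly_varying P X N alpha a mu.
Hypothesis A_borel : measurable (A : set (borel 'rV[\bar R]_d)).
Hypothesis A_away : bounded_away A.
Hypothesis A_cont : continuity_set (mu 0%N) A.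
Hypothesis A_cont_both : forall h : nat, (0 < h)%N ->
  continuity_set (mu h) [set x | A (row ord0 x) /\ A (row ord_max x)].
Hypothesis A_pos : (0 < mu 0%N A)%E.
Hypothesis condM : condition_M P X N a m r.
Hypothesis condM1 : condition_M1 P X m r.
Hypothesis rho_summable : (\sum_(1 <= h <oo) (extremogram P X A h%:Z)%:E < +oo)%E.

Variables (K : nat) (om : nat -> 'I_K -> R) (lam : 'I_K -> R).
Hypothesis om_diff : forall i j, i != j -> oscillating (fun n => om n i - om n j).
Hypothesis om_sum : forall i j, oscillating (fun n => om n i + om n j).
Hypothesis om_cvg : forall i, om n i @[n --> \oo] --> lam i.

Local Notation muA := (fine (mu 0%N A)).
Local Notation f_A := (spectral_density (extremogram P X A)).
Let s n := a (m n).
Let q n := exceed_prob P X A (s n).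
Let cc n := exceed_cov P X A (s n).
Let gam (h : nat) := muA * extremogram P X A h%:Z.
Let p (n : nat) : {ffun 'I_n -> bool} -> R := law P (pattern X A (s n) n 0).
Arguments p : clear implicits.
Let kappa n : R := Num.sqrt (2 * (m n)%:R / n%:R).

Let mpat n u := measurable_pattern X_meas A_borel (s n) (0 : int) (n := n) u.

Let p_ge0 n u : 0 <= p n u. Proof. exact: law_ge0. Qed.
Let p_sum1 n : \sum_u p n u = 1. Proof. exact (law_sum1 P (@mpat n)). Qed.

(** The limiting variance of the linear functional with coefficients x on the
  cosines and y on the sines; the frequencies no longer interact. *)
Let limit_var (x y : 'I_K -> R) : R :=
  \sum_i (x i ^+ 2 + y i ^+ 2) * (muA * f_A (lam i)).

Let limit_varE x y :
  \sum_(h < n) lag_weight h * gam h * trig_autocov x y lam h @[n --> \oo] --> limit_var x y.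
Proof.
have -> : (fun n => \sum_(h < n) lag_weight h * gam h * trig_autocov x y lam h) = (fun n =>
   \sum_i (x i ^+ 2 + y i ^+ 2) * (muA * \sum_(h < n) lag_weight h * extremogram P X A h%:Z * cos (lam i * h%:R))).
  apply/funext => n; under [RHS]eq_bigr do rewrite !mulr_sumr.
  rewrite exchange_big/=; apply: eq_bigr => h _; rewrite mulr_sumr; apply: eq_bigr => i _.
  by rewrite /gam; ring.
apply: (@cvg_sum_fin R nat \oo eventually_filter _ _ _ _ _) => i.
apply: cvgMr; apply: cvgMr; apply: spectral_series_cvg => //.
- by move=> h; exact: rhoN.
- by move=> h; exact: (rho_ge0 norm_N X_meas alpha_gt0 X_rv A_borel A_away A_cont A_cont_both A_pos).
Qed.

Let m_cvg : m n @[n --> \oo] --> \oo. Proof. by have [_ []] := condM. Qed.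

Let cc_cvg h : (m n)%:R * cc n h @[n --> \oo] --> gam h.
Proof. exact (@exceed_cov_cvg _ _ _ _ _ _ _ _ _ _ _ _ _ norm_N X_meas alpha_gt0 X_rv A_borel A_away A_cont A_cont_both A_pos condM h). Qed.

Let cc_tail (e : R) : 0 < e -> exists k, \forall n \near \oo,
  (m n)%:R * \sum_(k <= h < n) `|cc n h| <= e.
Proof. exact: (exceed_cov_tail norm_N X_meas X_stat X_rv A_borel A_away A_cont condM). Qed.

Let cc_far (e : R) : 0 < e -> \forall n \near \oo, forall l,
  (m n)%:R * \sum_(r n <= h < l) `|cc n h| <= e.
Proof. exact: (far_cov_cvg0 X_meas X_stat A_borel condM). Qed.

(** The left-hand side is the square root of 2 m ^ 3 / n, and m = o (n ^ (1 /
  3)). *)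
Let m3_cvg : kappa n * (m n)%:R @[n --> \oo] --> (0 : R).
Proof.
have [_ M1] := condM1.
have H : Num.sqrt (2 * ((m n)%:R / (n%:R `^ 3^-1)) ^+ 3) @[n --> \oo] --> Num.sqrt (2 * 0 ^+ 3 : R).
  apply: (@continuous_cvg _ _ _ _ _ (fun n => 2 * ((m n)%:R / (n%:R `^ 3^-1)) ^+ 3) Num.sqrt).
    exact: sqrt_continuous.
  by apply: cvgMr; rewrite !exprS !expr0 !mulr1; apply: cvgM => //; exact: cvgM.
rewrite expr0n/= mulr0 sqrtr0 in H; apply: cvg_trans H; apply: near_eq_cvg; near=> n.
have n0 : 0 < n%:R :> R by rewrite ltr0n; near: n; exact: nbhs_infty_gt.
have p3 : (n%:R `^ 3^-1) ^+ 3 = n%:R :> R.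
  by rewrite -powR_mulrn ?powR_ge0// -powRrM mulVf// powRr1// ltW.
rewrite expr_div_n p3; have -> : kappa n * (m n)%:R = kappa n * Num.sqrt ((m n)%:R ^+ 2).
  by rewrite sqrtr_sqr ger0_norm.
rewrite /kappa -sqrtrM ?divr_ge0 ?mulr_ge0//; congr Num.sqrt.
by field; rewrite gt_eqF.
Unshelve. all: by end_near. Qed.

Let mean_J n (t : 'I_n) : mean (p n) (centered (q n) t) = 0.
Proof. exact: (mean_centered X_meas X_stat A_borel). Qed.

Let mean_JJ n (t t' : 'I_n) :
  mean (p n) (fun u => centered (q n) t u * centered (q n) t' u) = cc n (dist t t').
Proof. exact: (mean_centered2 X_meas X_stat A_borel). Qed.

Let mn_cvg : (m n)%:R / n%:R @[n --> \oo] --> (0 : R).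
Proof. by have [_ []] := condM. Qed.

Let rm_cvg : (r n)%:R / (m n)%:R @[n --> \oo] --> (0 : R).
Proof. by have [_ []] := condM. Qed.

Let kxi_cvg : (n %/ m n)%:R * mixing_rate P X (r n) @[n --> \oo] --> (0 : R).
Proof. by have [] := condM1. Qed.

Let mixing n (b : nat) (Q1 Q2 : pred {ffun 'I_n -> bool}) :
  depends_on (fun t : 'I_n => (t < b)%N) Q1 ->
  depends_on (fun t : 'I_n => (b + r n <= t)%N) Q2 ->
  `|cov (p n) (fun u => (Q1 u)%:R) (fun u => (Q2 u)%:R)| <= mixing_rate P X (r n).
Proof. exact: (pattern_mixing X_meas X_stat A_borel). Qed.

Local Notation total x y n u := (@trig_total R q K x y om n u).

Let clt x y c0 : mean (p n) (fun u => cos (kappa n * total x y n u + c0))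
  @[n --> \oo] --> expR (- (limit_var x y / 2)) * cos c0.
Proof.
exact (trig_total_clt p_ge0 p_sum1 (fun n => exceed_prob_itv P X_meas A_borel (s n)) mean_J mean_JJ
  mixing m_cvg mn_cvg rm_cvg kxi_cvg m3_cvg cc_cvg cc_tail cc_far om_diff om_sum om_cvg (@limit_varE x y) (c0 := c0)).
Qed.

Let var_cvg x y : mean (p n) (fun u => (kappa n * total x y n u) ^+ 2)
  @[n --> \oo] --> limit_var x y.
Proof.
have := trig_total_variance_cvg mean_JJ cc_cvg cc_tail om_diff om_sum om_cvg (@limit_varE x y).
apply: cvg_trans; apply: near_eq_cvg; apply: nearW => n.
rewrite -/(kappa n) -meanZ; apply: eq_mean => u; by rewrite exprMn.
Qed.

(** Up to the factor mu A, a value of the spectral density is a limit of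
  variances. *)
Lemma spectral_density_ge0 i : 0 <= f_A (lam i).
Proof.
have mu0 := muA_gt0 X_rv A_borel A_away A_pos.
have := @var_cvg (fun j => (j == i)%:R) (fun=> 0).
have -> : limit_var (fun j => (j == i)%:R) (fun=> 0) = muA * f_A (lam i).
  rewrite /limit_var (bigD1 i)//= eqxx expr1n expr0n/= addr0 mul1r big1 ?addr0// => j ji.
  by rewrite (negbTE ji) !expr0n/= addr0 mul0r.
move=> H; suff : 0 <= muA * f_A (lam i) by rewrite pmulr_rge0.
apply: (cvgr_to_ge H); apply: nearW => n.
by apply: sumr_ge0 => u _; rewrite mulr_ge0// sqr_ge0.
Qed.

Let mu_f_ge0 i : 0 <= muA * f_A (lam i).
Proof. by rewrite mulr_ge0 ?spectral_density_ge0 ?fine_ge0. Qed.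

Let Sigma : 'M[R]_(K * 2) :=
    muA *: diag_mx (mxvec (\matrix_(i < K, j < 2) f_A (lam i))).

Let stddev : 'rV[R]_(K * 2) := mxvec (\matrix_(i < K, j < 2) Num.sqrt (muA * f_A (lam i))).

Let stddevE : (diag_mx stddev)^T *m diag_mx stddev = Sigma.
Proof.
rewrite tr_diag_mx mulmx_diag /Sigma; apply/matrixP => k l; rewrite !mxE mulrnAr.
congr (_ *+ _); case/mxvec_indexP: k => i j; rewrite /stddev !mxvecE !mxE -expr2 sqr_sqrtr//.
Qed.

Let coord (b : 'I_2) (t : 'rV[R]_(K * 2)) (i : 'I_K) : R := t 0 (mxvec_index i b).

Lemma dotp_mxvec (t : 'rV[R]_(K * 2)) (M : 'M[R]_(K, 2)) :
  dotp t (mxvec M) = \sum_i (coord 0 t i * M i 0 + coord 1 t i * M i 1).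
Proof.
rewrite /dotp (reindex _ (curry_mxvec_bij _ _))/=.
transitivity (\sum_(i < K) \sum_(j < 2) t 0 (mxvec_index i j) * M i j).
  by rewrite pair_bigA; apply: eq_bigr => -[i j] _; rewrite /= mxvecE.
apply: eq_bigr => i _; rewrite !big_ord_recl big_ord0 addr0 /coord.
by rewrite (_ : lift ord0 ord0 = 1)//; apply/val_inj.
Qed.

Let limit_char (t : 'rV[R]_(K * 2)) :
  dotp (t *m (diag_mx stddev)^T) (t *m (diag_mx stddev)^T) =
  limit_var (coord 0 t) (coord 1 t).
Proof.
have -> : t *m (diag_mx stddev)^T = mxvec (\matrix_(i, j)
    (t 0 (mxvec_index i j) * Num.sqrt (muA * f_A (lam i)))).
  rewrite tr_diag_mx; apply/rowP => k; case/mxvec_indexP: k => i j.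
  rewrite mul_mx_diag mxvecE !mxE /stddev mxvecE mxE //.
rewrite dotp_mxvec; apply: eq_bigr => i _; rewrite /coord !mxvecE !mxE.
have -> : muA * f_A (lam i) = Num.sqrt (muA * f_A (lam i)) ^+ 2.
  by rewrite sqr_sqrtr.
rewrite sqrtr_sqr ger0_norm ?sqrtr_ge0//; ring.
Qed.

Let z n (u : {ffun 'I_n -> bool}) : 'rV[R]_(K * 2) :=
  mxvec (\matrix_(i < K, j < 2)
    if j == 0 then kappa n * \sum_(t < n) centered (q n) t u * cos (om n i * t.+1%:R)
    else kappa n * \sum_(t < n) centered (q n) t u * sin (om n i * t.+1%:R)).
Arguments z : clear implicits.

(** A linear functional of the periodogram ordinates is a weighted sum of the
  centered exceedances, with trigonometric weights. *)
Let dotp_z n u t : dotp t (z n u) = kappa n * total (coord 0 t) (coord 1 t) n u.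
Proof.
rewrite dotp_mxvec /trig_total /trig_weight.
under [in RHS]eq_bigr do rewrite mulr_suml.
rewrite exchange_big/= mulr_sumr; apply: eq_bigr => i _; rewrite !mxE/=.
rewrite !mulrA ![_ * kappa n]mulrC -!mulrA -mulrDr; congr (_ * _).
rewrite !mulr_sumr -big_split/=; apply: eq_bigr => j _; ring.
Qed.

Let Z_nE n w : Z_n P X a m A n (om n) w = z n (pattern X A (s n) n 0 w).
Proof.
have cE (t : 'I_n) : centered_exceedance P X a m A n t.+1 w =
    centered (q n) t (pattern X A (s n) n 0 w).
  rewrite /centered_exceedance /centered /q /exceed_prob /s; congr (_ - _).
  by rewrite ffunE addr0 indicE.
rewrite /Z_n /z; congr mxvec; apply/matrixP => i j; rewrite !mxE.
case: ifP => _; rewrite /alpha_n /beta_n big_add1/= big_mkord;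
  by congr (_ * _); apply: eq_bigr => t _; rewrite cE.
Qed.

(** Each coordinate is a linear functional whose variance converges. *)
Let tight : exists2 B : R, 0 <= B & \forall n \near \oo,
  forall k, mean (p n) (fun u => z n u 0 k ^+ 2) <= B.
Proof.
pose V k := limit_var (coord 0 (delta_mx 0 k)) (coord 1 (delta_mx 0 k)).
exists (\sum_k (`|V k| + 1)).
  by apply: sumr_ge0 => k _; rewrite addr_ge0.
apply: filter_forall => k.
have := @var_cvg (coord 0 (delta_mx 0 k)) (coord 1 (delta_mx 0 k)).
move/cvgrPdist_le/(_ _ ltr01); apply: filterS => n H.
apply: (@le_trans _ _ (`|V k| + 1)); last first.
  rewrite (bigD1 k)//= lerDl sumr_ge0// => j _; by rewrite addr_ge0.
rewrite (eq_mean _ (G := fun u => (kappa n * total (coord 0 (delta_mx 0 k)) (coord 1 (delta_mx 0 k)) n u) ^+ 2)).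
  move: H; rewrite ler_norml -/(V k) => /andP[H _]; have := ler_norm (V k); lra.
move=> u; rewrite -dotp_z; congr (_ ^+ 2).
rewrite /dotp (bigD1 k)//= mxE !eqxx mul1r big1 ?addr0// => j jk.
by rewrite mxE (negbTE jk) andbF mul0r.
Qed.

(** Linear functionals have Gaussian limits, and their characteristic functions
  determine the limit law. The sequence of ordinates is tight because its second
  moments converge. *)
Theorem periodogram_clt : exists nu : probability (borel 'rV[R]_(K * 2)) R,
  is_normal nu 0 Sigma /\ cvg_in_distribution P (fun n => Z_n P X a m A n (om n)) nu.
Proof.
have [nu [nuN nuC]] := normal_exists (diag_mx stddev).
exists nu; split; first by rewrite -stddevE.
move=> f cf [b fb].
have char_cvg t c : mean (p n) (fun u => cos (dotp t (z n u) + c)) @[n --> \oo] -->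
    \int[nu]_x cos (dotp t x + c).
  rewrite nuC limit_char; have := @clt (coord 0 t) (coord 1 t) c.
  apply: cvg_trans; apply: near_eq_cvg; apply: nearW => n.
  by apply: eq_mean => u; rewrite dotp_z.
have H := levy_continuity p_ge0 p_sum1 char_cvg tight cf fb.
have -> : (\int[nu]_x (f x)%:E)%E = (\int[nu]_x f x)%:E.
  rewrite /Rintegral fineK//; apply: integrable_fin_num => //.
  exact: integrable_bounded_continuous cf fb.
have -> : (fun n => \int[P]_w (f (Z_n P X a m A n (om n) w))%:E)%E =
    (fun n => (mean (p n) (fun u => f (z n u)))%:E).
  apply/funext => n; rewrite -(integral_finite P (@mpat n)).
  by apply: eq_integral => w _; rewrite Z_nE.
by apply: cvg_EFin; [exact: nearW|exact: H].
Qed.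

End periodogram_limit.

(** * Fixed and Fourier frequencies *)

Section frequencies.
Context {R : realType}.

Lemma sin_neq0 (x : R) : x != 0 -> `|x| < pi -> sin x != 0.
Proof.
move=> x0 xpi; have [xp|xn] := ltP 0 x.
  by rewrite gt_eqF// sin_gt0_pi// xp/= -(gtr0_norm xp).
have xn' : x < 0 by rewrite lt_neqAle x0.
by rewrite -oppr_eq0 -sinN gt_eqF// sin_gt0_pi// oppr_gt0 xn'/= -(ltr0_norm xn').
Qed.

Lemma fourier_frequencyD n (x y : R) :
  fourier_frequency n x -> fourier_frequency n y -> fourier_frequency n (x + y).
Proof. by move=> [j ->] [k ->]; exists (j + k); rewrite rmorphD/=; ring. Qed.

Lemma fourier_frequencyB n (x y : R) :
  fourier_frequency n x -> fourier_frequency n y -> fourier_frequency n (x - y).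
Proof. by move=> [j ->] [k ->]; exists (j - k); rewrite rmorphB/=; ring. Qed.

Variables (K : nat) (lam : 'I_K -> R).
Hypothesis lam_itv : forall i, 0 < lam i < pi.

(** The difference lies strictly between - 2 pi and 2 pi, and it is not 0. *)
Lemma fixed_oscillating_diff (i j : 'I_K) : injective lam -> i != j ->
  oscillating (fun=> lam i - lam j).
Proof.
move=> lam_inj ij; apply: oscillating_fixed; apply: sin_neq0.
  rewrite mulf_neq0// ?invr_neq0// subr_eq0.
  by apply: contra_neq ij; exact: lam_inj.
have /andP[i0 i1] := lam_itv i; have /andP[j0 j1] := lam_itv j.
by rewrite ltr_norml; apply/andP; split; lra.
Qed.

Lemma fixed_oscillating_sum (i j : 'I_K) : oscillating (fun=> lam i + lam j).
Proof.
have /andP[i0 i1] := lam_itv i; have /andP[j0 j1] := lam_itv j.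
apply: oscillating_fixed; apply: sin_neq0; first by rewrite gt_eqF//; lra.
by rewrite ltr_norml; apply/andP; split; lra.
Qed.

Variable om : nat -> 'I_K -> R.
Hypothesis om_fourier : \forall n \near \oo,
  injective (om n) /\ forall i, fourier_frequency n (om n i).
Hypothesis om_cvg : forall i, om n i @[n --> \oo] --> lam i.

Let om_itv i : \forall n \near \oo, 0 < om n i < pi.
Proof.
have /andP[i0 i1] := lam_itv i.
near=> n; apply/andP; split; near: n.
  by apply: (cvgr_gt (lam i)) => //; exact: om_cvg.
by apply: (cvgr_lt (lam i)) => //; exact: om_cvg.
Unshelve. all: by end_near. Qed.

(** Distinct Fourier frequencies may have the same limit, in which case their
  difference tends to 0; but it stays a nonzero Fourier frequency, along which
  cosines sum to exactly 0. *)
Lemma fourier_oscillating_diff (i j : 'I_K) : i != j ->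
  oscillating (fun n => om n i - om n j).
Proof.
move=> ij; apply: oscillating_fourier.
near=> n; have [inj four] : injective (om n) /\ forall i, fourier_frequency n (om n i) by near: n.
have /andP[i0 i1] : 0 < om n i < pi by near: n; exact: om_itv.
have /andP[j0 j1] : 0 < om n j < pi by near: n; exact: om_itv.
split; first exact: fourier_frequencyB.
apply: sin_neq0; last by rewrite ltr_norml; apply/andP; split; lra.
rewrite mulf_neq0// ?invr_neq0// subr_eq0.
by apply: contra_neq ij; exact: inj.
Unshelve. all: by end_near. Qed.

Lemma fourier_oscillating_sum (i j : 'I_K) : oscillating (fun n => om n i + om n j).
Proof.
apply: oscillating_fourier.
near=> n; have [inj four] : injective (om n) /\ forall i, fourier_frequency n (om n i) by near: n.
have /andP[i0 i1] : 0 < om n i < pi by near: n; exact: om_itv.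
have /andP[j0 j1] : 0 < om n j < pi by near: n; exact: om_itv.
split; first exact: fourier_frequencyD.
apply: sin_neq0; first by rewrite gt_eqF//; lra.
by rewrite ltr_norml; apply/andP; split; lra.
Unshelve. all: by end_near. Qed.

End frequencies.

Theorem theorem4p4
  (R : realType) (dsp : measure_display) (T : measurableType dsp)
  (P : probability T R) (d : nat) (X : int -> T -> 'rV[R]_d)
  (N : 'rV[R]_d -> R) (alpha : R) (a : nat -> R)
  (mu : forall h : nat, {measure set (borel 'M[\bar R]_(h.+1, d)) -> \bar R})
  (A : set 'rV[\bar R]_d) (m r : nat -> nat) (K : nat)
  (norm_N : is_norm N)
  (X_meas : random_vectors X)
  (X_stat : strictly_stationary P X)
  (alpha_gt0 : 0 < alpha)
  (X_rv : regularly_varying P X N alpha a mu)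
  (A_borel : measurable (A : set (borel 'rV[\bar R]_d)))
  (A_away : bounded_away A)
  (A_cont : continuity_set (mu 0%N) A)
  (A_cont_first : forall h : nat, (0 < h)%N ->
    continuity_set (mu h) [set x | A (row ord0 x)])
  (A_cont_both : forall h : nat, (0 < h)%N ->
    continuity_set (mu h) [set x | A (row ord0 x) /\ A (row ord_max x)])
  (A_pos : (0 < mu 0%N A)%E)
  (condM : condition_M P X N a m r)
  (condM1 : condition_M1 P X m r)
  (rho_summable : (\sum_(1 <= h <oo) (extremogram P X A h%:Z)%:E < +oo)%E)
  (K_gt0 : (0 < K)%N) :
  let f_A := spectral_density (extremogram P X A) in
  let Sigma (lambda : 'I_K -> R) : 'M[R]_(K * 2) :=
    fine (mu 0%N A) *: diag_mx (mxvec (\matrix_(i < K, j < 2) f_A (lambda i))) in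
  (forall lambda : 'I_K -> R,
     (forall i j : 'I_K, (i < j)%N -> lambda i < lambda j) ->
     (forall i, 0 < lambda i < pi) ->
     exists nu : probability (borel 'rV[R]_(K * 2)) R,
       is_normal nu 0 (Sigma lambda) /\
       cvg_in_distribution P (fun n => Z_n P X a m A n lambda) nu)
  /\
  (forall (lambda : 'I_K -> R) (omega : nat -> 'I_K -> R),
     (forall i, 0 < lambda i < pi) ->
     (\forall n \near \oo,
        injective (omega n) /\ forall i, fourier_frequency n (omega n i)) ->
     (forall i, omega n i @[n --> \oo] --> lambda i) ->
     exists nu : probability (borel 'rV[R]_(K * 2)) R,
       is_normal nu 0 (Sigma lambda) /\
       cvg_in_distribution P (fun n => Z_n P X a m A n (omega n)) nu).
Proof.
move=> f_A Sigma; split=> [lambda mono lam_itv|lambda omega lam_itv om_f om_cvg].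
  have lam_inj : injective lambda.
    move=> i j ij; apply/val_inj; case: (ltngtP i j) => // /mono; by rewrite ij ltxx.
  apply: (periodogram_clt norm_N X_meas X_stat alpha_gt0 X_rv A_borel A_away A_cont A_cont_both
    A_pos condM condM1 rho_summable (om := fun=> lambda)).
  - by move=> i j; exact: fixed_oscillating_diff.
  - by move=> i j; exact: fixed_oscillating_sum.
  - by move=> i; exact: cvg_cst.
apply: (periodogram_clt norm_N X_meas X_stat alpha_gt0 X_rv A_borel A_away A_cont A_cont_both
  A_pos condM condM1 rho_summable (om := omega)) => //.
- by move=> i j; exact: (fourier_oscillating_diff lam_itv om_f om_cvg).
- by move=> i j; exact: (fourier_oscillating_sum lam_itv om_f om_cvg).
Qed.
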